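(* Let $A$ be a locally finite, connected graded algebra generated in degree 1, and let $d\ge 2$. Then $A$ is a bi-Koszul algebra (determined by $\varDelta_d$) if and only if every $A_\infty$-algebra structure on $E(A)$ is reduced.
   Context: Fix a field $\mathbb F$; $A=\mathbb F\oplus A_1\oplus A_2\oplus\cdots$, and $\mathbb F$ also denotes the trivial graded left module $A/A_{\ge 1}$. Put $E(A)=\bigoplus_{p,j}E^p_j(A)$ with $E^p_j(A)=\underline{\mathrm{Ext}}^p_A(\mathbb F,\mathbb F)_{-j}$, where $\underline{\mathrm{Ext}}$ is the derived functor of $\underline{\mathrm{Hom}}_A(M,N)=\bigoplus_n\mathrm{Hom}_{Gr(A)}(M,N[n])$ (degree-zero graded maps, $N[n]_j=N_{n+j}$); $p$ is the cohomological degree and $j$ the lower grading; $E^p(A)=\bigoplus_j E^p_j(A)$. For $d\ge2$ let $\varDelta_d(3k)=(2dk,2dk)$, $\varDelta_d(3k+1)=(2dk+1,2dk+1)$, $\varDelta_d(3k+2)=(2dk+d,2dk+d+1)$ for $k\ge 0$. $A$ is a bi-Koszul algebra determined by $\varDelta_d$ if the trivial module $\mathbb F$ has a minimal graded free resolution $P$ in which $P_n$ is generated in degrees $\varDelta_d(n)$ (the pair viewed as a set) for all $n\ge0$. An $A_\infty$-algebra is a $\mathbb Z$-graded vector space $E$ with linear maps $m_n:E^{\otimes n}\to E$ of degree $2-n$ ($n\ge1$) such that for all $n\ge1$, $\sum(-1)^{i+jt}m_{i+1+j}(1^{\otimes i}\otimes m_t\otimes 1^{\otimes j})=0$, the sum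 over $n=i+t+j$, $i,j\ge0$, $t\ge1$. All $A_\infty$-algebras are strictly unital ($1\in E$ is a two-sided unit for $m_2$, and $m_n(x_1,\dots,x_n)=0$ for $n\ne2$ if some $x_i=1$). An $A_\infty$-algebra structure on $E(A)$ always means an $A_\infty$-Ext-algebra structure, i.e. one obtained by the minimality theorem (Kadeishvili) from the differential graded algebra $\mathrm{End}_A(P)$, $P$ a free resolution of ${}_A\mathbb F$: thus $m_1=0$, $m_2$ is the Yoneda product, every $m_n$ preserves the lower grading, and $E(A)$ is quasi-isomorphic to $\mathrm{End}_A(P)$. Reduced (with respect to $d$). For a bigraded $E=\bigoplus E^p_j$ put $E^{[r]}=\bigoplus_{k\ge0}E^{3k+r}$ ($r=0,1,2$), $E^{[2]}_{(d)}=\bigoplus_k E^{3k+2}_{2dk+d}$, $E^{[2]}_{(d+1)}=\bigoplus_kE^{3k+2}_{2dk+d+1}$, where $E^{[2]}=E^{[2]}_{(d)}\oplus E^{[2]}_{(d+1)}$. $E$ is reduced if $m_n=0$ for $n\notin\{2,3,4,d,d+1\}$ and the multiplications are zero on all tensor products of these pieces except possibly on the following (including all permutations of the factors; lists are merged when indices coincide), with values in the indicated piece: $m_2$: $E^{[0]}E^{[0]}\to E^{[0]}$; $E^{[0]}E^{[1]}$ and $E^{[2]}_{(d)}E^{[2]}_{(d+1)}\to E^{[1]}$; $E^{[0]}E^{[2]}\to E^{[2]}$. $m_3$: $E^{[0]}E^{[2]}_{(d)}E^{[2]}_{(d)}\to E^{[0]}$; $E^{[1]}E^{[2]}_{(d)}E^{[2]}_{(d)}\to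 E^{[1]}$; $E^{[0]}E^{[1]}E^{[2]}_{(d)}$ and $E^{[2]}E^{[2]}_{(d)}E^{[2]}_{(d)}\to E^{[2]}$. $m_4$: $E^{[2]}_{(d)}E^{[2]}_{(d)}E^{[2]}_{(d)}E^{[2]}_{(d)}\to E^{[0]}$; $E^{[1]}E^{[2]}_{(d)}E^{[2]}_{(d)}E^{[2]}_{(d)}\to E^{[2]}$. $m_d$: ($d-1$ factors $E^{[1]}$ and one $E^{[2]}_{(d+1)}$) $\to E^{[0]}$; ($d$ factors $E^{[1]}$) $\to E^{[2]}$. $m_{d+1}$: ($d$ factors $E^{[1]}$ and one $E^{[2]}_{(d)}$) $\to E^{[0]}$; ($d+1$ factors $E^{[1]}$) $\to E^{[2]}$. *)

(* Defs.v *)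
From HB Require Import structures.
From mathcomp Require Import all_boot all_order all_algebra.
From mathcomp Require Import generic_quotient ring_quotient.
From mathcomp Require Import boolp classical_sets functions.

Set Implicit Arguments.
Unset Strict Implicit.
Unset Printing Implicit Defensive.

Import GRing.Theory.
Local Open Scope ring_scope.
Local Open Scope quotient_scope.

(* V is the internal direct sum of the subgroups V_ i. *)
Record grading (I : eqType) (V : zmodType) (V_ : I -> set V) : Prop := {
  grading0 : forall i, V_ i 0;
  gradingB : forall i x y, V_ i x -> V_ i y -> V_ i (x - y);
  grading_sum : forall x, exists (s : seq I) (f : I -> V),
    [/\ uniq s, forall i, V_ i (f i) & x = \sum_(i <- s) f i];
  grading_direct : forall (s : seq I) (f : I -> V),
    uniq s -> (forall i, V_ i (f i)) -> \sum_(i <- s) f i = 0 ->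
    forall i, i \in s -> f i = 0 }.

Section GradingTheory.
Variables (I : eqType) (V : zmodType) (V_ : I -> set V).
Hypothesis gV : grading V_.

Lemma gradingN i x : V_ i x -> V_ i (- x).
Proof. by move=> Vx; rewrite -sub0r; apply: (gradingB gV) (grading0 gV i) Vx. Qed.

Lemma gradingD i x y : V_ i x -> V_ i y -> V_ i (x + y).
Proof.
by move=> Vx Vy; rewrite -[y]opprK; apply: (gradingB gV) => //; apply: gradingN.
Qed.

Let dec (x : V) (f : I -> V) := (forall i, V_ i (f i)) /\
  exists s, [/\ uniq s, forall i, i \notin s -> f i = 0 & x = \sum_(i <- s) f i].

Let sum_ext (f : I -> V) (s t : seq I) : uniq s ->
  (forall i, i \notin s -> f i = 0) ->
  \sum_(i <- s) f i = \sum_(i <- undup (s ++ t)) f i.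
Proof.
move=> us f0; rewrite [RHS](bigID (mem s)) /= [X in _ + X]big1 ?addr0; last first.
  by move=> i; exact: f0.
rewrite -[RHS]big_filter; apply: perm_big; apply: uniq_perm => //.
  by rewrite filter_uniq // undup_uniq.
by move=> i; rewrite mem_filter mem_undup mem_cat; case: (i \in s).
Qed.

Let dec_ex x : exists f, dec x f.
Proof.
have [s [f [us Vf ->]]] := grading_sum gV x.
exists (fun i => if i \in s then f i else 0); split.
  by move=> i; case: ifP => // _; apply: (grading0 gV).
exists s; split => // [i /negPf -> //|].
by apply: eq_big_seq => i ->.
Qed.

Let decB x y f g : dec x f -> dec y g -> dec (x - y) (fun i => f i - g i).
Proof.
move=> [Vf [s [us f0 ->]]] [Vg [t [ut g0 ->]]]; split.
  by move=> i; apply: (gradingB gV).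
exists (undup (s ++ t)); split; first exact: undup_uniq.
  by move=> i; rewrite mem_undup mem_cat negb_or => /andP[/f0 -> /g0 ->]; rewrite subrr.
rewrite sumrB (sum_ext t us f0); congr (_ - _).
rewrite (sum_ext s ut g0); apply: perm_big; apply: uniq_perm; rewrite ?undup_uniq //.
by move=> i; rewrite !mem_undup !mem_cat orbC.
Qed.

Let dec0 f : dec 0 f -> forall i, f i = 0.
Proof.
move=> [Vf [s [us f0 e]]] i; have [si|] := boolP (i \in s); last exact: f0.
exact: (grading_direct gV us Vf (esym e)).
Qed.

Let dec_uniq x f g : dec x f -> dec x g -> forall i, f i = g i.
Proof.
move=> dx dy i; apply/eqP; rewrite -subr_eq0; apply/eqP.
by apply: (@dec0 (fun i => f i - g i)); rewrite -(subrr x); apply: decB.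
Qed.

Lemma grading_proj : exists p : I -> V -> V,
  [/\ forall i x, V_ i (p i x),
      forall i x y, p i (x - y) = p i x - p i y,
      forall i x, V_ i x -> p i x = x,
      forall i j x, V_ j x -> i != j -> p i x = 0 &
      forall x, exists s, [/\ uniq s, forall i, i \notin s -> p i x = 0 &
        x = \sum_(i <- s) p i x]].
Proof.
pose q x := projT1 (cid (dec_ex x)).
have dq x : dec x (q x) by rewrite /q; case: cid.
have dV j x : V_ j x -> dec x (fun i => if i == j then x else 0).
  move=> Vx; split=> [i|]; first by case: eqP => [-> //|_]; apply: (grading0 gV).
  exists [:: j]; split=> //; last by rewrite big_seq1 eqxx.
  by move=> i; rewrite inE => /negPf ->.
exists (fun i x => q x i); split.
- by move=> i x; case: (dq x).
- by move=> i x y; apply: (dec_uniq (dq (x - y)) (decB (dq x) (dq y))).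
- by move=> i x Vx; rewrite (dec_uniq (dq x) (dV _ _ Vx)) eqxx.
- by move=> i j x Vx /negPf ij; rewrite (dec_uniq (dq x) (dV _ _ Vx)) ij.
- by move=> x; have [_ [s [us s0 e]]] := dq x; exists s.
Qed.

Lemma proj_sum (p : V -> V) (J : Type) (s : seq J) (f : J -> V) :
  (forall x y, p (x - y) = p x - p y) -> p (\sum_(j <- s) f j) = \sum_(j <- s) p (f j).
Proof.
move=> pB; have p0 : p 0 = 0 by rewrite -[X in p X](subrr 0) pB subrr.
have pD x y : p (x + y) = p x + p y.
  by have := pB (x + y) y; rewrite addrK => ->; rewrite subrK.
by elim: s => [|j s IH]; [rewrite !big_nil p0 | rewrite !big_cons pD IH].
Qed.

End GradingTheory.

Lemma proj_shift (I : zmodType) (V : zmodType) (V_ : I -> set V) (p : I -> V -> V)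
    (e : I) (g : V -> V) :
  (forall i x, V_ i (p i x)) -> (forall i x y, p i (x - y) = p i x - p i y) ->
  (forall i x, V_ i x -> p i x = x) ->
  (forall i j x, V_ j x -> i != j -> p i x = 0) ->
  (forall x, exists s, [/\ uniq s, forall i, i \notin s -> p i x = 0 &
    x = \sum_(i <- s) p i x]) ->
  (forall x y, g (x - y) = g x - g y) -> (forall i x, V_ i x -> V_ (i + e) (g x)) ->
  forall i x, p (i + e) (g x) = g (p i x).
Proof.
move=> pV pB pid p0 psum gB gV i x; have [s [us s0 {1}->]] := psum x.
rewrite (proj_sum s _ gB) (proj_sum s _ (pB _)).
have g0 : g 0 = 0 by rewrite -[X in g X](subrr 0) gB subrr.
have [si|si] := boolP (i \in s); last first.
  rewrite (s0 _ si) g0 big_seq big1 // => k ks; apply: (p0 _ (k + e)); first exact: gV.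
  by apply: contra si => /eqP/addIr ->.
rewrite (bigD1_seq i) //= big1 ?addr0; first by apply: pid; apply: gV.
move=> k ki; apply: (p0 _ (k + e)); first exact: gV.
by apply: contra ki => /eqP/addIr ->.
Qed.

Section Graded.
Variable F : fieldType.

Record gradedAlg := GradedAlg {
  galg :> algType F;
  gdeg : nat -> set galg;
  gdeg_grading : grading gdeg;
  gdeg1 : gdeg 0%N 1;
  gdegZ : forall n (c : F) x, gdeg n x -> gdeg n (c *: x);
  gdegM : forall m n x y, gdeg m x -> gdeg n y -> gdeg (m + n)%N (x * y) }.

Definition connected (A : gradedAlg) :=
  forall x : A, gdeg 0%N x -> exists c : F, x = c%:A.

Definition locally_finite (A : gradedAlg) :=
  forall n, exists s : seq A, forall x : A, gdeg n x ->
    exists c : nat -> F, x = \sum_(k < size s) c k *: s`_k.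

Definition generated_in_degree1 (A : gradedAlg) :=
  forall S : set A, S 1 -> (forall (c : F) x y, S x -> S y -> S (c *: x + y)) ->
    (forall x y, S x -> S y -> S (x * y)) -> (forall x, gdeg 1%N x -> S x) ->
  forall x, S x.

Definition lspan (R : nzRingType) (M : lmodType R) (S : R -> M -> Prop) (x : M) :=
  exists s : seq (R * M), (forall e, e \in s -> S e.1 e.2) /\
    x = \sum_(e <- s) e.1 *: e.2.

Definition is_basis (R : nzRingType) (M : lmodType R) (B : set M) :=
  (forall x, lspan (fun _ b => B b) x) /\
  (forall (s : seq M) (c : M -> R), uniq s -> (forall b, b \in s -> B b) ->
    \sum_(b <- s) c b *: b = 0 -> forall b, b \in s -> c b = 0).

(* A-linear maps to the trivial module A / A_{>=1}, identified with F: for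
   connected A, the elements c%:A act by c and those of positive degree by 0. *)
Record to_trivial (A : gradedAlg) (M : lmodType A) (phi : M -> F) : Prop := {
  trivD : forall x y, phi (x + y) = phi x + phi y;
  trivZ : forall (c : F) x, phi (c%:A *: x) = c * phi x;
  triv0 : forall n (a : A) x, (0 < n)%N -> gdeg n a -> phi (a *: x) = 0 }.

(* The total module of a graded free resolution P of the trivial module;
   [rdeg (n, j)] is the component of homological degree n and internal degree j,
   so that P_n is the direct sum of the [rdeg (n, j)] over j. *)
Record free_resolution (A : gradedAlg) := FreeResolution {
  res :> lmodType A;
  rdeg : int * int -> set res;
  rdiff : {linear res -> res};
  raug : res -> F;
  rdeg_grading : grading rdeg;
  rdegZ : forall k n j (a : A) x,
    gdeg k a -> rdeg (n, j) x -> rdeg (n, k%:Z + j) (a *: x);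
  rdeg_ge0 : forall n j x, (n < 0)%R -> rdeg (n, j) x -> x = 0;
  res_free : exists B : set res,
    (forall b, B b -> exists i, rdeg i b) /\ is_basis B;
  rdiff_deg : forall n j x, rdeg (n, j) x -> rdeg (n - 1, j) (rdiff x);
  rdiffK : forall x, rdiff (rdiff x) = 0;
  raug_triv : to_trivial raug;
  raug_deg : forall i x, i != 0 -> rdeg i x -> raug x = 0;
  raug_diff : forall x, raug (rdiff x) = 0;
  raug_surj : exists x, raug x != 0;
  res_exact0 : forall j x, rdeg (0, j) x -> raug x = 0 -> exists y, x = rdiff y;
  res_exact : forall n j x, (0 < n)%R -> rdeg (n, j) x -> rdiff x = 0 ->
    exists y, x = rdiff y }.

Arguments rdiff {A} f : rename.
Arguments raug {A} f : rename.
Arguments rdeg {A} f : rename.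

Definition minimal (A : gradedAlg) (P : free_resolution A) :=
  forall x : P, lspan (fun a _ => exists2 k, (0 < k)%N & gdeg k a) (rdiff P x).

Definition Delta (d n : nat) : nat * nat :=
  let k := (n %/ 3)%N in
  match (n %% 3)%N with
  | 0%N => (2 * d * k, 2 * d * k)%N
  | 1%N => (2 * d * k + 1, 2 * d * k + 1)%N
  | _ => (2 * d * k + d, 2 * d * k + d + 1)%N
  end.

Definition generated_in_degrees (A : gradedAlg) (P : free_resolution A)
    (n : nat) (D : seq nat) :=
  forall j (x : P), rdeg P (n%:Z, j) x ->
    lspan (fun _ y => exists2 k : nat, k \in D & rdeg P (n%:Z, k%:Z) y) x.

Definition bi_Koszul (d : nat) (A : gradedAlg) :=
  exists P : free_resolution A, minimal P /\
    forall n, generated_in_degrees P n [:: (Delta d n).1; (Delta d n).2].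

End Graded.

Arguments rdiff {F A} f : rename.
Arguments raug {F A} f : rename.
Arguments rdeg {F A} f : rename.

(* Quotient of a module by a submodule: the quotient group of [ring_quotient]
   with the induced scaling. *)

Section QuotientModule.
Variables (R : nzRingType) (V : lmodType R) (B : {pred V}).
Hypothesis subB : submod_closed B.

Definition submod_zmod : zmodClosed V := HB.pack_for (zmodClosed V) B
  (GRing.isZmodClosed.Build V B (GRing.submod_closedB subB)).

Definition quotmod := Quotient.quot submod_zmod.
HB.instance Definition _ := GRing.Zmodule.on quotmod.
HB.instance Definition _ := EqQuotient.on quotmod.

Definition quotmod_scale (c : R) (x : quotmod) : quotmod :=
  \pi_quotmod (c *: repr x).

Lemma quotmodE (x y : V) : (\pi_quotmod x == \pi_quotmod y) = (x - y \in B).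
Proof. by rewrite -[RHS]/(x - y \in submod_zmod) Quotient.idealrBE. Qed.

Lemma quotmodD (x y : V) : \pi_quotmod (x + y) = \pi_quotmod x + \pi_quotmod y.
Proof. by rewrite !piE. Qed.

Lemma quotmod_scaleE c (x : V) : quotmod_scale c (\pi_quotmod x) = \pi_quotmod (c *: x).
Proof.
apply/eqP; rewrite quotmodE -scalerBr -[_ *: _]addr0; have [B0 BZ] := subB.
by apply: BZ => //; rewrite -quotmodE reprK.
Qed.

Lemma quotmodP (x : quotmod) : exists y, x = \pi_quotmod y.
Proof. by exists (repr x); rewrite reprK. Qed.

Let scaleA a b v : quotmod_scale a (quotmod_scale b v) = quotmod_scale (a * b) v.
Proof. by have [x ->] := quotmodP v; rewrite !quotmod_scaleE scalerA. Qed.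
Let scale1 : left_id 1 quotmod_scale.
Proof. by move=> v; have [x ->] := quotmodP v; rewrite quotmod_scaleE scale1r. Qed.
Let scaleDr : right_distributive quotmod_scale +%R.
Proof.
move=> a u v; have [x ->] := quotmodP u; have [y ->] := quotmodP v.
by rewrite -quotmodD !quotmod_scaleE -quotmodD scalerDr.
Qed.
Let scaleDl v : {morph quotmod_scale^~ v : a b / a + b}.
Proof.
move=> a b; have [x ->] := quotmodP v.
by rewrite !quotmod_scaleE -quotmodD scalerDl.
Qed.

HB.instance Definition _ :=
  GRing.Zmodule_isLmodule.Build R quotmod scaleA scale1 scaleDr scaleDl.

Lemma quotmodZ c (x : V) : \pi_quotmod (c *: x) = c *: \pi_quotmod x.
Proof. by rewrite -quotmod_scaleE. Qed.

End QuotientModule.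

(* Bigraded spaces E, the (p, j)-component E^p_j being [bideg (p, j)]. *)

Record bigraded (F : fieldType) := Bigraded {
  bisort :> lmodType F;
  bideg : int * int -> set bisort;
  bideg_grading : grading bideg;
  bidegZ : forall i (c : F) x, bideg i x -> bideg i (c *: x) }.

(* E(A), computed as the cohomology of Hom_A(P, F). *)

Section Ext.
Variables (F : fieldType) (A : gradedAlg F) (P : free_resolution A).

(* phi is supported on P_p, and maps (P_p)_i to F_{i-j}, which is 0 for i != j. *)
Definition cochain_deg (pj : int * int) (phi : P -> F^o) :=
  to_trivial phi /\ forall i x, i != pj -> rdeg P i x -> phi x = 0.

(* The direct sum over (p, j) of the spaces of cochains of bidegree (p, j). *)
Definition cochain (phi : P -> F^o) :=
  to_trivial phi /\
  exists s : seq (int * int), forall i x, i \notin s -> rdeg P i x -> phi x = 0.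

Definition cocycle : {pred P -> F^o} :=
  [pred phi | `[< cochain phi /\ phi \o rdiff P = cst 0 >]].

Let cochain_lin (c : F) phi psi :
  cochain phi -> cochain psi -> cochain (c *: phi + psi).
Proof.
move=> [[p1 p2 p3] [s ps]] [[q1 q2 q3] [t qt]]; split.
  split=> [x y|k x|n a x n0 ax]; rewrite !fctE.
  - by rewrite p1 q1 scalerDr addrACA.
  - by rewrite p2 q2 /GRing.scale/= mulrDr mulrCA.
  - by rewrite (p3 n) // (q3 n) // scaler0 addr0.
exists (s ++ t) => i x; rewrite mem_cat negb_or => /andP[si ti] xi.
by rewrite !fctE (ps i) // (qt i) // scaler0 addr0.
Qed.

Let cochain0 : cochain 0.
Proof.
split; last by exists [::].
by split=> [x y|k x|n a x _ _]; rewrite ?addr0 ?mulr0.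
Qed.

Lemma cocycle_closed : submod_closed cocycle.
Proof.
split; first by apply/asboolP; split; [exact: cochain0|apply/funext].
move=> c f g /asboolP[hf f0] /asboolP[hg g0]; apply/asboolP; split.
  exact: cochain_lin.
apply/funext => x /=; rewrite !fctE.
have := congr1 (@^~ x) f0; have := congr1 (@^~ x) g0 => /= -> ->.
by rewrite scaler0 addr0.
Qed.
HB.instance Definition _ :=
  GRing.isSubmodClosed.Build F (P -> F^o) cocycle cocycle_closed.

Record cocycles := Cocycle { cocycle_val :> P -> F^o; _ : cocycle_val \in cocycle }.
HB.instance Definition _ := [isSub for cocycle_val].
HB.instance Definition _ := [Choice of cocycles by <:].
HB.instance Definition _ := [SubChoice_isSubLmodule of cocycles by <:].

Definition coboundary : {pred cocycles} :=
  [pred z | `[< exists psi, cochain psi /\ val z = psi \o rdiff P >]].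

Lemma coboundary_closed : submod_closed coboundary.
Proof.
split.
  by apply/asboolP; exists 0; split; [exact: cochain0|apply/funext].
move=> c f g /asboolP[u [hu fu]] /asboolP[v [hv gv]]; apply/asboolP.
exists (c *: u + v); split; first exact: cochain_lin.
by rewrite linearP /= fu gv.
Qed.

Definition ext_space : lmodType F := quotmod coboundary_closed.

(* phi is a cocycle whose cohomology class is x. *)
Definition represents (phi : P -> F) (x : ext_space) :=
  exists2 z : cocycles, val z = phi & x = \pi_(quotmod coboundary_closed) z.

Definition ext_deg (i : int * int) : set ext_space :=
  [set x | exists2 phi, cochain_deg i phi & represents phi x].

Let cochain_degW i phi : cochain_deg i phi -> cochain phi.
Proof.
case=> tphi phi0; split => //; exists [:: i] => k x; rewrite inE; exact: phi0.
Qed.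

Let cochain_deg_lin i (c : F) phi psi :
  cochain_deg i phi -> cochain_deg i psi -> cochain_deg i (c *: phi + psi).
Proof.
move=> h1 h2; have [hT _] := cochain_lin c (cochain_degW h1) (cochain_degW h2).
split=> // k x ki kx; rewrite !fctE (h1.2 k) // (h2.2 k) //.
by rewrite scaler0 addr0.
Qed.

Lemma represents_lin (c : F) phi psi x y :
  represents phi x -> represents psi y ->
  represents (c *: (phi : P -> F^o) + psi) (c *: x + y).
Proof.
move=> [z <- ->] [t <- ->]; exists (c *: z + t); first by rewrite linearP.
by rewrite quotmodD quotmodZ.
Qed.

Lemma represents0 : represents (0 : P -> F^o) 0.
Proof. 
exists 0 => //; apply: (@addrI _ (\pi_(quotmod coboundary_closed) 0)).
by rewrite addr0 -quotmodD addr0.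
Qed.

Let pi0 : \pi_(quotmod coboundary_closed) 0 = 0.
Proof. by apply: (@addrI _ (\pi_(quotmod coboundary_closed) 0)); rewrite addr0 -quotmodD addr0. Qed.

Let pi_sum (s : seq (int * int)) (z : int * int -> cocycles) :
  \pi_(quotmod coboundary_closed) (\sum_(i <- s) z i) = \sum_(i <- s) \pi_(quotmod coboundary_closed) (z i).
Proof.
by elim: s => [|i s IH]; [rewrite !big_nil pi0 | rewrite !big_cons quotmodD IH].
Qed.

Let pi_eq0 (z : cocycles) : (\pi_(quotmod coboundary_closed) z == 0) = (z \in coboundary).
Proof. by rewrite -pi0 quotmodE subr0. Qed.

Let val_sum (s : seq (int * int)) (z : int * int -> cocycles) x :
  val (\sum_(i <- s) z i) x = \sum_(i <- s) val (z i) x.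
Proof. by rewrite linear_sum fct_sumE. Qed.

Lemma ext_grading : grading ext_deg.
Proof.
have [p [pV pB pid p0 psum]] := grading_proj (rdeg_grading P).
have pD i x y : p i (x + y) = p i x + p i y.
  by have := pB i (x + y) y; rewrite addrK => ->; rewrite subrK.
have pd i x : p (i + (-1, 0)) (rdiff P x) = rdiff P (p i x).
  apply: (proj_shift pV pB pid p0 psum) => [{}x y|[n j] {}x]; first exact: linearB.
  by move=> xnj; have := rdiff_deg xnj; rewrite -[j in (_, j)]addr0.
have pZ k (a : A) i x : gdeg k a -> p (i + (0, k%:Z)) (a *: x) = a *: p i x.
  move=> ka; apply: (proj_shift (g := fun x => a *: x) pV pB pid p0 psum).
    by move=> u v; exact: scalerBr.
  move=> [n j] u unj; rewrite -[(n, j) + _]/(n + 0, j + k%:Z) addr0 addrC.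
  exact: rdegZ.
have comp phi i : cochain phi -> cochain_deg i (phi \o p i).
  move=> [[hD hZ h0] _]; have phi00 : phi 0 = 0.
    by apply: (@addrI _ (phi 0)); rewrite -hD !addr0.
  split; last by move=> k x ki kx; rewrite /= (p0 _ k) // eq_sym.
  split=> [x y|c x|n a x n0 ax] /=; first by rewrite pD hD.
    have /(pZ _ _ i x) : gdeg 0%N (c%:A : A) by apply: gdegZ; apply: gdeg1.
    by rewrite -[(0, _)]/(0 : int * int) addr0 => ->; exact: hZ.
  by rewrite -[i](subrK (0, n%:Z)) (pZ n) // (h0 n).
have compK phi i u : cochain_deg i phi -> phi (p i u) = phi u.
  move=> [[hD _ _] h0]; have phi00 : phi 0 = 0.
    by apply: (@addrI _ (phi 0)); rewrite -hD !addr0.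
  have phiD : {morph phi : a b / a + b} by [].
  have [t [ut t0 ue]] := psum u; rewrite [in RHS]ue (big_morph _ phiD phi00).
  have [it|it] := boolP (i \in t).
    rewrite (bigD1_seq i) //= big1 ?addr0 // => l li; exact: (h0 l).
  rewrite big_seq big1 ?t0 // => l lt; apply: (h0 l) => //.
  by apply: contra it => /eqP <-.
split.
- move=> i; exists (0 : P -> F^o); last exact: represents0.
  split; last by [].
  by split=> [x y|k x|n a x _ _]; rewrite ?addr0 ?mulr0.
- move=> i x y [f fi fx] [g gi gy]; exists (-1 *: (g : P -> F^o) + f).
    exact: cochain_deg_lin.
  by rewrite [x - y]addrC -[- y]scaleN1r; exact: (represents_lin (-1) gy fx).
- move=> x; have [z ->] := quotmodP x.
  have /asboolP[hz zd] := valP z; have [hT [s s0]] := hz.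
  have zP i : (val z \o p i : P -> F^o) \in cocycle.
    apply/asboolP; split; first exact: cochain_degW (comp _ i hz).
    apply/funext => u /=; rewrite -[i](subrK (-1, 0)) pd.
    exact: (congr1 (@^~ _) zd).
  pose zi i := Cocycle (zP i).
  exists (undup s), (fun i => \pi_(quotmod coboundary_closed) (zi i)); split.
  + exact: undup_uniq.
  + by move=> i; exists (zi i); [exact: comp|exists (zi i)].
  rewrite -pi_sum; congr (\pi_(quotmod coboundary_closed) _); apply/val_inj/funext => u.
  rewrite val_sum /=; have [t [ut t0 {1}->]] := psum u.
  have phiD : {morph val z : a b / a + b} by case: hT.
  have phi00 : val z 0 = 0 by apply: (@addrI _ (val z 0)); rewrite -phiD !addr0.
  rewrite (big_morph _ phiD phi00).
  rewrite (bigID (mem (undup s))) /= [X in _ + X]big1 ?addr0; last first.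
    by move=> i; rewrite mem_undup => si; apply: (s0 i).
  rewrite [RHS](bigID (mem t)) /= [X in _ + X]big1 ?addr0; last first.
    by move=> i it; rewrite t0.
  rewrite -big_filter -[RHS]big_filter; apply: perm_big; apply: uniq_perm.
  + by rewrite filter_uniq.
  + by rewrite filter_uniq // undup_uniq.
  by move=> i; rewrite !mem_filter andbC.
- move=> s f us fdeg f0 i si.
  have {}fdeg k : exists z : cocycles, cochain_deg k (val z) /\ f k = \pi_(quotmod coboundary_closed) z.
    by have [phi hp [z zp ->]] := fdeg k; exists z; rewrite zp.
  have [z zP] := choice fdeg.
  have : \pi_(quotmod coboundary_closed) (\sum_(k <- s) z k) == 0.
    rewrite pi_sum; apply/eqP; rewrite -[RHS]f0.
    by apply: eq_bigr => k _; case: (zP k).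
  rewrite pi_eq0 => /asboolP[psi [hpsi e]].
  have [zi ->] := zP i; apply/eqP; rewrite pi_eq0; apply/asboolP.
  exists (psi \o p (i + (-1, 0))); split; first exact: cochain_degW (comp _ _ hpsi).
  have zd k u : k \in s -> val (z k) (p i u) = if k == i then val (z k) u else 0.
    move=> ks; case: eqP => [->|/eqP ki]; first by apply: compK; case: (zP i).
    by have [[_ h0] _] := zP k; apply: (h0 i) => //; rewrite eq_sym.
  apply/funext => u; rewrite /= pd; have := congr1 (@^~ (p i u)) e => /= <-.
  rewrite val_sum (eq_big_seq (fun k => if k == i then val (z k) u else 0)).
    by rewrite (bigD1_seq i) //= eqxx big1 ?addr0 // => k /negPf ->.
  by move=> k; exact: zd.
Qed.

Lemma ext_degZ i (c : F) x : ext_deg i x -> ext_deg i (c *: x).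
Proof.
move=> [f fi fx]; exists (c *: (f : P -> F^o) + 0).
  apply: cochain_deg_lin => //; split; last by [].
  by split=> [y z|k y|n a y _ _]; rewrite ?addr0 ?mulr0.
by rewrite -[c *: x]addr0; apply: represents_lin fx represents0.
Qed.

Definition Ext : bigraded F := Bigraded ext_grading ext_degZ.

End Ext.

(* A-infinity structures. The operations m_n (n >= 1) are given together as a
   single m : seq E -> E, with m_n(x_1, ..., x_n) = m [:: x_1; ...; x_n]; the
   value m [::] is irrelevant. *)

Section Ainf.
Variable F : fieldType.

Definition sign (R : nzRingType) (p : int) : R := (-1) ^+ `|p|%N.

Fixpoint forall2 (T U : Type) (R : T -> U -> Prop) (s : seq T) (t : seq U) : Prop :=
  match s, t with
  | [::], [::] => True
  | x :: s', y :: t' => R x y /\ forall2 R s' t'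
  | _, _ => False
  end.

Definition homog (E : bigraded F) (ds : seq (int * int)) (s : seq E) :=
  forall2 (@bideg F E) ds s.

Definition multilinear (E : bigraded F) (m : seq E -> E) :=
  forall (s t : seq E) (c : F) x y,
    m (s ++ (c *: x + y) :: t) = c *: m (s ++ x :: t) + m (s ++ y :: t).

(* The summand of the n-th Stasheff identity with m_t inserted after i inputs,
   where ds lists the degrees of the inputs; the second sign is the Koszul sign
   for moving m_t, of degree 2 - t, past x_1, ..., x_i. *)
Definition insertion (E : bigraded F) (V : Type) (scale : F -> V -> V)
    (u : seq E -> V) (m : seq E -> E) (ds : seq (int * int)) (s : seq E)
    (i t : nat) : V :=
  let j := (size s - i - t)%N in
  scale (sign F (i + j * t)%N *
         sign F ((2 - t%:Z) * \sum_(d <- take i ds) d.1))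
    (u (take i s ++ m (take t (drop i s)) :: drop (i + t) s)).

Record Ainf_algebra (E : bigraded F) (m : seq E -> E) : Prop := {
  Ainf_multilinear : multilinear m;
  Ainf_deg : forall ds s, s != [::] -> homog ds s ->
    bideg (\sum_(d <- ds) d + (2 - (size s)%:Z, 0)) (m s);
  Ainf_stasheff : forall ds s, homog ds s ->
    \sum_(0 <= i < size s) \sum_(1 <= t < (size s - i).+1)
      insertion *:%R m m ds s i t = 0;
  Ainf_unit : exists e : E,
    [/\ bideg (0, 0) e, forall x, m [:: e; x] = x, forall x, m [:: x; e] = x &
        forall s, size s != 2 -> e \in s -> m s = 0] }.

End Ainf.

(* The differential graded algebra End_A(P): the component of bidegree (p, j)
   consists of the A-linear maps sending P_n to P_{n-p} and lowering the
   internal degree by j, the product is composition, and the differential is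
   the graded commutator with that of P. *)

Section End.
Variables (F : fieldType) (A : gradedAlg F) (P : free_resolution A).

Definition end_deg (pj : int * int) (a : P -> P) :=
  forall i x, rdeg P i x -> rdeg P (i - pj) (a x).

(* The differential of a of cohomological degree p, evaluated at z. *)
Definition end_diff (p : int) (a : P -> P) (z : P) : P :=
  rdiff P (a z) - sign A p *: a (rdiff P z).

(* A-infinity morphisms (f_n) from E to End_A(P), with f_n of degree 1 - n and
   again written f_n(x_1, ..., x_n) = f [:: x_1; ...; x_n]. Since m_r = 0 on
   End_A(P) for r > 2, the right-hand side of the n-th identity consists of
   m_1 f_n and of the terms (-1)^(i-1) m_2 (f_i (x) f_(n-i)), with the Koszul
   sign for moving f_(n-i) past x_1, ..., x_i. *)
Record Ainf_morphism_End (E : bigraded F) (m : seq E -> E)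
    (f : seq E -> {linear P -> P}) : Prop := {
  morE_multilinear : forall (s t : seq E) (c : F) x y z,
    f (s ++ (c *: x + y) :: t) z =
      c%:A *: f (s ++ x :: t) z + f (s ++ y :: t) z;
  morE_deg : forall ds s, s != [::] -> homog ds s ->
    end_deg (\sum_(d <- ds) d + (1 - (size s)%:Z, 0)) (f s);
  morE_eq : forall ds s z, s != [::] -> homog ds s ->
    \sum_(0 <= i < size s) \sum_(1 <= t < (size s - i).+1)
      insertion (fun (c : F) (v : P) => c%:A *: v) (fun s => f s z) m ds s i t
    = end_diff (\sum_(d <- ds) d.1 + 1 - (size s)%:Z) (f s) z
      + \sum_(1 <= i < size s)
          (sign A (i%:Z - 1) *
           sign A ((1 - (size s - i)%N%:Z) * \sum_(d <- take i ds) d.1))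
          *: f (take i s) (f (drop i s) z) }.

(* A-infinity structures on E(A) given by the minimality theorem: m_1 = 0 and
   there is an A-infinity morphism f to End_A(P) such that f_1 induces the
   canonical identification of Ext_A(F, F) with H(End_A(P)), whose inverse sends
   the class of a to that of [raug P \o a]. In particular f is a
   quasi-isomorphism, and its second identity says that m_2 is the Yoneda
   product. *)
Definition Ext_Ainf_structure (m : seq (Ext P) -> Ext P) :=
  [/\ Ainf_algebra m, forall x, m [:: x] = 0 &
      exists2 f : seq (Ext P) -> {linear P -> P}, Ainf_morphism_End m f &
        forall x, represents (raug P \o f [:: x]) x].

End End.

(* The pieces E^[0], E^[1], E^[2]_(d) and E^[2]_(d+1). *)
Variant piece := E0 | E1 | E2d | E2d1.

Definition piece_code (l : piece) : nat :=
  match l with E0 => 0 | E1 => 1 | E2d => 2 | E2d1 => 3 end.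

Definition piece_decode (n : nat) : piece :=
  match n with 0 => E0 | 1 => E1 | 2 => E2d | _ => E2d1 end.

Lemma piece_codeK : cancel piece_code piece_decode. Proof. by case. Qed.
HB.instance Definition _ := Equality.copy piece (can_type piece_codeK).

Section Reduced.
Variables (F : fieldType) (d : nat) (E : bigraded F).

(* x lies in the sum of the E^p_j with D (p, j). *)
Definition in_degrees (D : int * int -> Prop) (x : E) :=
  exists (s : seq (int * int)) (f : int * int -> E),
    [/\ forall i, i \in s -> D i, forall i, bideg i (f i) & x = \sum_(i <- s) f i].

Definition piece_deg (l : piece) (pj : int * int) : Prop :=
  exists k : nat,
    match l with
    | E0 => pj.1 = (3 * k)%N%:Z
    | E1 => pj.1 = (3 * k + 1)%N%:Z
    | E2d => pj = ((3 * k + 2)%N%:Z, (2 * d * k + d)%N%:Z)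
    | E2d1 => pj = ((3 * k + 2)%N%:Z, (2 * d * k + d + 1)%N%:Z)
    end.

Definition residue_deg (r : nat) (pj : int * int) : Prop :=
  exists k : nat, pj.1 = (3 * k + r)%N%:Z.

(* The possibly nonzero multiplications: the list of factors, up to permutation,
   and the r such that the values lie in E^[r]. *)
Definition reduced_table : seq (seq piece * nat) :=
  [:: ([:: E0; E0], 0%N); ([:: E0; E1], 1%N); ([:: E2d; E2d1], 1%N);
      ([:: E0; E2d], 2%N); ([:: E0; E2d1], 2%N);
      ([:: E0; E2d; E2d], 0%N); ([:: E1; E2d; E2d], 1%N);
      ([:: E0; E1; E2d], 2%N); ([:: E2d; E2d; E2d], 2%N);
      ([:: E2d1; E2d; E2d], 2%N);
      ([:: E2d; E2d; E2d; E2d], 0%N); ([:: E1; E2d; E2d; E2d], 2%N);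
      (E2d1 :: nseq d.-1 E1, 0%N); (nseq d E1, 2%N);
      (E2d :: nseq d E1, 0%N); (nseq d.+1 E1, 2%N)].

Record reduced (m : seq E -> E) : Prop := {
  reduced_E2 : forall (k : nat) (j : int) (x : E),
    bideg ((3 * k + 2)%N%:Z, j) x ->
    j != (2 * d * k + d)%N -> j != (2 * d * k + d + 1)%N -> x = 0;
  reduced_arity : forall s, s != [::] -> size s \notin [:: 2; 3; 4; d; d.+1]%N ->
    m s = 0;
  reduced_values : forall ls s e, forall2 (fun l => in_degrees (piece_deg l)) ls s ->
    e \in reduced_table -> perm_eq ls e.1 -> in_degrees (residue_deg e.2) (m s);
  reduced_zero : forall ls s, ls != [::] ->
    forall2 (fun l => in_degrees (piece_deg l)) ls s ->
    ~~ has (fun e => perm_eq ls e.1) reduced_table -> m s = 0 }.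

End Reduced.

(* Main.v *)
(* Write rho for the identification of E(A) with the functionals P -> F supported in
   finitely many degrees, available for a minimal free resolution P.

   If A is bi-Koszul, then E(A) lives in the bidegrees (n, Delta_d(n)) only, and the
   table of possibly nonzero multiplications merely lists the tuples of pieces for
   which the degree of m_n of the tuple is again such a bidegree.

   Conversely, on a minimal resolution P we build A-linear maps phi(s) : P -> P indexed
   by the words s in functionals, with phi() = d, such that the operations
   b(x, s) = x o phi(s) satisfy the Stasheff identities and phi satisfies the (flatness)
   equations of an A-infinity morphism to End_A(P); this is a recursion on the length of
   s in which a contracting homotopy h of P removes the obstruction. For this particular
   A-infinity structure each generator v of P_n with n >= 2 is detected by some
   b(x_1, ..., x_r, y) with r >= 1, where the x_i are dual to P_1 and y is dual to
   P_{n-1}. Generation of A in degree 1 puts P_1 in internal degree 1, and if n is not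
   congruent to 2 mod 3 the table then determines r from the piece of y; for n congruent
   to 2 the degrees are part of the definition of reduced. So the degrees of the
   generators follow by induction on n. *)

From HB Require Import structures.
Require Import Defs.
From mathcomp Require Import all_boot all_order all_algebra.
From mathcomp Require Import generic_quotient ring_quotient.
From mathcomp Require Import zify ring.
From mathcomp Require Import boolp classical_sets functions.

Set Implicit Arguments.
Unset Strict Implicit.
Unset Printing Implicit Defensive.

Import GRing.Theory Num.Theory Order.TTheory.
Local Open Scope ring_scope.

(** * Words, splittings and coderivations *)

(** Reducedness is asked of every structure, but an arbitrary one gives no hold on the generators of
    P. The form x o phi(s) is chosen because the Stasheff identities then follow by applying x to
    flatness, while flatness itself is an identity in P and can be evaluated at a single generator
    v. The price is that phi must be A-linear whereas h is only F-linear; hence phi is prescribed on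
    a basis, by a recursion on homological degree inside the one on word length. Solvability at each
    length rests on a Bianchi identity, which makes the obstruction a cycle, and on the vanishing of
    its augmentation. Strict units constrain h as well: it has to vanish on the basis, which is
    possible because minimality makes the basis independent modulo boundaries. Signs are absorbed by
    working on the suspension, with the parity automorphism of P in place of degrees, so that
    inhomogeneous functionals are allowed. In the other direction the bi-Koszul resolution may
    differ from the one computing E(A), and degrees have to be carried across by a chain homotopy
    equivalence. *)

(* [spl G s] is the sum of [G u v] over the factorizations s = u ++ v. *)
Section Split.
Variables (X : Type) (W : zmodType).
Implicit Types (G : seq X -> seq X -> W) (s u v : seq X).

Fixpoint spl G s : W :=
  match s with
  | [::] => G [::] [::]
  | x :: s' => G [::] (x :: s') + spl (fun u v => G (x :: u) v) s'
  end.

Lemma eq_spl G G' s : (forall u v, s = u ++ v -> G u v = G' u v) ->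
  spl G s = spl G' s.
Proof.
elim: s G G' => [|x s IH] G G' e /=; first exact: e.
rewrite e //; congr (_ + _); apply: IH => u v es; apply: e.
by rewrite /= es.
Qed.

Lemma splD G G' s : spl (fun u v => G u v + G' u v) s = spl G s + spl G' s.
Proof. by elim: s G G' => //= x s IH G G'; rewrite IH addrACA. Qed.

Lemma splN G s : spl (fun u v => - G u v) s = - spl G s.
Proof. by elim: s G => //= x s IH G; rewrite IH opprD. Qed.

Lemma spl0 G s : (forall u v, s = u ++ v -> G u v = 0) -> spl G s = 0.
Proof.
move=> e; rewrite (eq_spl (G' := fun _ _ => 0)) //; elim: s {e} => //= x s ->.
by rewrite addr0.
Qed.

Lemma spl_assoc (H : seq X -> seq X -> seq X -> W) s :
  spl (fun u v => spl (H u) v) s = spl (fun u v => spl (fun u1 u2 => H u1 u2 v) u) s.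
Proof.
elim: s H => //= x s IH H; rewrite (IH (fun u => H (x :: u))) -addrA -splD.
by congr (_ + _); apply: eq_spl.
Qed.

Lemma spl_closed (K : W -> Prop) G s : (forall x y, K x -> K y -> K (x + y)) ->
  (forall u v, s = u ++ v -> K (G u v)) -> K (spl G s).
Proof.
move=> KD; elim: s G => [|x s IH] G KG /=; first exact: KG.
apply: KD; first exact: KG.
by apply: IH => u v e; apply: KG; rewrite e.
Qed.

Lemma spl_last G s : (forall u y v, s = u ++ y :: v -> G u (y :: v) = 0) ->
  spl G s = G s [::].
Proof.
elim: s G => //= x s IH G G0; rewrite (G0 [::]) // add0r IH // => u y v es.
by apply: G0; rewrite es.
Qed.

Lemma spl_first G s : (forall y u v, s = y :: u ++ v -> G (y :: u) v = 0) ->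
  spl G s = G [::] s.
Proof.
case: s => //= x s G0; rewrite spl0 ?addr0 // => u v es.
by apply: G0; rewrite es.
Qed.

Lemma spl_rcons G s x : spl G (rcons s x) = spl (fun u v => G u (rcons v x)) s + G (rcons s x) [::].
Proof. by elim: s G => //= y s IH G; rewrite IH addrA. Qed.

Lemma spl_takedrop G s : spl G s = \sum_(0 <= i < (size s).+1) G (take i s) (drop i s).
Proof.
elim: s G => [|x s IH] G; first by rewrite big_nat1.
by rewrite big_nat_recl // take0 drop0 /= IH.
Qed.

End Split.

Lemma spl_map (X Y : Type) (W : zmodType) (f : X -> Y) (G : seq Y -> seq Y -> W) s :
  spl G (map f s) = spl (fun u v => G (map f u) (map f v)) s.
Proof. by elim: s G => //= x s IH G; rewrite IH. Qed.

Lemma spl_morph (X : Type) (W W' : zmodType) (f : W -> W') (G : seq X -> seq X -> W) s :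
  {morph f : x y / x + y} -> f (spl G s) = spl (fun u v => f (G u v)) s.
Proof. by move=> fD; elim: s G => //= x s IH G; rewrite fD IH. Qed.

(* [ins b si g s] is the sum over the factorizations s = p ++ m ++ q, with m
   nonempty, of [g (map si p ++ b m :: q)]: g composed with the coderivation of the
   tensor coalgebra defined by b, where si gives the Koszul signs. *)
Section Insert.
Variables (X : Type) (b : seq X -> X) (si : X -> X).

Fixpoint ins (W : zmodType) (g : seq X -> W) (s : seq X) : W :=
  match s with
  | [::] => 0
  | x :: s' => spl (fun u v => g (b (x :: u) :: v)) s' + ins (fun u => g (si x :: u)) s'
  end.

Variable W : zmodType.
Implicit Types (g : seq X -> W) (s : seq X).

Lemma eq_ins g g' s :
  (forall p m q, s = p ++ m ++ q -> m <> [::] ->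
    g (map si p ++ b m :: q) = g' (map si p ++ b m :: q)) ->
  ins g s = ins g' s.
Proof.
elim: s g g' => //= x s IH g g' e; congr (_ + _).
  by apply: eq_spl => u v es; apply: (e [::] (x :: u)); rewrite //= es.
by apply: IH => p m q es; apply: (e (x :: p)); rewrite /= es.
Qed.

Lemma insD g g' s : ins (fun u => g u + g' u) s = ins g s + ins g' s.
Proof.
elim: s g g' => [|x s IH] g g' /=; first by rewrite addr0.
by rewrite IH splD addrACA.
Qed.

Lemma insN g s : ins (fun u => - g u) s = - ins g s.
Proof.
elim: s g => [|x s IH] g /=; first by rewrite oppr0.
by rewrite IH splN opprD.
Qed.

Lemma ins0 g s :
  (forall p m q, s = p ++ m ++ q -> m <> [::] -> g (map si p ++ b m :: q) = 0) ->
  ins g s = 0.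
Proof.
move=> e; rewrite (eq_ins (g' := fun _ => 0)) //; elim: s {e} => //= x s ->.
by rewrite addr0 spl0.
Qed.

Lemma ins_closed (K : W -> Prop) g s : K 0 -> (forall x y, K x -> K y -> K (x + y)) ->
  (forall p m q, s = p ++ m ++ q -> m <> [::] -> K (g (map si p ++ b m :: q))) ->
  K (ins g s).
Proof.
move=> K0 KD; elim: s g => [|x s IH] g Kg //=; apply: (KD).
  by apply: spl_closed => // u v e; refine (Kg [::] (x :: u) v _ _) => //=; rewrite e.
by apply: IH => p m q e; refine (Kg (x :: p) m q _); rewrite /= e.
Qed.

(** The co-Leibniz rule. The inserted b lies either left or right of the cut; in the second case its
    sign has to pass the whole left word, which becomes [map si u]. *)
Lemma ins_spl (G : seq X -> seq X -> W) s :
  ins (spl G) s = spl (fun u v => ins (G^~ v) u) s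
                  + spl (fun u v => ins (G (map si u)) v) s.
Proof.
elim: s G => [|x s IH] G /=; first by rewrite addr0.
rewrite splD insD IH add0r; set I1 := ins _ s.
set S2 := spl (fun u v => ins _ u) s; set S3 := spl (fun u v => ins _ v) s.
rewrite (spl_assoc (fun u v1 v2 => G (b (x :: u) :: v1) v2)) !splD -/S2.
by rewrite -!addrA (addrCA S2 _ (_ + S3)) (addrCA S2 I1) addrCA.
Qed.

End Insert.

Lemma eq_ins_op (X : Type) (b b' : seq X -> X) (si : X -> X) (W : zmodType)
    (g g' : seq X -> W) s :
  (forall p m q, s = p ++ m ++ q -> m <> [::] ->
    g (map si p ++ b m :: q) = g' (map si p ++ b' m :: q)) ->
  ins b si g s = ins b' si g' s.
Proof.
elim: s g g' => //= x s IH g g' e; congr (_ + _).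
  by apply: eq_spl => u v es; apply: (e [::] (x :: u)); rewrite //= es.
by apply: IH => p m q es; apply: (e (x :: p)); rewrite /= es.
Qed.

Lemma cat_eq_cat_cons (X : Type) (e : X) (a c u v : seq X) : a ++ c = u ++ e :: v ->
  (exists l, a = u ++ e :: l /\ v = l ++ c) \/ (exists l, u = a ++ l /\ c = l ++ e :: v).
Proof.
elim: a u => [|x a IH] [|y u] /=.
- by move=> ->; right; exists [::].
- by move=> ->; right; exists (y :: u).
- by case=> <- <-; left; exists a.
by case=> <- /IH [] [l [-> ->]]; [left|right]; exists l.
Qed.

(** * Cancellation of insertions at a unit letter *)

Section Unit.
Variables (X W : zmodType) (b : seq X -> X) (si : X -> X) (e : X).
Hypothesis si_e : si e = - e.
Hypothesis b_single : forall x, b [:: x] = 0.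
Hypothesis b_e : forall p q, (1 < size (p ++ q))%N -> b (p ++ e :: q) = 0.
Hypothesis b_ex : forall x, b [:: e; x] = - x.
Hypothesis b_xe : forall x, b [:: x; e] = si x.

(** Only the products of e with its two neighbours survive. They give the same word with opposite
    signs, so everything cancels unless e stands at an end and one neighbour is missing. *)
Lemma ins_unit (g : seq X -> W) u v :
  (forall p q x, g (p ++ - x :: q) = - g (p ++ x :: q)) ->
  (forall p q, g (p ++ 0 :: q) = 0) ->
  (forall p q, p ++ q <> [::] -> g (p ++ e :: q) = 0) ->
  ins b si g (u ++ e :: v) =
    (if u is [::] then 0 else g (map si u ++ v)) -
    (if v is [::] then 0 else g (map si u ++ v)).
Proof.
elim: u g => [|x u IH] g gN g0 ge /=.
  rewrite [ins _ _ _ _]ins0 ?addr0 ?sub0r; last first.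
    move=> p m q _ _; rewrite si_e (gN [::]) /= (ge [::]) ?oppr0 //=.
    by case: (map si p).
  case: v => [|x v] /=; first by rewrite b_single (g0 [::]) oppr0.
  rewrite b_single (g0 [::]) add0r spl_first; last first.
    by move=> y a c _; rewrite (b_e (p := [::])) // (g0 [::]).
  by rewrite b_ex (gN [::]).
rewrite (IH (fun w => g (si x :: w))); last first.
- by move=> p q _; apply: (ge (si x :: p)).
- by move=> p q; apply: (g0 (si x :: p)).
- by move=> p q y; apply: (gN (si x :: p)).
rewrite addrA; congr (_ - _).
case: u {IH} => [|y u].
  rewrite /= addr0 b_single (g0 [::]) add0r spl_first ?b_xe // => y a c _.
  by rewrite (b_e (p := [:: x])) // (g0 [::]).
rewrite spl0 ?add0r // => a c es.
have [[l [-> _]]|[l [_ ->]]] := @cat_eq_cat_cons _ e a c (y :: u) v (esym es).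
  by rewrite -cat_cons b_e ?(g0 [::]) //=.
by apply: (ge (b (x :: a) :: l)).
Qed.

End Unit.

Lemma ins_morph (X : Type) (b : seq X -> X) (si : X -> X) (W W' : zmodType)
    (f : W -> W') (g : seq X -> W) s :
  {morph f : x y / x + y} -> f 0 = 0 -> f (ins b si g s) = ins b si (fun u => f (g u)) s.
Proof.
move=> fD f0; elim: s g => //= x s IH g; rewrite fD IH.
by congr (_ + _); apply: spl_morph.
Qed.

Definition mult (F : fieldType) (X W : lmodType F) (g : seq X -> W) :=
  forall (s t : seq X) (c : F) x y,
    g (s ++ (c *: x + y) :: t) = c *: g (s ++ x :: t) + g (s ++ y :: t).

Section Multilinear.
Variables (F : fieldType) (X W : lmodType F).
Implicit Types (g : seq X -> W).

Lemma mult_cat g p : mult g -> mult (fun u => g (p ++ u)).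
Proof. by move=> gM s t c x y; rewrite !catA gM. Qed.

Lemma mult_cons g x : mult g -> mult (fun u => g (x :: u)).
Proof. exact: (@mult_cat g [:: x]). Qed.

Lemma mult0 g p q : mult g -> g (p ++ 0 :: q) = 0.
Proof.
move=> gM; have := gM p q 1 0 0; rewrite scaler0 addr0 scale1r => /eqP.
by rewrite -subr_eq0 opprD addrA subrr sub0r oppr_eq0 => /eqP.
Qed.

Lemma multD g p q x y : mult g -> g (p ++ (x + y) :: q) = g (p ++ x :: q) + g (p ++ y :: q).
Proof. by move=> gM; have := gM p q 1 x y; rewrite !scale1r. Qed.

Lemma multZ g p q c x : mult g -> g (p ++ (c *: x) :: q) = c *: g (p ++ x :: q).
Proof. by move=> gM; have := gM p q c x 0; rewrite addr0 mult0 // addr0. Qed.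

Lemma multN g p q x : mult g -> g (p ++ - x :: q) = - g (p ++ x :: q).
Proof. by move=> gM; rewrite -scaleN1r multZ // scaleN1r. Qed.

Lemma splZ (c : F) (G : seq X -> seq X -> W) s :
  spl (fun u v => c *: G u v) s = c *: spl G s.
Proof. by rewrite (spl_morph (f := fun x => c *: x)) // => x y; exact: scalerDr. Qed.

Lemma insZ b si (c : F) g s : ins b si (fun u => c *: g u) s = c *: ins b si g s.
Proof.
rewrite (ins_morph b si (f := fun x => c *: x)) //; last exact: scaler0.
by move=> x y; exact: scalerDr.
Qed.

Lemma spl_mult (G : seq X -> seq X -> W) :
  (forall v, mult (G^~ v)) -> (forall u, mult (G u)) -> mult (spl G).
Proof.
move=> Gl Gr s; elim: s G Gl Gr => [|z s IH] G Gl Gr t c x y /=.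
  have := Gr [::] [::] t c x y; rewrite /= => ->; rewrite scalerDr addrACA.
  congr (_ + _); rewrite -splZ -splD; apply: eq_spl => u v _.
  exact: (Gl v [::]).
have := Gr [::] (z :: s) t c x y; rewrite /= => ->; rewrite scalerDr addrACA.
congr (_ + _); apply: IH => [v|u]; first exact: (@mult_cons (G^~ v)).
exact: (Gr (z :: u)).
Qed.

Variables (b : seq X -> X) (si : X -> X).
Hypothesis bM : mult b.
Hypothesis siL : forall c x y, si (c *: x + y) = c *: si x + si y.

Lemma ins_mult g : mult g -> mult (ins b si g).
Proof.
move=> gM s; elim: s g gM => [|z s IH] g gM t c x y /=.
  rewrite scalerDr addrACA; congr (_ + _).
    rewrite -splZ -splD; apply: eq_spl => u v _.
    by rewrite (bM [::]) (gM [::]).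
  rewrite -insZ -insD; apply: eq_ins => p m q _ _.
  by rewrite siL (gM [::]).
rewrite scalerDr addrACA; congr (_ + _); last by apply: IH; exact: mult_cons.
apply: spl_mult => [v|u].
  move=> s1 t1 c1 x1 y1; rewrite (bM (z :: s1)); exact: (gM [::]).
exact: mult_cons.
Qed.

Lemma mult_map g : mult g -> mult (fun s => g (map si s)).
Proof. by move=> gM s t c x y; rewrite !map_cat /= siL gM. Qed.

End Multilinear.

Section Coderivation.
Variables (F : fieldType) (X : lmodType F) (b : seq X -> X) (si : X -> X) (n : nat).
Hypothesis bsi : forall s, (size s <= n)%N -> si (b s) = - b (map si s).

(** Moving [si] through an insertion passes exactly one b, which is odd; hence the single sign. *)
Lemma ins_map (W : lmodType F) (g : seq X -> W) s : mult g -> (size s <= n)%N ->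
  ins b si (fun u => g (map si u)) s = - ins b si g (map si s).
Proof.
elim: s g => [|x s IH] g gM sn /=; first by rewrite oppr0.
rewrite opprD -IH; [|exact: mult_cons|exact: ltnW].
congr (_ + _); rewrite spl_map -splN; apply: eq_spl => u v es.
rewrite bsi; first exact: (multN [::]).
by apply: leq_trans sn; rewrite es /= ltnS size_cat leq_addr.
Qed.

Hypothesis stash : forall s, (size s <= n)%N -> ins b si b s = 0.

(** The coderivation squares to zero: nested insertions add up to a Stasheff sum, and disjoint ones
    occur in both orders with opposite signs because b is odd. The bound n is kept because during
    the recursive construction the identities are known only up to some length. *)
Lemma ins_ins (W : lmodType F) (g : seq X -> W) s : mult g -> (size s <= n)%N ->
  ins b si (ins b si g) s = 0.
Proof.
elim: s g => [|x s IH] g gM sn //=.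
rewrite insD splD ins_spl IH ?addr0; [|exact: mult_cons|exact: ltnW].
rewrite (spl_assoc (fun u v1 v2 => g (b (b (x :: u) :: v1) :: v2))).
rewrite addrACA -!splD; apply: spl0 => u v es.
have xu : (size (x :: u) <= n)%N.
  by apply: leq_trans sn; rewrite es /= ltnS size_cat leq_addr.
rewrite -insD [X in _ + X]ins0 ?addr0; last first.
  by move=> p m q _ _; rewrite bsi // (multN [::]) //= addNr.
have gD : {morph (fun y => g (y :: v)) : y z / y + z} by move=> y z; exact: (multD [::]).
have g0 : g (0 :: v) = 0 by exact: (mult0 [::]).
by rewrite -[RHS]g0 -(stash xu) (ins_morph _ _ _ _ gD g0).
Qed.

End Coderivation.

(** * Functionals and curvature *)

Section Restriction.
Variables (F : fieldType) (A : algType F) (M : lmodType A).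

(** An alias carrying the F-structure pulled back along c |-> c%:A, so that the notions for F-spaces
    apply to P, whose own module structure is over A. *)
Definition restr : Type := M.
HB.instance Definition _ := GRing.Zmodule.on restr.

Definition restr_scale (c : F) (x : restr) : restr := c%:A *: (x : M).

Let scaleA a b v : restr_scale a (restr_scale b v) = restr_scale (a * b) v.
Proof. by rewrite /restr_scale scalerA -scalerAl mul1r scalerA. Qed.
Let scale1 : left_id 1 restr_scale.
Proof. by move=> v; rewrite /restr_scale !scale1r. Qed.
Let scaleDr : right_distributive restr_scale +%R.
Proof. by move=> a u v; rewrite /restr_scale scalerDr. Qed.
Let scaleDl v : {morph restr_scale^~ v : a b / a + b}.
Proof. by move=> a b; rewrite /restr_scale !scalerDl. Qed.

HB.instance Definition _ :=
  GRing.Zmodule_isLmodule.Build F restr scaleA scale1 scaleDr scaleDl.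

End Restriction.

Section Functionals.
Variables (F : fieldType) (A : gradedAlg F) (M : lmodType A).

Definition trivial_functional : {pred M -> F^o} := [pred w | `[< to_trivial w >]].

Lemma trivial_functional_closed : submod_closed trivial_functional.
Proof.
split.
  by apply/asboolP; split=> [x y|c x|n a x _ _]; rewrite /= ?addr0 ?mulr0.
move=> c f g /asboolP[fD fZ f0] /asboolP[gD gZ g0]; apply/asboolP.
split=> [x y|k x|n a x n0 ax]; rewrite !fctE.
- by rewrite fD gD scalerDr addrACA.
- by rewrite fZ gZ /GRing.scale/= mulrDr mulrCA.
- by rewrite (f0 n) // (g0 n) // scaler0 addr0.
Qed.
HB.instance Definition _ := GRing.isSubmodClosed.Build F (M -> F^o)
  trivial_functional trivial_functional_closed.

(** No finiteness of support is imposed, unlike for the cochains that make up E(A); this keeps the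
    space closed under composition with every A-linear endomorphism of M. *)
Record functional := Functional {
  functional_val :> M -> F^o; _ : functional_val \in trivial_functional }.
HB.instance Definition _ := [isSub for functional_val].
HB.instance Definition _ := [Choice of functional by <:].
HB.instance Definition _ := [SubChoice_isSubLmodule of functional by <:].

Implicit Types (x y : functional) (g : {linear M -> M}).

Lemma functionalP x : to_trivial x.
Proof. exact/asboolP/(valP x). Qed.

Lemma functional_ext x y : (forall z, x z = y z) -> x = y.
Proof. by move=> e; apply/val_inj/funext. Qed.

Lemma exists_functional (w : M -> F) : to_trivial w -> exists x : functional, forall z, x z = w z.
Proof.
move=> wT; have wP : (w : M -> F^o) \in trivial_functional by apply/asboolP.
by exists (Functional wP).
Qed.

Lemma fvalD x y z : (x + y) z = x z + y z. Proof. by []. Qed.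
Lemma fvalN x z : (- x) z = - x z. Proof. by []. Qed.
Lemma fvalZ c x z : (c *: x) z = c * x z. Proof. by []. Qed.
Lemma fval0 z : (0 : functional) z = 0. Proof. by []. Qed.

Lemma functionalD x u v : x (u + v) = x u + x v. Proof. by case: (functionalP x). Qed.
Lemma functional0 x : x 0 = 0.
Proof. by apply: (@addrI _ (x 0)); rewrite -functionalD !addr0. Qed.
Lemma functionalN x u : x (- u) = - x u.
Proof. by apply: (@addrI _ (x u)); rewrite -functionalD !subrr functional0. Qed.

Lemma to_trivial_comp (w : M -> F) g : to_trivial w -> to_trivial (w \o g).
Proof.
case=> wD wZ w0; split=> [x y|c x|n a x n0 ax] /=; first by rewrite linearD wD.
  by rewrite linearZ /= wZ.
by rewrite linearZ /= (w0 n).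
Qed.

(** The default of [insubd] is never reached, since x o g always satisfies the predicate. *)
Definition act x g : functional := insubd x (x \o g : M -> F^o).

Lemma actE x g z : act x g z = x (g z).
Proof.
rewrite /act -[LHS]/(val _ z) val_insubd.
suff -> : (x \o g : M -> F^o) \in trivial_functional by [].
by apply/asboolP/to_trivial_comp/functionalP.
Qed.

End Functionals.

(** * Curvature and the Bianchi identity *)

Section Curvature.
Variables (F : fieldType) (A : gradedAlg F) (P : lmodType A) (tau : {linear P -> P}).
Hypothesis tauK : involutive tau.
Local Notation E := (functional P).

(** In the application tau acts on P_n by (-1)^n. So [sg] is the sign (-1)^p on functionals of
    degree p, and [si] is the sign of the suspended degree p - 1; both make sense without
    homogeneity. *)
Definition sg (x : E) : E := act x tau.
Definition si (x : E) : E := - sg x.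

Lemma sgE x z : sg x z = x (tau z). Proof. exact: actE. Qed.
Lemma siE x z : si x z = - x (tau z). Proof. by rewrite fvalN sgE. Qed.

Lemma siK : involutive si.
Proof. by move=> x; apply: functional_ext => z; rewrite !siE tauK opprK. Qed.

Lemma sgL c x y : sg (c *: x + y) = c *: sg x + sg y.
Proof. by apply: functional_ext => z; rewrite fvalD fvalZ !sgE fvalD fvalZ. Qed.

Lemma siL c x y : si (c *: x + y) = c *: si x + si y.
Proof. by rewrite /si sgL opprD scalerN. Qed.

Variable (phi : seq E -> {linear P -> P}).

(* The operations on functionals induced by phi, on the suspension, where they all
   have degree 1: sg and si carry the Koszul signs. *)
Definition bop (s : seq E) : E := if s is x :: s' then act (sg x) (phi s') else 0.

Lemma bopE x s z : bop (x :: s) z = x (tau (phi s z)).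
Proof. by rewrite actE sgE. Qed.

(* The curvature of phi; Omega = 0 says that phi is an A-infinity morphism from the
   functionals with the operations bop to End(P). *)
Definition Omega (s : seq E) (z : P) : P :=
  spl (fun u v => phi (map si u) (phi v z)) s + ins bop si (fun w => phi w z) s.

Definition pmult := forall z, mult (fun s : seq E => phi s z : restr P).
Hypothesis phiM : pmult.

Lemma bop_mult : mult bop.
Proof.
case=> [|x s] t c a b' /=; apply: functional_ext => z; rewrite fvalD fvalZ.
  by rewrite !(actE (sg _)) sgL fvalD fvalZ.
rewrite !(actE (sg _)); have /= -> := phiM z s t c a b'; rewrite functionalD; congr (_ + _).
by case: (functionalP (sg x)) => _ + _ => ->.
Qed.

Lemma Omega_mult z : mult (fun s => Omega s z : restr P).
Proof.
have mS : mult (spl (fun u v => phi (map si u) (phi v z)) : seq E -> restr P).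
  apply: spl_mult => [v|u].
    exact: (mult_map siL (phiM _)).
  move=> s t c x y; have /= -> := phiM z s t c x y.
  by rewrite linearD /=; congr (_ + _); rewrite linearZ.
have mI : mult (ins bop si (fun w => phi w z : restr P)).
  exact: (ins_mult bop_mult siL).
move=> s t c x y; have := mS s t c x y; have := mI s t c x y.
by rewrite /Omega /= => -> ->; rewrite scalerDr addrACA.
Qed.

Lemma Omega_comb s (a : A) z y : Omega s (a *: z + y) = a *: Omega s z + Omega s y.
Proof.
have aD : {morph (fun x : P => a *: x) : x y / x + y} by move=> x1 x2; exact: scalerDr.
have a0 : a *: (0 : P) = 0 by exact: scaler0.
rewrite /Omega scalerDr addrACA; congr (_ + _).
  rewrite (spl_morph _ _ aD).
  by rewrite -splD; apply: eq_spl => u v _; rewrite !linearP.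
rewrite (ins_morph _ _ _ _ aD a0) -insD; apply: eq_ins => p m q _ _.
by rewrite linearP.
Qed.

Hypothesis phi_par : forall s z, phi (map si s) z = - tau (phi s (tau z)).

Lemma si_bop s : si (bop s) = - bop (map si s).
Proof.
apply: functional_ext => z; rewrite siE fvalN; congr (- _).
case: s => [|x s]; first by [].
by rewrite /bop /= !actE siE tauK phi_par functionalN opprK.
Qed.

(** A term of the curvature contains two factors phi, or one phi and one b; all of these are odd
    under tau, so the signs cancel. *)
Lemma Omega_par s z : Omega (map si s) z = tau (Omega s (tau z)).
Proof.
rewrite /Omega linearD; congr (_ + _).
  rewrite spl_map (spl_morph _ _ (linearD tau)); apply: eq_spl => u v _.
  by rewrite (phi_par (map si u)) (phi_par v) !linearN opprK tauK.
have bsi s' : (size s' <= size s)%N -> si (bop s') = - bop (map si s').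
  by rewrite si_bop.
apply: oppr_inj.
rewrite -[LHS](ins_map bsi (phiM z) (leqnn _)).
rewrite (ins_morph _ _ _ _ (linearD tau) (linear0 tau)) -insN.
by apply: eq_ins => p m q _ _; rewrite phi_par.
Qed.

(* Apply x to the equation Omega s = 0. *)
Lemma stasheff_bop x s : (forall z, Omega s z = 0) -> ins bop si bop (x :: s) = 0.
Proof.
move=> Os; apply: functional_ext => z; rewrite fval0.
have evD : {morph (fun y : E => y z) : y1 y2 / y1 + y2} by [].
have -> : ins bop si bop (x :: s) z = ins bop si (fun u => bop u z) (x :: s).
  exact: (ins_morph _ _ _ _ evD (fval0 z)).
rewrite [ins _ _ _ _]/=.
rewrite -[RHS](functional0 (- x)) -(Os z) /Omega functionalD; congr (_ + _).
  rewrite (spl_morph _ _ (functionalD (- x))).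
  apply: eq_spl => u v _; rewrite fvalN !actE.
  by rewrite phi_par functionalN opprK.
rewrite (ins_morph _ _ _ _ (functionalD (- x)) (functional0 _)).
apply: eq_ins => p m q _ _.
by rewrite !actE siE tauK fvalN.
Qed.

Variable n : nat.
Hypothesis flat : forall s z, (size s <= n)%N -> Omega s z = 0.
Hypothesis phi_nil : forall x : E, act x (phi [::]) = 0.

(** The insertion sum of [Omega] over s is evaluated twice. It is zero term by term; expanded, it is
    the commutator of phi with the curvature, of which flatness on shorter words leaves only the two
    extreme terms. *)
Lemma bianchi s z : size s = n.+1 ->
  phi [::] (Omega s z) = Omega (map si s) (phi [::] z).
Proof.
move=> sn; have le_sn : (size s <= n.+1)%N by rewrite sn.
have stash s' : (size s' <= n.+1)%N -> ins bop si bop s' = 0.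
  by case: s' => [|x s'] // s'n; apply: stasheff_bop => y; exact: flat.
have bsi s' : (size s' <= n.+1)%N -> si (bop s') = - bop (map si s').
  by move=> _; exact: si_bop.
(* Inserting b of a single letter gives 0 by [phi_nil]; inserting b of a longer factor shortens the
   word to one on which the curvature is known to vanish. *)
have e0 : ins bop si (fun w => Omega w z) s = 0.
  apply: ins0 => p [//|x m] q es _; have [m0|m0] := posnP (size m).
    case: m m0 es => // _ _; rewrite [bop _]phi_nil.
    exact: (mult0 _ _ (Omega_mult z)).
  apply: flat; rewrite size_cat size_map /= -ltnS -sn es !size_cat /= -addnS leq_add2l.
  by rewrite addSn ltnS -add1n leq_add2r.
(* The double insertions vanish by [ins_ins], and the triple compositions of phi in the two sums are
   equal by associativity. *)
have : ins bop si (fun w => Omega w z) s =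
  spl (fun u v => phi u (Omega v z)) s - spl (fun u v => Omega (map si u) (phi v z)) s.
  rewrite insD ins_spl (ins_ins bsi stash (phiM z) le_sn) addr0.
  have -> : spl (fun u v => ins bop si (fun u0 => phi (map si u0) (phi v z)) u) s =
    - spl (fun u v => ins bop si (fun w => phi w (phi v z)) (map si u)) s.
    rewrite -splN; apply: eq_spl => u v es.
    apply: (ins_map bsi (phiM (phi v z))).
    by apply: leq_trans le_sn; rewrite es size_cat leq_addr.
  have -> : spl (fun u v => ins bop si (fun w => phi (map si (map si u)) (phi w z)) v) s
      = spl (fun u v => phi u (ins bop si (fun w => phi w z) v)) s.
    apply: eq_spl => u v _; rewrite mapK; last exact: siK.
    by rewrite (ins_morph _ _ _ _ (linearD (phi u)) (linear0 (phi u))).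
  rewrite [X in _ = _ - X]splD.
  have -> : spl (fun u v => phi u (Omega v z)) s
    = spl (fun u v => phi u (spl (fun v1 v2 => phi (map si v1) (phi v2 z)) v)) s
      + spl (fun u v => phi u (ins bop si (fun w => phi w z) v)) s.
    by rewrite -splD; apply: eq_spl => u v _; rewrite linearD.
  have <- : spl (fun u v => phi u (spl (fun v1 v2 => phi (map si v1) (phi v2 z)) v)) s
    = spl (fun u v => spl (fun u0 v0 => phi (map si u0) (phi v0 (phi v z))) (map si u)) s.
    transitivity (spl (fun u v => spl (fun v1 v2 => phi u (phi (map si v1) (phi v2 z))) v) s).
      by apply: eq_spl => u v _; apply: spl_morph; exact: linearD.
    rewrite (spl_assoc (fun u v1 v2 => phi u (phi (map si v1) (phi v2 z)))).
    apply: eq_spl => u v _; rewrite spl_map; apply: eq_spl => u1 u2 _.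
    by rewrite mapK //; exact: siK.
  by rewrite opprD addrACA subrr add0r addrC.
rewrite e0 => /esym/eqP; rewrite subr_eq0 => /eqP.
rewrite [X in _ = X]spl_last; last first.
  move=> u y v es; apply: flat; rewrite size_map -ltnS -sn es size_cat /= addnS ltnS.
  exact: leq_addr.
move=> <-; case: s sn {le_sn e0} => // x s [sn] /=; rewrite [X in _ + X]spl0 ?addr0 //.
move=> u v es; rewrite flat ?linear0 //.
by rewrite -sn es size_cat leq_addl.
Qed.

End Curvature.

(** * Free modules and resolutions *)

Lemma grading_ind (I : eqType) (V : zmodType) (V_ : I -> set V) (K : V -> Prop) :
  grading V_ -> K 0 -> (forall x y, K x -> K y -> K (x + y)) ->
  (forall i x, V_ i x -> K x) -> forall x, K x.
Proof.
move=> gV K0 KD KV x; have [s [f [_ Vf ->]]] := grading_sum gV x.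
by elim/big_ind: _ => // i _; exact: KV (Vf i).
Qed.

Lemma grading_neq (I : eqType) (V : zmodType) (V_ : I -> set V) i j x :
  grading V_ -> V_ i x -> V_ j x -> i != j -> x = 0.
Proof.
move=> gV Vi Vj ij; have [p [_ _ pid p0 _]] := grading_proj gV.
by rewrite -(pid _ _ Vi) (p0 i j).
Qed.

Section FreeModule.
Variables (R : nzRingType) (M : lmodType R) (B : set M).
Hypothesis basB : is_basis B.

Lemma sum_group (N : lmodType R) (g : M -> N) (s : seq (R * M)) :
  \sum_(e <- s) e.1 *: g e.2
  = \sum_(b <- undup (unzip2 s)) (\sum_(e <- s | e.2 == b) e.1) *: g b.
Proof.
rewrite [RHS](eq_bigr (fun b => \sum_(e <- s | e.2 == b) e.1 *: g e.2)); last first.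
  by move=> b _; rewrite scaler_suml; apply: eq_bigr => e /eqP ->.
rewrite (exchange_big_dep predT) //=; apply: eq_big_seq => e es.
have eU : e.2 \in undup (unzip2 s) by rewrite mem_undup; apply: map_f.
rewrite big_mkcond (bigD1_seq e.2) ?undup_uniq //= eqxx big1 ?addr0 // => b.
by rewrite eq_sym => /negPf ->.
Qed.

Lemma basis_expand x : exists (s : seq M) (c : M -> R),
  [/\ uniq s, forall b, b \in s -> B b & x = \sum_(b <- s) c b *: b].
Proof.
have [s [sB ->]] := basB.1 x.
exists (undup (unzip2 s)), (fun b => \sum_(e <- s | e.2 == b) e.1).
split; [exact: undup_uniq | | exact: (sum_group id)].
by move=> b; rewrite mem_undup => /mapP[e es ->]; exact: sB.
Qed.

(** Coefficients at repeated basis elements are collected before independence is applied. This is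
    what makes the extension in [basis_lift] independent of the chosen expansion. *)
Lemma basis_sum0 (N : lmodType R) (g : M -> N) (s : seq (R * M)) :
  (forall e, e \in s -> B e.2) -> \sum_(e <- s) e.1 *: e.2 = 0 ->
  \sum_(e <- s) e.1 *: g e.2 = 0.
Proof.
move=> sB; rewrite (sum_group id) (sum_group g) => U0; rewrite big_seq big1 // => b bU.
have bB b' : b' \in undup (unzip2 s) -> B b'.
  by rewrite mem_undup => /mapP[e es ->]; exact: sB.
by rewrite (basB.2 _ _ (undup_uniq _) bB U0 b bU) scale0r.
Qed.

Lemma basis_lift (N : lmodType R) (g : M -> N) :
  exists f : {linear M -> N}, forall b, B b -> f b = g b.
Proof.
pose rep x (s : seq (R * M)) :=
  (forall e, e \in s -> B e.2) /\ x = \sum_(e <- s) e.1 *: e.2.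
have ex x : exists s, rep x s by exact: basB.1.
pose r x := projT1 (cid (ex x)).
have rP x : rep x (r x) by rewrite /r; case: cid.
pose v (s : seq (R * M)) := \sum_(e <- s) e.1 *: g e.2.
have vP x s : rep x s -> v (r x) = v s.
  move=> [sB xs]; have [rB xr] := rP x; apply/eqP; rewrite -subr_eq0 -sumrN.
  have -> : \sum_(i <- s) - (i.1 *: g i.2)
      = \sum_(e <- [seq (- e.1, e.2) | e <- s]) e.1 *: g e.2.
    by rewrite big_map; apply: eq_bigr => e _; rewrite scaleNr.
  rewrite -big_cat /=; apply/eqP/basis_sum0.
    by move=> e; rewrite mem_cat => /orP[/rB //|/mapP[e' e's ->]]; exact: (sB e').
  rewrite big_cat big_map /= -xr [in X in _ + X](eq_bigr (fun e => - (e.1 *: e.2))).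
    by rewrite sumrN -xs subrr.
  by move=> e _; rewrite scaleNr.
have lin : linear (fun x => v (r x)).
  move=> a x y; rewrite (vP _ ([seq (a * e.1, e.2) | e <- r x] ++ r y)).
    rewrite /v big_cat big_map scaler_sumr; congr (_ + _).
    by apply: eq_bigr => e _; rewrite scalerA.
  have [xB ex'] := rP x; have [yB ey] := rP y; split.
    by move=> e; rewrite mem_cat => /orP[/mapP[e' e's ->]|]; [exact: (xB e')|exact: yB].
  rewrite big_cat big_map /= -ey {1}ex' scaler_sumr; congr (_ + _).
  by apply: eq_bigr => e _; rewrite scalerA.
pose fL := GRing.isLinear.Build R M N *:%R (fun x => v (r x)) lin.
pose f : {linear M -> N} := HB.pack (fun x => v (r x)) fL.
exists f => b Bb; rewrite -[LHS]/(v (r b)) (vP _ [:: (1, b)]).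
  by rewrite /v big_seq1 scale1r.
split; last by rewrite big_seq1 scale1r.
by move=> e; rewrite inE => /eqP ->.
Qed.

Lemma basis_ind (K : M -> Prop) : K 0 -> (forall a x y, K x -> K y -> K (a *: x + y)) ->
  (forall b, B b -> K b) -> forall x, K x.
Proof.
move=> K0 KZ KB x; have [s [sB ->]] := basB.1 x.
elim: s sB => [|e s IH] sB; first by rewrite big_nil.
rewrite big_cons; apply: KZ; first by apply: KB; apply: sB; rewrite mem_head.
by apply: IH => e' e's; apply: sB; rewrite inE e's orbT.
Qed.

End FreeModule.

Section Resolution.
Variables (F : fieldType) (A : gradedAlg F) (P : free_resolution A) (B : set P).
Hypothesis homB : forall b, B b -> exists i, rdeg P i b.
Hypothesis basB : is_basis B.

Local Notation gP := (rdeg_grading P).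

(** An expansion in the basis need not have homogeneous coefficients; splitting them into components
    and projecting to (n, j) discards every term of another degree. *)
Lemma rdeg_ind (K : P -> Prop) n j : K 0 -> (forall x y, K x -> K y -> K (x + y)) ->
  (forall k j' a b, B b -> rdeg P (n, j') b -> gdeg k a -> k%:Z + j' = j -> K (a *: b)) ->
  forall x, rdeg P (n, j) x -> K x.
Proof.
move=> K0 KD KB x xnj; have [p [pV pB pid p0 _]] := grading_proj gP.
have p00 : p (n, j) 0 = 0 by rewrite -[X in p _ X](subrr 0) pB subrr.
have pD : {morph p (n, j) : u v / u + v}.
  by move=> u v; have := pB (n, j) (u + v) v; rewrite addrK => ->; rewrite subrK.
rewrite -(pid _ _ xnj); elim/(basis_ind basB): x {xnj} => [|a x y Kx Ky|].
- by rewrite p00.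
- rewrite pD; apply: (KD) => //; move: x {Kx y Ky}.
  suff H x : K (p (n, j) (a *: x)) by [].
  elim/(basis_ind basB): x a => [|c x y Kx Ky|b Bb] a; first by rewrite scaler0 p00.
    by rewrite scalerDr scalerA pD; apply: (KD).
  apply: (grading_ind (K := fun a => K (p (n, j) (a *: b))) (gdeg_grading A)) a => [|u v Ku Kv|k a ka].
  + by rewrite scale0r p00.
  + by rewrite scalerDl pD; apply: (KD).
  have [[n' j'] bnj] := homB Bb; have abn := rdegZ ka bnj.
  have [e|ne] := eqVneq (n, j) (n', k%:Z + j'); last by rewrite (p0 _ _ _ abn).
  rewrite e pid //; case: e bnj => <- je bnj.
  exact: (KB k j').
move=> b Bb; have [[n' j'] bnj] := homB Bb.
have [e|ne] := eqVneq (n, j) (n', j'); last by rewrite (p0 _ _ _ bnj).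
rewrite e pid //; case: e bnj => <- <- bnj; rewrite -[b]scale1r.
by apply: (KB 0%N j) => //; [exact: gdeg1|rewrite add0r].
Qed.

(** Induction on homological degree: d lowers it by one and P is zero in negative degrees, so at a
    basis element b the claim for d b is available. *)
Lemma res_ind (K : P -> Prop) : K 0 -> (forall a x y, K x -> K y -> K (a *: x + y)) ->
  (forall b, B b -> K (rdiff P b) -> K b) -> forall x, K x.
Proof.
move=> K0 KZ KB.
have KD x y : K x -> K y -> K (x + y) by move=> Kx Ky; rewrite -[x]scale1r; exact: KZ.
have KZ0 a x : K x -> K (a *: x) by move=> Kx; rewrite -[_ *: _]addr0; exact: KZ.
suff H (n : nat) j x : rdeg P (n%:Z, j) x -> K x.
  apply: (grading_ind gP) => // [] [[n|n] j] x; first exact: H.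
  by move/rdeg_ge0 => ->.
elim: n j x => [|n IH] j; apply: rdeg_ind => // k j' a b Bb bn _ _; apply: (KZ0); apply: (KB) => //.
  by rewrite (rdeg_ge0 _ (rdiff_deg bn)).
by apply: (IH j'); have := rdiff_deg bn; rewrite -addn1 PoszD addrK.
Qed.

Lemma res_deg_ind (Q : free_resolution A) (f : {linear P -> Q}) (e : int * int) :
  (forall b i, B b -> rdeg P i b -> rdeg Q (i - (1, 0) + e) (f (rdiff P b)) ->
     rdeg Q (i + e) (f b)) ->
  forall i x, rdeg P i x -> rdeg Q (i + e) (f x).
Proof.
move=> fB; have gQ := rdeg_grading Q.
have Q0 i : rdeg Q i 0 by exact: (grading0 gQ).
suff H (n : nat) j x : rdeg P (n%:Z, j) x -> rdeg Q ((n%:Z, j) + e) (f x).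
  move=> [[n|n] j] x; first exact: H.
  by move/rdeg_ge0 => -> //; rewrite linear0.
case: e fB => e1 e2 fB.
elim: n j x => [|n IH] j; apply: rdeg_ind.
- by rewrite linear0.
- by move=> x y fx fy; rewrite linearD; exact: gradingD.
- move=> k j' a b Bb bn ka <-; rewrite linearZ /= -[_ + _]/(_, _ + _) -addrA.
  apply: rdegZ => //; apply: (fB _ _ Bb bn); rewrite (rdeg_ge0 _ (rdiff_deg bn)) //.
  by rewrite linear0.
- by rewrite linear0.
- by move=> x y fx fy; rewrite linearD; exact: gradingD.
move=> k j' a b Bb bn ka <-; rewrite linearZ /= -[_ + _]/(_, _ + _) -addrA.
apply: rdegZ => //; apply: (fB _ _ Bb bn).
have := rdiff_deg bn; rewrite -addn1 PoszD addrK => /IH.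
by rewrite -[(_, _) - _]/(_, _) /= addrK subr0.
Qed.

(* Linear maps out of P can be defined by recursion on the homological degree of
   the basis elements. *)
Lemma rec_lift (Q : lmodType A) (S : Type) (ka : S -> S) (O : S -> P -> Q) (H : Q -> Q) :
  exists f : S -> {linear P -> Q},
    forall s b, B b -> f s b = O s b + H (f (ka s) (rdiff P b)).
Proof.
have [lft lftP] := choice (basis_lift basB (N := Q)).
pose f := fix f n s := if n is n'.+1 then
    lft (fun b => O s b + H (f n' (ka s) (rdiff P b))) else lft (fun _ => 0).
(* The index n is fuel: in homological degrees below n the value of [f n] no longer depends on it,
   so each basis element can be given its own degree as fuel. *)
have stab n : forall m k s j x, rdeg P (k, j) x -> (k < n%:Z)%R -> (k < m%:Z)%R ->
    f n s x = f m s x.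
  elim: n => [|n IH] m k s j x xk kn km.
    by rewrite (rdeg_ge0 kn xk) !linear0.
  case: m km => [|m] km; first by rewrite (rdeg_ge0 km xk) !linear0.
  move: x xk; apply: rdeg_ind; first by rewrite !linear0.
    by move=> x y e1 e2; rewrite !linearD e1 e2.
  move=> l j' a b Bb bk _ _; rewrite !linearZ /=; congr (_ *: _).
  rewrite !lftP //; congr (_ + H _); apply: (IH _ _ _ _ _ (rdiff_deg bk)).
    by lia.
  by lia.
have deg b : exists n : nat, B b -> exists j, rdeg P (n%:Z, j) b.
  have [Bb|nB] := pselect (B b); last by exists 0%N.
  have [[[n|n] j] bn] := homB Bb; first by exists n => _; exists j.
  exists 0%N => _; exists 0; rewrite (rdeg_ge0 _ bn) //; exact: (grading0 gP).
have [hd hdP] := choice deg.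
exists (fun s => lft (fun b => O s b + H (f (hd b) (ka s) (rdiff P b)))) => s b Bb.
rewrite lftP //; congr (_ + H _).
have key n k t j x : rdeg P (k, j) x -> (k < n%:Z)%R ->
    lft (fun b => O t b + H (f (hd b) (ka t) (rdiff P b))) x = f n t x.
  move=> xk kn; move: x xk; apply: rdeg_ind; first by rewrite !linear0.
    by move=> x y e1 e2; rewrite !linearD e1 e2.
  move=> l j' a c Bc ck _ _; rewrite !linearZ /=; congr (_ *: _).
  case: n kn => [|n] kn; first by rewrite (rdeg_ge0 kn ck) !linear0.
  rewrite !lftP //; congr (_ + H _).
  have [j2 cj2] := hdP _ Bc.
  have [e|ne] := eqVneq (k, j') ((hd c)%:Z, j2); last first.
    by rewrite (grading_neq gP ck cj2 ne) !linear0.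
  case: e => ek _; apply: (stab _ _ _ _ _ _ (rdiff_deg ck)).
    by lia.
  by lia.
have [j bj] := hdP _ Bb; apply/esym/(key _ _ _ _ _ (rdiff_deg bj)).
by lia.
Qed.

End Resolution.

Local Open Scope classical_set_scope.

(** * Linear independence modulo a subspace *)

Section Independence.
Variables (F : fieldType) (V : lmodType F).
Implicit Types (G H S D K : set V) (x y : V).

Definition subspace K := K 0 /\ forall (c : F) x y, K x -> K y -> K (c *: x + y).

Lemma subspaceD K x y : subspace K -> K x -> K y -> K (x + y).
Proof. by case=> _ KZ Kx Ky; rewrite -[x]scale1r; exact: KZ. Qed.

Lemma subspaceZ K c x : subspace K -> K x -> K (c *: x).
Proof. by case=> K0 KZ Kx; rewrite -[c *: x]addr0; exact: KZ. Qed.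

Lemma subspaceN K x : subspace K -> K x -> K (- x).
Proof. by move=> sK Kx; rewrite -scaleN1r; exact: subspaceZ. Qed.

Lemma subspaceB K x y : subspace K -> K x -> K y -> K (x - y).
Proof. by move=> sK Kx Ky; apply: subspaceD => //; exact: subspaceN. Qed.

Lemma subspace_sum K (I : eqType) (s : seq I) (f : I -> V) : subspace K ->
  (forall i, i \in s -> K (f i)) -> K (\sum_(i <- s) f i).
Proof.
move=> sK Kf; rewrite big_seq; elim/big_ind: _ => //; first by case: sK.
by move=> x y; exact: subspaceD.
Qed.

Definition fspan G x := forall K, subspace K -> G `<=` K -> K x.

Lemma fspan_subspace G : subspace (fspan G).
Proof.
split=> [K [] //|c x y Gx Gy K sK GK].
by case: (sK) => _; apply; [exact: Gx|exact: Gy].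
Qed.

Lemma sub_fspan G : G `<=` fspan G. Proof. by move=> x Gx K _; apply. Qed.

Lemma fspanP G x : fspan G x -> exists (s : seq V) (c : V -> F),
  [/\ uniq s, forall b, b \in s -> G b & x = \sum_(b <- s) c b *: b].
Proof.
move/(_ (fun x => exists (s : seq V) (c : V -> F), [/\ uniq s, forall b, b \in s -> G b
  & x = \sum_(b <- s) c b *: b])); apply; last first.
  move=> g Gg; exists [:: g], (fun _ => 1); split=> //; last by rewrite big_seq1 scale1r.
  by move=> b; rewrite inE => /eqP ->.
split; first by exists [::], (fun _ => 0); rewrite big_nil.
have ext (s t : seq V) (c : V -> F) : uniq s ->
    \sum_(b <- s) c b *: b
      = \sum_(b <- undup (s ++ t)) (if b \in s then c b else 0) *: b.
  move=> us; rewrite [RHS](bigID (mem s)) /= [X in _ + X]big1 ?addr0; last first.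
    by move=> i /negPf ->; rewrite scale0r.
  rewrite -[RHS]big_filter big_seq.
  rewrite (eq_bigr (fun b => (if b \in s then c b else 0) *: b)); last by move=> i ->.
  rewrite -big_seq; apply: perm_big; apply: uniq_perm => //.
    by rewrite filter_uniq // undup_uniq.
  by move=> i; rewrite mem_filter mem_undup mem_cat; case: (i \in s).
move=> k y z [s [c [us Gs ->]]] [t [d [ut Gt ->]]].
exists (undup (s ++ t)), (fun b => k * (if b \in s then c b else 0)
  + (if b \in t then d b else 0)); split; first exact: undup_uniq.
  by move=> b; rewrite mem_undup mem_cat => /orP[/Gs|/Gt].
rewrite (ext s t c us) (ext t s d ut) scaler_sumr.
rewrite [X in _ + X = _](perm_big (undup (s ++ t))); last first.
  apply: uniq_perm; rewrite ?undup_uniq // => i.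
  by rewrite !mem_undup !mem_cat orbC.
by rewrite -big_split; apply: eq_bigr => b _; rewrite scalerDl scalerA.
Qed.

Definition indep_mod D G := forall (s : seq V) (c : V -> F), uniq s ->
  (forall b, b \in s -> G b) -> D (\sum_(b <- s) c b *: b) ->
  forall b, b \in s -> c b = 0.

Lemma indep_mod_disjoint D G x : indep_mod D G -> fspan G x -> D x -> x = 0.
Proof.
move=> ind /fspanP[s [c [us Gs ->]]] Dx; rewrite big_seq big1 // => b bs.
by rewrite (ind _ _ us Gs Dx) // scale0r.
Qed.

Lemma indep_extend D S H : subspace D -> S `<=` H -> indep_mod D S ->
  exists G, [/\ S `<=` G, G `<=` H, indep_mod D G &
    forall x, H x -> exists2 g, fspan G g & D (x - g)].
Proof.
move=> sD SH indS.
(* S is adjoined inside the predicate instead of being required in G, because the union of the empty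
   chain is empty and must satisfy Q as well. *)
pose Q G := G `<=` H /\ indep_mod D (G `|` S).
have [C CQ tot|G [[GH indG] maxG]] := @Zorn_bigcup V Q.
  split; first by move=> x [X CX Xx]; case: (CQ _ CX) => XH _; exact: XH.
  move=> s c us sC.
  have : (forall b, b \in s -> S b) \/
      exists2 X, C X & forall b, b \in s -> (X `|` S) b.
    elim: s sC {us} => [|x s IH] sC; first by left.
    have [b bs|sS|[X CX sX]] := IH.
    - by apply: sC; rewrite inE bs orbT.
    - have [[X CX Xx]|Sx] := sC x (mem_head _ _); last first.
        by left=> b; rewrite inE => /orP[/eqP -> //|/sS].
      by right; exists X => // b; rewrite inE => /orP[/eqP ->|/sS]; [left|right].
    have [[Y CY Yx]|Sx] := sC x (mem_head _ _); last first.
      by right; exists X => // b; rewrite inE => /orP[/eqP ->|/sX //]; right.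
    right; have [XY|YX] := tot _ _ CX CY; [exists Y|exists X] => // b;
        rewrite inE => /orP[/eqP ->|/sX [Xb|Sb]].
    + by left.
    + by left; exact: XY.
    + by right.
    + by left; exact: YX.
    + by left.
    + by right.
  case=> [sS|[X CX sX]]; first exact: indS.
  by case: (CQ _ CX) => _; apply.
exists (G `|` S); split=> [x Sx|x [/GH|/SH] //||x Hx]; [by right|by []|].
apply: contrapT => no.
have nG : ~ (G `|` S) x.
  move=> Gx; apply: no; exists x; first exact: sub_fspan.
  by rewrite subrr; case: sD.
apply: (maxG (G `|` [set x])).
  split; last by move=> h; apply: nG; left; apply: h; right.
  by move=> y Gy; left.
split; first by move=> y [/GH|->].
move=> s c us sG Ds.
have sub b : b \in s -> b != x -> (G `|` S) b.
  by move=> /sG [[Gb|->]|Sb] bx; [left|rewrite eqxx in bx|right].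
have [xs|xs] := boolP (x \in s); last first.
  move=> b bs; apply: (indG s c us _ Ds) => // b' b's; apply: sub => //.
  by apply: contra xs => /eqP <-.
have ur : uniq (rem x s) by exact: rem_uniq.
have sr b : b \in rem x s -> (G `|` S) b.
  by rewrite mem_rem_uniq // !inE => /andP[bx bs]; exact: sub.
rewrite (perm_big _ (perm_to_rem xs)) big_cons /= in Ds.
have [cx0|cx] := eqVneq (c x) 0.
  rewrite cx0 scale0r add0r in Ds; move=> b bs.
  have [-> //|bx] := eqVneq b x; apply: (indG _ _ ur sr Ds).
  by rewrite mem_rem_uniq // !inE bx.
case: no; exists (- ((c x)^-1 *: \sum_(b <- rem x s) c b *: b)).
  apply: subspaceN (fspan_subspace _) _; apply: subspaceZ (fspan_subspace _) _.
  apply: subspace_sum (fspan_subspace _) _ => b /sr Gb.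
  by apply: subspaceZ (fspan_subspace _) _; exact: sub_fspan.
rewrite opprK; have := subspaceZ (c x)^-1 sD Ds.
by rewrite scalerDr scalerA mulVf // scale1r.
Qed.

End Independence.

(** * Exactness and contracting homotopies *)

Section Exactness.
Variables (F : fieldType) (A : gradedAlg F) (P : free_resolution A).
Local Notation gP := (rdeg_grading P).

Lemma raugD x y : raug P (x + y) = raug P x + raug P y.
Proof. by case: (raug_triv P). Qed.

Lemma raugZ (c : F) x : raug P (c%:A *: x) = c * raug P x.
Proof. by case: (raug_triv P). Qed.

Lemma raug0 : raug P 0 = 0.
Proof. by apply: (@addrI _ (raug P 0)); rewrite -raugD !addr0. Qed.

Lemma raugN x : raug P (- x) = - raug P x.
Proof. by apply: (@addrI _ (raug P x)); rewrite -raugD !subrr raug0. Qed.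

Lemma res_proj : exists p : int * int -> P -> P,
  [/\ [/\ forall i x, rdeg P i (p i x), forall i x, rdeg P i x -> p i x = x &
          forall i j x, rdeg P j x -> i != j -> p i x = 0],
      forall i x y, p i (x + y) = p i x + p i y,
      forall i (c : F) x, p i (c%:A *: x) = c%:A *: p i x,
      forall i x, p i (rdiff P x) = rdiff P (p (i + (1, 0)) x) &
      (forall i x, i != (0, 0) -> raug P (p i x) = 0) /\
      (forall x, raug P (p (0, 0) x) = raug P x) /\
      (forall K : P -> Prop, K 0 -> (forall x y, K x -> K y -> K (x + y)) ->
        forall x, (forall i, K (p i x)) -> K x)].
Proof.
have [p [pV pB pid p0 psum]] := grading_proj gP.
have pD i x y : p i (x + y) = p i x + p i y.
  by have := pB i (x + y) y; rewrite addrK => ->; rewrite subrK.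
exists p; split=> [//|//|i c x|i x|].
- rewrite -[in LHS](addr0 i).
  apply: (proj_shift (g := fun x => c%:A *: x) pV pB pid p0 psum).
    by move=> u v; exact: scalerBr.
  move=> [n j] u unj; rewrite addr0 -[j]add0r.
  by apply: (rdegZ (k := 0)) => //; apply: gdegZ; exact: gdeg1.
- rewrite -{1}[i](addrK (1, 0)).
  apply: (proj_shift pV pB pid p0 psum) => [{}x y|[n j] {}x]; first exact: linearB.
  by move=> xnj; have := rdiff_deg xnj; rewrite -[(n, j) - _]/(n - 1, j - 0) subr0.
have r0 i x : i != (0, 0) -> raug P (p i x) = 0 by move=> /raug_deg; apply.
split => //; split=> [x|K K0 KD x Kx].
  have [s [us s0 {2}->]] := psum x.
  rewrite (big_morph _ raugD raug0); have [si|si] := boolP ((0, 0) \in s).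
    by rewrite (bigD1_seq (0, 0)) //= big1 ?addr0 // => i; exact: r0.
  rewrite s0 // raug0 big_seq big1 // => i iS; apply: r0.
  by apply: contra si => /eqP <-.
by have [s [_ _ ->]] := psum x; elim/big_ind: _.
Qed.

Lemma res_exactness x : rdiff P x = 0 -> raug P x = 0 -> exists y, x = rdiff P y.
Proof.
move=> dx0 rx0; have [p [[pV _ _] pD pZ pd [r0 [r00 psum]]]] := res_proj.
have p0 i : p i 0 = 0 by apply: (@addrI _ (p i 0)); rewrite -pD !addr0.
apply: (psum (fun x => exists y, x = rdiff P y)) => [|u v [y ->] [z ->]|[n j]]; first by exists 0; rewrite linear0.
  by exists (y + z); rewrite linearD.
have dp : rdiff P (p (n, j) x) = 0.
  by rewrite -[(n, j)](subrK (1, 0)) -pd dx0 p0.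
have xn := pV (n, j) x; have [n0|n0|n0] := ltgtP n 0.
- by exists 0; rewrite linear0; exact: rdeg_ge0 xn.
- exact: res_exact xn dp.
rewrite n0 in xn *; apply: res_exact0 xn _.
by have [->|j0] := eqVneq j 0; [rewrite r00|apply: r0; rewrite xpair_eqE eqxx].
Qed.

Lemma range_diff_subspace : subspace (range (rdiff P) : set (restr P)).
Proof.
split; first by exists 0 => //; exact: linear0.
move=> c _ _ [x _ <-] [y _ <-]; exists (c%:A *: x + y) => //.
by rewrite linearP.
Qed.

(** S is extended to a homogeneous set whose F-span C is a complement of the boundaries. Then h x is
    the unique c in C with augmentation 0 and x - d c in C; linearity, degree and the homotopy
    formula all follow from uniqueness. On S the choice c = 0 is allowed, so h vanishes there. *)
Lemma contraction (S : set P) (one : P) :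
  (forall x, S x -> exists i, rdeg P i x) ->
  indep_mod (V := restr P) (range (rdiff P)) S ->
  S one -> rdeg P (0, 0) one -> raug P one = 1 ->
  exists h : P -> P,
    [/\ forall c x y, h (c%:A *: x + y) = c%:A *: h x + h y,
        forall n j x, rdeg P (n, j) x -> rdeg P (n + 1, j) (h x),
        forall x, rdiff P (h x) + h (rdiff P x) = x - (raug P x)%:A *: one,
        forall x, raug P (h x) = 0 &
        forall x, S x -> h x = 0].
Proof.
move=> homS indS S1 deg1 aug1.
pose D : set (restr P) := range (rdiff P).
have sD : subspace D by exact: range_diff_subspace.
pose Hom : set (restr P) := [set x | exists i, rdeg P i x].
have [G [SG GH indG GD]] := indep_extend sD (H := Hom) homS indS.
pose C := fspan (V := restr P) G.
have sC : subspace C by exact: fspan_subspace.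
have C1 : C one by apply: sub_fspan; exact: SG.
have CD (x : P) : C x -> D x -> x = 0.
  by move=> Cx Dx; exact: (indep_mod_disjoint indG Cx Dx).
have d1 : rdiff P one = 0 by exact: rdeg_ge0 (rdiff_deg deg1).
have spans (x : P) : exists2 g : P, C g & exists y, x = g + rdiff P y.
  move: x; apply: (grading_ind (K := fun x : P => exists2 g : P, C g &
    exists y, x = g + rdiff P y) gP) => [|x y [g Cg [u ->]] [g' Cg' [u' ->]]|i x xi].
  - by exists 0; [case: sC|exists 0; rewrite linear0 addr0].
  - exists (g + g'); first exact: (subspaceD sC).
    by exists (u + u'); rewrite linearD addrACA.
  have [|g Cg [y _ e]] := GD x; first by exists i.
  exists g => //; exists y; apply/eqP; rewrite addrC -subr_eq; apply/eqP.
  exact: esym e.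
have [p [[pV pid pne] pD pZ pd [r0 [r00 _]]]] := res_proj.
have p0 i : p i 0 = 0 by apply: (@addrI _ (p i 0)); rewrite -pD !addr0.
have pB i x y : p i (x - y) = p i x - p i y.
  by apply: (@addIr _ (p i y)); rewrite -pD !subrK.
have Cp i x : C x -> C (p i x).
  move=> Cx; have sK : subspace (V := restr P) [set x | C (p i x)].
    split; first by rewrite /= p0; case: sC.
    move=> c u v Cu Cv; rewrite /=.
    have -> : p i (c *: u + v) = c *: (p i u : restr P) + p i v.
      by rewrite -[RHS]/(c%:A *: p i u + p i v) -pZ -pD.
    by apply: sC.2.
  apply: (Cx _ sK) => g Gg /=; have [k gk] := GH g Gg.
  have [->|ki] := eqVneq i k; first by rewrite pid //; exact: sub_fspan.
  by rewrite (pne _ _ _ gk ki); case: sC.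
(* Without the condition on the augmentation c could be changed by multiples of [one], a cycle lying
   in C. *)
pose R x c := [/\ C c, raug P c = 0 & C (x - rdiff P c)].
have exR x : exists c, R x c.
  have [g Cg [y ->]] := spans x; have [g' Cg' [y' ->]] := spans y.
  exists (g' - (raug P g')%:A *: one); split.
  - by apply: (subspaceB sC) => //; exact: (subspaceZ _ sC).
  - by rewrite raugD raugN raugZ aug1 mulr1 subrr.
  by rewrite linearD rdiffK addr0 linearB linearZ /= d1 scaler0 subr0 addrK.
have uniqR x c c' : R x c -> R x c' -> c = c'.
  move=> [Cc rc Cdc] [Cc' rc' Cdc']; apply/eqP; rewrite -subr_eq0; apply/eqP.
  have Ccc : C (c - c') by exact: (subspaceB sC).
  apply: (CD) => //; have [||y ->] := @res_exactness (c - c'); last by exists y.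
    apply: CD; last by exists (c - c').
    have := subspaceB sC Cdc' Cdc; congr C.
    by rewrite opprB [LHS]addrC addrA subrK linearB.
  by rewrite raugD raugN rc rc' subrr.
have [h hR] := choice exR; exists h; split.
- move=> c x y; apply: uniqR (hR _) _; have [Cx rx dx] := hR x; have [Cy ry dy] := hR y.
  split; first by apply: sC.2.
    by rewrite raugD raugZ rx ry mulr0 addr0.
  rewrite linearP opprD addrACA -scalerBr.
  by apply: sC.2.
- move=> n j x xnj; have [Cx rx dx] := hR x.
  suff -> : h x = p (n + 1, j) (h x) by exact: pV.
  apply: uniqR (hR x) _; split; first exact: Cp.
    have [->|ne] := eqVneq (n + 1, j) (0, 0); first by rewrite r00.
    exact: r0.
  have := Cp (n, j) _ dx; rewrite pB pid // pd.
  by rewrite -[(n, j) + _]/(n + 1, j + 0) addr0.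
- move=> x; have [Cx rx dx] := hR x.
  suff -> : h (rdiff P x) = x - rdiff P (h x) - (raug P x)%:A *: one.
    by rewrite addrA addrCA subrr addr0.
  apply: uniqR (hR _) _; split.
  - by apply: (subspaceB sC) => //; exact: (subspaceZ _ sC).
  - by rewrite !raugD !raugN raugZ raug_diff aug1 mulr1 subr0 subrr.
  have -> : rdiff P (x - rdiff P (h x) - (raug P x)%:A *: one) = rdiff P x.
    by rewrite !raddfB /= linearZ /= rdiffK d1 scaler0 !subr0.
  by rewrite subrr; case: sC.
- by move=> x; case: (hR x).
move=> x Sx; apply: uniqR (hR x) _; split; [by case: sC|exact: raug0|].
by rewrite linear0 subr0; apply: sub_fspan; exact: SG.
Qed.

End Exactness.

(** * The twisting family phi on a minimal resolution *)

Section ConnectedAlgebra.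
Variables (F : fieldType) (A : gradedAlg F).
Hypothesis hconn : connected A.

Lemma functional_scale (M : lmodType A) (x : functional M) (a : A) u :
  x u = 0 -> x (a *: u) = 0.
Proof.
have [_ xZ xpos] := functionalP x; move=> xu0.
apply: (grading_ind (K := fun a => x (a *: u) = 0) (gdeg_grading A)) a.
- by rewrite scale0r functional0.
- by move=> a b; rewrite scalerDl functionalD => -> ->; rewrite addr0.
move=> [|n] a an; last exact: (xpos n.+1).
by have [c ->] := hconn an; rewrite xZ xu0 mulr0.
Qed.

Lemma functional_eq (M : lmodType A) (B : set M) (x y : functional M) :
  is_basis B -> (forall b, B b -> x b = y b) -> x = y.
Proof.
move=> basB xy; apply: functional_ext => z; apply/eqP; rewrite -subr_eq0.
rewrite -fvalN -fvalD; apply/eqP; move: z.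
apply: (basis_ind (K := fun z => (x - y) z = 0) basB).
- exact: functional0.
- by move=> a u v xu xv; rewrite functionalD xv addr0 functional_scale.
by move=> b Bb; rewrite fvalD fvalN xy // subrr.
Qed.

End ConnectedAlgebra.

Lemma bideg_eq (x y : int * int) : x.1 = y.1 -> x.2 = y.2 -> x = y.
Proof. by case: x y => [a b] [c e] /= -> ->. Qed.
Lemma fstD (x y : int * int) : (x + y).1 = x.1 + y.1. Proof. by []. Qed.
Lemma fstN (x : int * int) : (- x).1 = - x.1. Proof. by []. Qed.
Lemma sndD (x y : int * int) : (x + y).2 = x.2 + y.2. Proof. by []. Qed.
Lemma sndN (x : int * int) : (- x).2 = - x.2. Proof. by []. Qed.

Ltac bidegs := apply: bideg_eq; rewrite ?(fstD, fstN, sndD, sndN) /=; lia.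

Section Words.
Variables (T U V : Type).

Lemma forall2_cat (R : T -> U -> Prop) ds s es t :
  forall2 R ds s -> forall2 R es t -> forall2 R (ds ++ es) (s ++ t).
Proof. by elim: ds s => [|d ds IH] [|x s] //= [xd /IH h] /h. Qed.

Lemma forall2_split (R : T -> U -> Prop) ds u v : forall2 R ds (u ++ v) ->
  exists d1 d2, [/\ ds = d1 ++ d2, forall2 R d1 u & forall2 R d2 v].
Proof.
elim: u ds => [|x u IH] ds; first by exists [::], ds.
case: ds => //= d ds [dx /IH[d1 [d2 [-> h1 h2]]]].
by exists (d :: d1), d2.
Qed.

Lemma forall2_map (R : T -> U -> Prop) (R' : T -> V -> Prop) (f : U -> V) ds s :
  (forall d x, R d x -> R' d (f x)) -> forall2 R ds s -> forall2 R' ds (map f s).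
Proof. by move=> RR'; elim: ds s => [|d ds IH] [|x s] //= [/RR' dx /IH]. Qed.

Lemma forall2_size (R : T -> U -> Prop) ds s : forall2 R ds s -> size ds = size s.
Proof. by elim: ds s => [|d ds IH] [|x s] //= [_ /IH ->]. Qed.

End Words.

(* The degree of a word in the bar construction. *)
Definition wdeg (ds : seq (int * int)) : int * int := \sum_(d <- ds) (d - (1, 0)).

Lemma wdeg_nil : wdeg [::] = 0. Proof. by rewrite /wdeg big_nil. Qed.
Lemma wdeg_cons d ds : wdeg (d :: ds) = d - (1, 0) + wdeg ds.
Proof. by rewrite /wdeg big_cons. Qed.
Lemma wdeg_cat ds es : wdeg (ds ++ es) = wdeg ds + wdeg es.
Proof. by rewrite /wdeg big_cat. Qed.

Definition fdeg (F : fieldType) (A : gradedAlg F) (P : free_resolution A) (i : int * int)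
  (x : functional P) := forall k z, k != i -> rdeg P k z -> x z = 0.

(** * Recursive construction of phi *)

Section Construction.
Variables (F : fieldType) (A : gradedAlg F) (P : free_resolution A) (B : set P).
Hypothesis hconn : connected A.
Hypothesis hmin : minimal P.
Hypothesis homB : forall b, B b -> exists i, rdeg P i b.
Hypothesis basB : is_basis B.
Local Notation E := (functional P).
Local Notation d := (rdiff P).

(** By minimality d z lies in A_{>=1} P, on which functionals vanish. This is what makes the unary
    operation b(x) zero. *)
Lemma functional_diff (x : E) z : x (d z) = 0.
Proof.
have [s [sB ->]] := hmin z; elim: s sB => [|e s IH] sB.
  by rewrite big_nil functional0.
rewrite big_cons functionalD IH ?addr0; last first.
  by move=> e' e's; apply: sB; rewrite inE e's orbT.
have [k k0 ke] := sB e (mem_head _ _).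
by have [_ _ x0] := functionalP x; exact: (x0 k).
Qed.

Lemma parity_ex : exists tau : {linear P -> P},
  forall n j x, rdeg P (n, j) x -> tau x = sign A n *: x.
Proof.
have gP := rdeg_grading P.
have ex b : exists i, B b -> rdeg P i b.
  have [Bb|nB] := pselect (B b); first by have [i bi] := homB Bb; exists i.
  by exists (0, 0).
have [dg dgP] := choice ex.
have [tau tauE] := basis_lift basB (fun b => sign A (dg b).1 *: b).
exists tau => n j; apply: (rdeg_ind homB basB); first by rewrite linear0 scaler0.
  by move=> x y e1 e2; rewrite linearD e1 e2 scalerDr.
move=> k j' a b Bb bn ka _; rewrite linearZ /= tauE // !scalerA commr_sign.
have [<- //|ne] := eqVneq (n, j') (dg b).
by rewrite (grading_neq gP bn (dgP _ Bb) ne) !scaler0.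
Qed.

Variable tau : {linear P -> P}.
Hypothesis tauE : forall n j x, rdeg P (n, j) x -> tau x = sign A n *: x.

Lemma signE (R : nzRingType) (n : int) : sign R n = (-1) ^+ odd (absz n).
Proof. by rewrite /sign signr_odd. Qed.

Lemma sign_succ (n : int) : sign A (n + 1) = - sign A n.
Proof.
rewrite !signE; have -> : odd (absz (n + 1)) = ~~ odd (absz n) by lia.
by case: odd; rewrite /= ?expr0 ?expr1 ?opprK.
Qed.

Lemma sign_pred (n : int) : sign A (n - 1) = - sign A n.
Proof. by rewrite -[in RHS](subrK 1 n) sign_succ opprK. Qed.

Lemma sign2 (n : int) : sign A n * sign A n = 1.
Proof. by rewrite signE -expr2 sqrr_sign. Qed.

Local Notation hind K := (grading_ind (K := K) (rdeg_grading P)).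

Lemma tauK : involutive tau.
Proof.
apply: (hind (fun x => tau (tau x) = x)) => [|x y e1 e2|[n j] x xn].
- by rewrite !linear0.
- by rewrite !linearD e1 e2.
by rewrite !(tauE xn) linearZ /= (tauE xn) scalerA sign2 scale1r.
Qed.

Lemma tau_diff x : tau (d x) = - d (tau x).
Proof.
move: x; apply: (hind (fun x => tau (d x) = - d (tau x))) => [|x y e1 e2|[n j] x xn].
- by rewrite !linear0 ?oppr0.
- by rewrite !linearD e1 e2 ?opprD.
by rewrite (tauE xn) (tauE (rdiff_deg xn)) sign_pred linearZ /= scaleNr.
Qed.

Lemma sign_scale (n : int) : sign A n = (sign F n)%:A.
Proof.
rewrite !signE.
by case: odd => /=; rewrite ?expr0 ?expr1 ?scale1r // scaleN1r.
Qed.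

Lemma raug_tau x : raug P (tau x) = raug P x.
Proof.
move: x; apply: (hind (fun x => raug P (tau x) = raug P x)) => [|x y e1 e2|[n j] x xn].
- by rewrite linear0.
- by rewrite linearD !raugD e1 e2.
rewrite (tauE xn); have [[-> _]|ne] := eqVneq (n, j) (0, 0); first by rewrite [sign A 0]expr0 scale1r.
by rewrite sign_scale raugZ (raug_deg ne xn) mulr0.
Qed.

Variable h : P -> P.
Hypothesis hL : forall c x y, h (c%:A *: x + y) = c%:A *: h x + h y.
Hypothesis h_deg : forall n j x, rdeg P (n, j) x -> rdeg P (n + 1, j) (h x).

Lemma h0 : h 0 = 0.
Proof. by apply: (@addrI _ (h 0)); have := hL 1 0 0; rewrite !scale1r !addr0. Qed.

Lemma hD x y : h (x + y) = h x + h y.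
Proof. by have := hL 1 x y; rewrite !scale1r. Qed.

Lemma hZ c x : h (c%:A *: x) = c%:A *: h x.
Proof. by have := hL c x 0; rewrite h0 !addr0. Qed.

Lemma hN x : h (- x) = - h x.
Proof. by apply: (@addrI _ (h x)); rewrite -hD !subrr h0. Qed.

Lemma tau_h x : tau (h x) = - h (tau x).
Proof.
move: x; apply: (hind (fun x => tau (h x) = - h (tau x))) => [|x y e1 e2|[n j] x xn].
- by rewrite linear0 h0 linear0 oppr0.
- by rewrite linearD !hD linearD e1 e2 ?opprD.
rewrite (tauE xn) (tauE (h_deg xn)) sign_succ scaleNr; congr (- _).
rewrite !signE; case: odd => /=; rewrite ?expr0 ?expr1 ?scale1r //.
by rewrite !scaleN1r hN.
Qed.

Variable one : P.
Hypothesis deg1 : rdeg P (0, 0) one.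
Hypothesis aug1 : raug P one = 1.
Hypothesis dh : forall x, d (h x) + h (d x) = x - (raug P x)%:A *: one.
Hypothesis raug_h : forall x, raug P (h x) = 0.
Hypothesis hB : forall b, B b -> h b = 0.

Local Notation si := (si tau).
Local Notation Omega := (Omega tau).
Local Notation bop := (bop tau).

(** The sign gives raug o phi(w) = -w. As the morphism to End(P) is built from -phi, the cocycle
    attached to its first component at x is then exactly x. *)
Definition base (s : seq E) (b : P) : P :=
  if s is [:: w] then (- w b)%:A *: one else 0.

(* The next value of phi is prescribed on the basis so that its boundary cancels the
   curvature, up to the contraction h; base fixes its component along one. *)
Definition psi (phi : seq E -> {linear P -> P}) : seq E -> {linear P -> P} :=
  projT1 (cid (rec_lift homB basB (map si) (fun s b => base s b - h (Omega phi s b))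
    (fun z => - h z))).

Lemma psiE phi s b : B b ->
  psi phi s b = base s b - h (Omega phi s b) - h (psi phi (map si s) (d b)).
Proof. by rewrite /psi; case: cid => f fE /=; exact: fE. Qed.

(** Stage n is zero on words longer than n, so on a word of length n + 1 its curvature consists of
    precisely the terms already determined. *)
Fixpoint Phi (n : nat) : seq E -> {linear P -> P} :=
  if n is n'.+1 then
    fun s => if size s == n then psi (Phi n') s else Phi n' s
  else fun s => if s is [::] then rdiff P else \0.

Lemma d_one : d one = 0.
Proof. exact: rdeg_ge0 (rdiff_deg deg1). Qed.

Lemma tau_one : tau one = one.
Proof. by rewrite (tauE deg1) [sign A 0]expr0 scale1r. Qed.

Lemma base_mult s t c x y b :
  base (s ++ (c *: x + y) :: t) b = c%:A *: base (s ++ x :: t) b + base (s ++ y :: t) b.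
Proof.
case: s => [|a [|a' s]] /=; [|by rewrite scaler0 addr0|by rewrite scaler0 addr0].
case: t => [|a t]; last by rewrite scaler0 addr0.
rewrite -[LHS]/((- (c * x b + y b))%:A *: one).
by rewrite opprD !scalerDl scalerA -scalerAl mul1r scalerA mulrN.
Qed.

Lemma psi_mult phi : pmult phi -> pmult (psi phi).
Proof.
move=> phiM z s t c x y; rewrite -[RHS]/(c%:A *: psi phi (s ++ x :: t) z + _).
move: z s t c x y; apply: (res_ind homB basB) => [|a u v eu ev|b Bb IH] s t c x y.
- by rewrite !linear0 scaler0 addr0.
- rewrite !linearP /= eu ev !scalerDr addrACA; congr (_ + _); congr (_ + _).
  by rewrite !scalerA -scalerAl -scalerAr mul1r mulr1.
rewrite !(psiE _ _ Bb) base_mult map_cat /= siL IH -!(map_cat, map_cons).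
rewrite (_ : Omega phi _ b = c%:A *: Omega phi (s ++ x :: t) b + Omega phi (s ++ y :: t) b).
  rewrite !hL !map_cat /= !opprD !scalerDr !scalerN.
  by rewrite [RHS]addrACA; congr (_ + _); rewrite addrACA.
exact: (Omega_mult tau phiM b s t c x y).
Qed.

Lemma OmegaD phi s y z : Omega phi s (y + z) = Omega phi s y + Omega phi s z.
Proof. by have := Omega_comb tau phi s 1 y z; rewrite !scale1r. Qed.

Lemma Omega0 phi s : Omega phi s 0 = 0.
Proof. by apply: (@addrI _ (Omega phi s 0)); rewrite -OmegaD !addr0. Qed.

Lemma OmegaZ phi s a z : Omega phi s (a *: z) = a *: Omega phi s z.
Proof. by have := Omega_comb tau phi s a z 0; rewrite Omega0 !addr0. Qed.

(** tau anticommutes with d and with h, is compatible with the curvature by [Omega_par], and fixes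
    [one]; so the recursion preserves oddness. *)
Lemma psi_par phi : pmult phi -> (forall s z, phi (map si s) z = - tau (phi s (tau z))) ->
  forall s z, psi phi (map si s) z = - tau (psi phi s (tau z)).
Proof.
move=> phiM par s z; move: z s; apply: (res_ind homB basB) => [|a u v eu ev|b Bb IH] s.
- by rewrite !linear0 ?oppr0.
- by rewrite !linearP /= eu ev.
have [[n j] bn] := homB Bb.
have tb : tau b = (sign F n)%:A *: b by rewrite (tauE bn) sign_scale.
rewrite {1}tb 2!linearZ /= !(psiE _ _ Bb) 2!linearB /= !tau_h.
have -> : (sign F n)%:A *: (tau (base s b) - - h (tau (Omega phi s b))
      - - h (tau (psi phi (map si s) (d b))))
    = tau (base s (tau b)) + h (tau (Omega phi s (tau b)))
      + h (tau (psi phi (map si s) ((sign F n)%:A *: d b))).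
  rewrite !opprK !scalerDr -!hZ tb OmegaZ !linearZ /=; congr (_ + _ + _).
  case: (s) => [|w [|? ?]]; rewrite /= ?linear0 ?scaler0 //.
  rewrite -!linearZ /= scalerA; congr (tau (_ *: _)).
  have [_ wZ _] := functionalP w.
  by rewrite wZ -mulrN -scalerAl mul1r scalerA.
have -> : (sign F n)%:A *: d b = d (tau b) by rewrite tb linearZ.
rewrite -(Omega_par tauK phiM par) -[d (tau b)]opprK -tau_diff linearN /= linearN /= hN.
have := IH (map si s); rewrite mapK => [->|]; last exact: siK tauK.
rewrite !opprD opprK hN opprK; congr (_ - _ + _).
case: (s) => [|w [|? ?]]; rewrite /= ?linear0 ?oppr0 //.
rewrite -[X in (- X)%:A *: _ = _]/(si w b) siE linearZ /= tau_one.
by rewrite !scaleNr !opprK.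
Qed.

Record stage n (phi : seq E -> {linear P -> P}) : Prop := {
  st_nil : forall z, phi [::] z = d z;
  st_trunc : forall s z, (n < size s)%N -> phi s z = 0;
  st_mult : pmult phi;
  st_par : forall s z, phi (map si s) z = - tau (phi s (tau z));
  st_flat : forall s z, (size s <= n)%N -> Omega phi s z = 0;
  st_aug1 : (0 < n)%N -> forall w z, raug P (phi [:: w] z) = - w z;
  st_aug : forall s z, (1 < size s)%N -> raug P (phi s z) = 0 }.

Lemma stage0 : stage 0 (Phi 0).
Proof.
split=> //=.
- by case.
- move=> z [|a s] t c x y; rewrite /= ?scaler0 ?addr0 //.
- by case=> [|x s] z /=; [rewrite tau_diff opprK tauK|rewrite linear0 oppr0].
- by case=> //= z _; rewrite /Omega /= addr0 rdiffK.
by case=> // a s z _; exact: raug0.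
Qed.

Lemma Omega_ext (phi1 phi2 : seq E -> {linear P -> P}) n s z :
  (forall w, (size w <= n)%N -> phi1 w = phi2 w) -> (size s <= n)%N ->
  Omega phi1 s z = Omega phi2 s z.
Proof.
move=> e12 sn; congr (_ + _).
  apply: eq_spl => u v es; rewrite !e12 ?size_map //; apply: leq_trans sn.
    by rewrite es size_cat leq_addl.
  by rewrite es size_cat leq_addr.
apply: eq_ins_op => p [//|x m] q es _.
have lemn : (size p + (size m).+1 + size q <= n)%N.
  by apply: leq_trans sn; rewrite es !size_cat /= addnA.
by rewrite /= !e12 // ?size_cat ?size_map /=; lia.
Qed.

Section Step.
Variables (n : nat) (phi : seq E -> {linear P -> P}).
Hypothesis st : stage n phi.

Definition next (s : seq E) := if size s == n.+1 then psi phi s else phi s.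

Lemma next_le s : (size s <= n)%N -> next s = phi s.
Proof. by move=> sn; rewrite /next ltn_eqF. Qed.

Lemma bop_single (phi' : seq E -> {linear P -> P}) x :
  (forall z, phi' [::] z = d z) -> bop phi' [:: x] = 0.
Proof.
move=> p0; apply: functional_ext => z.
by rewrite bopE p0 tau_diff functionalN functional_diff oppr0.
Qed.

Lemma Omega_le s z : (size s <= n)%N -> Omega next s z = Omega phi s z.
Proof. by move=> sn; apply: (Omega_ext z _ sn) => w wn; exact: next_le. Qed.

Lemma next_mult : pmult next.
Proof.
move=> z s t c x y; rewrite /next !size_cat /=; case: ifP => _.
  exact: (psi_mult (st_mult st)).
exact: (st_mult st).
Qed.

(** Only the cuts at the two ends involve the new values. An insertion keeping the length n + 1
    would use b of one letter, which is zero. *)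
Lemma Omega_eq s z : size s = n.+1 ->
  Omega next s z = d (psi phi s z) + psi phi (map si s) (d z) + Omega phi s z.
Proof.
move=> sn; have nn : next [::] = phi [::] by exact: next_le.
rewrite /Omega addrA; congr (_ + _); last first.
  apply: eq_ins_op => p [//|x m] q es _; rewrite es !size_cat /= in sn.
  have [m0|m0] := posnP (size m).
    case: m m0 {es sn} => // _; rewrite !bop_single ?nn; try exact: (st_nil st).
    by rewrite (mult0 _ _ (next_mult z)) (mult0 _ _ (st_mult st z)).
  by rewrite /= !next_le // ?size_cat ?size_map /=; lia.
have -> : d (psi phi s z) = spl (fun u v => if u is [::] then d (psi phi v z) else 0) s.
  by rewrite spl_first.
have -> : psi phi (map si s) (d z)
    = spl (fun u v => if v is [::] then psi phi (map si u) (d z) else 0) s.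
  by rewrite spl_last.
rewrite -!splD; apply: eq_spl => u v es.
case: u es => [|x u] es /=; last first.
  case: v es => [|y v] es.
    rewrite cats0 in es; rewrite -[_ :: _]/(map si (x :: u)) -es nn !(st_nil st) /next.
    by rewrite size_map sn eqxx (st_trunc st) ?size_map ?sn // add0r addr0.
  rewrite !add0r !next_le //= ?size_map.
    by rewrite -ltnS -sn es size_cat /=; lia.
  by rewrite -ltnS -sn es size_cat /=; lia.
rewrite /= in es; rewrite -es; case: (s) sn => // x s' sn.
rewrite addr0 nn !(st_nil st) /next sn eqxx (st_trunc st) ?sn //.
by rewrite linear0 addr0.
Qed.

(** Only phi of a one-letter word has nonzero augmentation. For a word of two or more letters this
    leaves the cut after the first letter and the insertion of b of the whole word, whose
    augmentations are opposite by the definition of b. *)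
Lemma raug_Omega s b : size s = n.+1 -> raug P (Omega phi s b) = 0.
Proof.
pose K (z : P) := raug P z = 0; have K0 : K 0 by exact: raug0.
have KD x y : K x -> K y -> K (x + y) by rewrite /K raugD => -> ->; rewrite addr0.
case: s => // x [|y s] sn.
  rewrite -[Omega _ _ _]/(phi [::] (phi [:: x] b) + phi [:: si x] (phi [::] b)
    + (phi [:: bop phi [:: x]] b + 0)).
  rewrite (bop_single _ (st_nil st)) (mult0 [::] [::] (st_mult st b)) !addr0.
  have [n0|n0] := posnP n.
    rewrite (st_trunc st (s := [:: x])) ?n0 // (st_trunc st (s := [:: si x])) ?n0 //.
    by rewrite linear0 addr0.
  rewrite raugD (st_nil st) raug_diff add0r (st_aug1 st) // siE opprK.
  by rewrite (st_nil st) tau_diff functionalN functional_diff oppr0.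
have n0 : (0 < n)%N by case: (n) sn.
rewrite -[Omega _ _ _]/(phi [::] (phi [:: x, y & s] b)
   + (phi [:: si x] (phi (y :: s) b)
      + spl (fun u v => phi [:: si x, si y & map si u] (phi v b)) s)
   + (phi [:: bop phi [:: x], y & s] b + spl (fun u v => phi (bop phi [:: x, y & u] :: v) b) s
      + (spl (fun u v => phi [:: si x, bop phi (y :: u) & v] b) s
         + ins (bop phi) si (fun u => phi [:: si x, si y & u] b) s))).
have s1 : K (spl (fun u v => phi [:: si x, si y & map si u] (phi v b)) s).
  by apply: spl_closed => // u v _; rewrite /K (st_aug st).
have s2 : K (spl (fun u v => phi [:: si x, bop phi (y :: u) & v] b) s).
  by apply: spl_closed => // u v _; rewrite /K (st_aug st).
have s3 : K (ins (bop phi) si (fun u => phi [:: si x, si y & u] b) s).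
  by apply: ins_closed => // p m q _ _; rewrite /K (st_aug st).
rewrite !raugD s1 s2 s3 (st_nil st) raug_diff (st_aug st (s := [:: bop phi [:: x], y & s])) //.
rewrite !addr0 !add0r.
have -> : raug P (spl (fun u v => phi (bop phi [:: x, y & u] :: v) b) s)
    = raug P (phi [:: bop phi [:: x, y & s]] b).
  rewrite (spl_morph _ _ (@raugD _ _ P)) spl_last // => u z v _; exact: (st_aug st).
by rewrite !(st_aug1 st) // bopE siE opprK subrr.
Qed.

Lemma psi_aug1 w z : raug P (psi phi [:: w] z) = - w z.
Proof.
have /exists_functional[x xE] : to_trivial (fun z => raug P (psi phi [:: w] z)).
  exact: to_trivial_comp (raug_triv P).
rewrite -xE -fvalN; congr (functional_val _ z).
apply: (functional_eq hconn basB) => b Bb; rewrite xE (psiE _ _ Bb) fvalN.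
by rewrite !raugD !raugN !raug_h !subr0 /= raugZ aug1 mulr1.
Qed.

Lemma psi_aug s z : (1 < size s)%N -> raug P (psi phi s z) = 0.
Proof.
move=> s1; have /exists_functional[x xE] : to_trivial (fun z => raug P (psi phi s z)).
  exact: to_trivial_comp (raug_triv P).
rewrite -xE -[RHS](fval0 z); congr (functional_val _ z).
apply: (functional_eq hconn basB) => b Bb; rewrite xE (psiE _ _ Bb) fval0.
rewrite !raugD !raugN !raug_h !subr0.
by move: s1; rewrite /base; case: (s) => [|? [|? ?]] //= _; rewrite raug0.
Qed.

(** On a basis element b, [psi phi s b] is the base term minus h w, where w is the rest of the
    curvature at b. Flatness at d b together with [bianchi] gives d w = 0, and w has augmentation 0;
    hence d (h w) = w and the sum cancels. *)
Lemma next_flat s z : size s = n.+1 -> Omega next s z = 0.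
Proof.
move: z s; apply: (res_ind homB basB) => [|a u v eu ev|b Bb IH] s sn.
- exact: Omega0.
- by rewrite Omega_comb eu // ev // scaler0 addr0.
have d_base : d (base s b) = 0.
  by case: (s) => [|w [|? ?]]; rewrite /= ?linear0 // linearZ /= d_one scaler0.
set w := psi phi (map si s) (d b) + Omega phi s b.
have psiw : psi phi s b = base s b - h w.
  by rewrite (psiE _ _ Bb) /w (hD (psi _ _ _)) opprD addrA [RHS]addrAC.
have dw : d w = 0.
  have /= IHs := IH (map si s); rewrite size_map in IHs.
  have := IHs sn; rewrite Omega_eq ?size_map //.
  rewrite rdiffK linear0 addr0 linearD /= => <-; congr (_ + _).
  rewrite -(st_nil st) -(st_nil st b); apply: (bianchi tauK (st_mult st) (st_par st)) sn.
    exact: (st_flat st).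
  move=> x; apply: functional_ext => y; rewrite actE (st_nil st) functional_diff.
  by rewrite fval0.
have raugw : raug P w = 0.
  rewrite raugD raug_Omega // addr0; have [x xE] : exists x : E, forall z, x z =
    raug P (psi phi (map si s) z).
    by apply: exists_functional; exact: to_trivial_comp (raug_triv P).
  by rewrite -xE functional_diff.
rewrite Omega_eq // -addrA -/w psiw linearB d_base sub0r.
by have := dh w; rewrite dw h0 addr0 raugw scale0r scale0r subr0 => ->; rewrite addNr.
Qed.

Lemma stage_next : stage n.+1 next.
Proof.
split.
- by move=> z; rewrite next_le // (st_nil st).
- by move=> s z sn; rewrite /next gtn_eqF // (st_trunc st) // ltnW.
- exact: next_mult.
- move=> s z; rewrite /next size_map; case: ifP => _; last exact: (st_par st).
  exact: psi_par (st_mult st) (st_par st) _ _.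
- move=> s z; rewrite leq_eqVlt => /orP[/eqP sn|sn]; first exact: next_flat.
  by rewrite Omega_le // (st_flat st).
- move=> _ w z; rewrite /next /=; case: eqP => [_|n0]; first exact: psi_aug1.
  by apply: (st_aug1 st); case: (n) n0.
move=> s z s1; rewrite /next; case: ifP => _; first exact: psi_aug.
exact: (st_aug st).
Qed.

End Step.

Lemma Phi_stage n : stage n (Phi n).
Proof. by elim: n => [|n IH]; [exact: stage0|exact: stage_next IH]. Qed.

Definition phi (s : seq E) : {linear P -> P} := Phi (size s) s.

Lemma Phi_phi n s : (size s <= n)%N -> Phi n s = phi s.
Proof.
elim: n => [|n IH]; first by rewrite leqn0 /phi => /eqP ->.
rewrite leq_eqVlt => /orP[/eqP sn|sn]; first by rewrite /phi sn.
by rewrite /= ltn_eqF // IH.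
Qed.

Lemma tau_deg i z : rdeg P i z -> rdeg P i (tau z).
Proof.
case: i => n j zn; rewrite (tauE zn) -[j]add0r; apply: (rdegZ (k := 0)) => //.
by rewrite sign_scale; apply: gdegZ; exact: gdeg1.
Qed.

Lemma fdeg_si i x : fdeg i x -> fdeg i (si x).
Proof. by move=> xi k z ki kz; rewrite siE (xi k) ?oppr0 //; exact: tau_deg. Qed.

Lemma wordsi ds s : forall2 (@fdeg F A P) ds s -> forall2 (@fdeg F A P) ds (map si s).
Proof. by apply: forall2_map => i x; exact: fdeg_si. Qed.

Definition has_deg (phi : seq E -> {linear P -> P}) := forall ds s,
  forall2 (@fdeg F A P) ds s -> forall i z, rdeg P i z ->
  rdeg P (i - (wdeg ds + (1, 0))) (phi s z).

Lemma bop_deg phi ds s : has_deg phi -> s <> [::] -> forall2 (@fdeg F A P) ds s ->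
  fdeg (wdeg ds + (2, 0)) (bop phi s).
Proof.
case: s ds => // x s [//|d ds] hphi _ [dx dss] k z ki kz.
rewrite bopE (dx (k - (wdeg ds + (1, 0)))) //; last first.
  by apply: tau_deg; apply: hphi.
by apply: contra ki => /eqP <-; rewrite wdeg_cons; apply/eqP; bidegs.
Qed.

Lemma Omega_deg phi ds s : has_deg phi -> forall2 (@fdeg F A P) ds s ->
  forall i z, rdeg P i z -> rdeg P (i - (wdeg ds + (2, 0))) (Omega phi s z).
Proof.
move=> hphi dss i z iz; have gP := rdeg_grading P.
apply: (gradingD gP).
  apply: spl_closed => [x y|u v es]; first exact: (gradingD gP).
  rewrite es in dss; have [du [dv [-> hu hv]]] := forall2_split dss.
  have := hphi _ _ (wordsi hu) _ _ (hphi _ _ hv _ _ iz); rewrite wdeg_cat.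
  by congr (rdeg _ _ _); bidegs.
apply: ins_closed => [|x y|p m q es m0]; first exact: (grading0 gP).
  exact: (gradingD gP).
rewrite es in dss; have [dp [dr [-> hp /forall2_split[dm [dq [-> hm hq]]]]]] := forall2_split dss.
have := hphi _ _ (forall2_cat (wordsi hp) (_ : forall2 _ (_ :: dq) (_ :: q))) _ _ iz.
move=> /(_ (wdeg dm + (2, 0)) (bop phi m)) H.
have {H} := H (conj (bop_deg hphi m0 hm) hq); rewrite !wdeg_cat wdeg_cons.
congr (rdeg _ _ _).
by bidegs.
Qed.

Lemma h_deg' i z : rdeg P i z -> rdeg P (i + (1, 0)) (h z).
Proof. by case: i => n j /h_deg; rewrite -[(n, j) + _]/(n + 1, j + 0) addr0. Qed.

Lemma base_deg ds s i b : s <> [::] -> forall2 (@fdeg F A P) ds s -> rdeg P i b ->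
  rdeg P (i - (wdeg ds + (1, 0))) (base s b).
Proof.
have gP := rdeg_grading P.
case: s => [|w [|y s]] // _ dss ib; last exact: (grading0 gP).
case: ds dss => [|k [|? ?]] //= [] // wk _.
have [->|ne] := eqVneq i k; last by rewrite (wk _ _ ne ib) oppr0 !scale0r; exact: (grading0 gP).
rewrite wdeg_cons wdeg_nil.
have -> : k - (k - (1, 0) + 0 + (1, 0)) = (0, 0%:Z + 0).
  by bidegs.
by apply: rdegZ deg1; apply: gdegZ; exact: gdeg1.
Qed.

Lemma psi_deg phi ds s : pmult phi -> (forall s z, phi (map si s) z = - tau (phi s (tau z))) ->
  has_deg phi -> s <> [::] -> forall2 (@fdeg F A P) ds s ->
  forall i z, rdeg P i z -> rdeg P (i - (wdeg ds + (1, 0))) (psi phi s z).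
Proof.
move=> phiM par hphi s0 dss; have gP := rdeg_grading P.
apply: (res_deg_ind homB basB (f := psi phi s)) => [b i Bb ib IH].
have db : rdeg P (i - (1, 0)) (d b).
  by case: i ib {IH} => n j /rdiff_deg; rewrite -[(n, j) - _]/(n - 1, j - 0) subr0.
rewrite (psiE _ _ Bb); apply: (gradingB gP); first apply: (gradingB gP).
- exact: base_deg.
- have := h_deg' (Omega_deg hphi dss ib); congr (rdeg _ _ _).
  by bidegs.
have -> : i - (wdeg ds + (1, 0)) = i - (1, 0) - (wdeg ds + (1, 0)) + (1, 0).
  by bidegs.
apply: h_deg'; rewrite psi_par //; apply: (gradingN gP); apply: tau_deg.
rewrite (tauE (n := i.1 - 1) (j := i.2)); last by case: (i) db => n j /=; rewrite -[(n, j) - _]/(n - 1, j - 0) subr0.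
rewrite linearZ /= sign_scale.
move: IH; case: (_ - (wdeg ds + _)) => n j IH; rewrite -[j]add0r.
by apply: (rdegZ (k := 0)) => //; apply: gdegZ; exact: gdeg1.
Qed.

Lemma Phi_deg n : has_deg (Phi n).
Proof.
have gP := rdeg_grading P.
elim: n => [|n IH] ds s dss i z iz.
  case: s dss => [|x s] dss; last by exact: (grading0 gP).
  case: ds dss => // _; rewrite wdeg_nil add0r /=.
  by case: i iz => a j /rdiff_deg; rewrite -[(a, j) - _]/(a - 1, j - 0) subr0.
rewrite /=; case: ifP => [/eqP sn|_]; last exact: IH.
apply: psi_deg => //; [exact: st_mult (Phi_stage n)|exact: st_par (Phi_stage n)|].
by case: (s) sn.
Qed.

Lemma phi_mult : pmult phi.
Proof.
move=> z s t c x y; rewrite /phi !size_cat /=.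
exact: (st_mult (Phi_stage _) z).
Qed.

Lemma phi_par s z : phi (map si s) z = - tau (phi s (tau z)).
Proof. rewrite /phi size_map; exact: (st_par (Phi_stage _)). Qed.

Lemma phi_Omega s z : Omega phi s z = 0.
Proof.
rewrite -(st_flat (Phi_stage (size s)) z (leqnn _)).
by apply: (Omega_ext z _ (leqnn _)) => w ws; rewrite Phi_phi.
Qed.

Lemma phi_aug1 w z : raug P (phi [:: w] z) = - w z.
Proof. exact: (st_aug1 (Phi_stage 1)). Qed.

Lemma phi_aug s z : (1 < size s)%N -> raug P (phi s z) = 0.
Proof. exact: (st_aug (Phi_stage _)). Qed.

Lemma phi_deg : has_deg phi.
Proof. move=> ds s; exact: (Phi_deg (size s)). Qed.

Lemma phi_rec n s b : size s = n.+1 -> B b ->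
  phi s b = base s b - h (Omega (Phi n) s b) - h (phi (map si s) (d b)).
Proof. by move=> sn Bb; rewrite /phi size_map sn /= size_map sn eqxx psiE. Qed.

(** The value lies in P_0, so both corrections are h applied to elements of homological degree -1,
    that is, to 0. *)
Lemma phi_bottom ds s i b : s <> [::] -> forall2 (@fdeg F A P) ds s -> B b ->
  rdeg P i b -> i.1 = (wdeg ds).1 + 1 -> phi s b = base s b.
Proof.
move=> s0 dss Bb ib i1; have [n sn] : exists n, size s = n.+1.
  by case: (s) s0 => // x w _; exists (size w).
have neg (k : int * int) x : k.1 = -1 -> rdeg P k x -> x = 0.
  by case: k => k1 k2 /= ->; exact: rdeg_ge0.
rewrite (phi_rec sn Bb).
rewrite (neg _ _ _ (Omega_deg (Phi_deg n) dss ib)); last by rewrite /= i1; lia.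
rewrite (neg _ _ _ (phi_deg (wordsi dss) (i := (i.1 - 1, i.2)) _)).
- by rewrite h0 !subr0.
- by rewrite /= i1; lia.
by case: (i) ib => a j; exact: rdiff_deg.
Qed.

(** * Strict unitality of phi *)

Section Unit.
Variable e : E.
Hypothesis eE : forall z, e z = raug P z.

Lemma si_unit : si e = - e.
Proof. by apply: functional_ext => z; rewrite siE fvalN !eE raug_tau. Qed.

(** Here h b = 0 is essential: the homotopy formula becomes h (d b) = b - raug(b) one, so the
    recursion returns exactly -b. *)
Lemma phi_unit1 z : phi [:: e] z = - z.
Proof.
move: z; apply: (res_ind homB basB) => [|a u v eu ev|b Bb IH].
- by rewrite linear0 oppr0.
- by rewrite linearP /= eu ev opprD scalerN.
have O0 : Omega (Phi 0) [:: e] b = 0.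
  rewrite -[Omega _ _ _]/(d 0 + 0 + (Phi 0 [:: bop (Phi 0) [:: e]] b + 0)).
  by rewrite linear0 !addr0.
rewrite (@phi_rec 0) // O0 h0 subr0 /= si_unit (multN [::] [::] _ (phi_mult _)) /= IH.
rewrite opprK eE scaleNr scaleNr; have := dh b; rewrite (hB Bb) linear0 add0r => ->.
by rewrite opprB addKr.
Qed.

Lemma bop_unit1 (phi' : seq E -> {linear P -> P}) x :
  (forall z, phi' [:: e] z = - z) -> bop phi' [:: x; e] = si x.
Proof.
move=> pe; apply: functional_ext => z.
by rewrite bopE pe linearN functionalN siE.
Qed.

(** It suffices that the curvature of such a word vanishes. If e stands at an end, the term left by
    [ins_unit] cancels against the cut that splits off e, because phi(e) = -1; if e is interior,
    nothing is left on either side. *)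
Lemma Phi_unit n u v z : u ++ v <> [::] -> Phi n (u ++ e :: v) z = 0.
Proof.
elim: n u v z => [|n IH] u v z uv; first by case: u {uv}.
rewrite /=; case: ifP => [/eqP sn|_]; last exact: IH.
have st := Phi_stage n.
have n0 : (0 < n)%N.
  by rewrite -ltnS -sn size_cat /= addnS -size_cat !ltnS; case: (u ++ v) uv.
have Pe y : Phi n [:: e] y = - y by rewrite Phi_phi // phi_unit1.
have Psie y : Phi n [:: si e] y = y.
  by rewrite si_unit (multN [::] [::] _ (st_mult st y)) /= Pe opprK.
have Psi p q y : p ++ q <> [::] -> Phi n (map si (p ++ e :: q)) y = 0.
  move=> pq; rewrite map_cat /= si_unit (multN _ _ _ (st_mult st y)) IH ?oppr0 //.
  by case: p pq => // /eqP; case: q.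
have O0 s1 s2 y : s1 ++ s2 <> [::] -> size (s1 ++ e :: s2) = n.+1 ->
    Omega (Phi n) (s1 ++ e :: s2) y = 0.
  move=> s12 s12n.
  have insE : ins (bop (Phi n)) si (fun w => Phi n w y) (s1 ++ e :: s2)
      = (if s1 is [::] then 0 else Phi n (map si s1 ++ s2) y)
        - (if s2 is [::] then 0 else Phi n (map si s1 ++ s2) y).
    apply: (ins_unit si_unit) => [x|p q pq|x|x|p q x|p q|p q].
    - exact: bop_single (st_nil st).
    - case: p pq => [|x p] pq; apply: functional_ext => w; rewrite fval0 bopE.
        by rewrite eE raug_tau (st_aug st).
      by rewrite IH ?linear0 ?functional0 //; case: p pq => //; case: q.
    - apply: functional_ext => w; rewrite bopE eE raug_tau (st_aug1 st) //.
    - exact: bop_unit1.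
    - exact: (multN p q x (st_mult st y)).
    - exact: (mult0 p q (st_mult st y)).
    exact: IH.
  rewrite /Omega insE; case: s1 s12 s12n {insE} => [|x s1] s12 s12n.
    case: s2 s12 s12n => // x s2 _ s12n.
    rewrite /= (st_nil st) (IH [::]) // linear0 add0r Psie spl0.
      by rewrite addr0 add0r subrr.
    by move=> p q _; rewrite (Psi [::] (x :: p)).
  case: s2 s12 s12n => [|y' s2] s12 s12n.
    rewrite cats1 spl_rcons subr0 cats0 (st_nil st) map_rcons -!cats1.
    rewrite -[_ ++ _](map_cat si (x :: s1) [:: e]) (Psi (x :: s1)) // addr0.
    rewrite spl_last; first by rewrite Pe linearN /= addNr.
    by move=> p w q _; rewrite -cats1 IH ?linear0 //.
  rewrite subrr addr0 spl0 // => p q es.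
  have [[l [-> _]]|[l [_ ->]]] := @cat_eq_cat_cons _ e p q (x :: s1) (y' :: s2) (esym es).
    by rewrite Psi.
  by rewrite IH ?linear0 //; case: l.
move: z u v uv sn; apply: (res_ind homB basB) => [|a p q ep eq|b Bb IHb] u v uv sn.
- by rewrite linear0.
- by rewrite linearP /= ep // eq // scaler0 addr0.
rewrite (psiE _ _ Bb) O0 // h0 subr0 map_cat /= si_unit.
rewrite (multN _ _ _ (psi_mult (st_mult st) _)) IHb.
- rewrite oppr0 h0 subr0; case: u uv {sn} => [|? [|? ?]] //=; by case: v.
- by case: u uv {sn} => //; case: v.
by rewrite size_cat /= !size_map; rewrite size_cat in sn.
Qed.

Lemma phi_unit u v z : u ++ v <> [::] -> phi (u ++ e :: v) z = 0.
Proof. exact: Phi_unit. Qed.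

End Unit.

End Construction.

Section MinimalResolution.
Variables (F : fieldType) (A : gradedAlg F) (P : free_resolution A) (B : set P) (one : P).
Hypothesis hconn : connected A.
Hypothesis hmin : minimal P.
Hypothesis homB : forall b, B b -> exists i, rdeg P i b.
Hypothesis basB : is_basis B.
Hypothesis B1 : B one.
Hypothesis deg1 : rdeg P (0, 0) one.
Hypothesis aug1 : raug P one = 1.
Local Notation E := (functional P).

Lemma dual_functional b0 : exists x : E, forall b, B b -> x b = (b == b0)%:R.
Proof.
have [f fE] := basis_lift basB (fun b => if b == b0 then one else 0).
have /exists_functional[x xE] : to_trivial (fun z => raug P (f z)).
  exact: to_trivial_comp (raug_triv P).
exists x => b Bb; rewrite xE fE //; case: eqP => _; [exact: aug1|by rewrite raug0].
Qed.

Lemma dual_functional_deg b0 i (x : E) : rdeg P i b0 ->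
  (forall b, B b -> x b = (b == b0)%:R) -> fdeg i x.
Proof.
move=> ib xE [n j] z ne; move: z; apply: (rdeg_ind homB basB).
- exact: functional0.
- by move=> y z; rewrite functionalD => -> ->; rewrite addr0.
move=> k j' a b Bb bn ka kj.
have [e|k0] := posnP k; last by have [_ _ x0] := functionalP x; exact: (x0 k).
apply: functional_scale => //; rewrite xE //; case: eqP => // bb0.
rewrite bb0 e add0r in bn kj *; rewrite kj in bn.
have := xE _ Bb; rewrite bb0 (grading_neq (rdeg_grading P) bn ib ne) functional0.
by rewrite -(grading_neq (rdeg_grading P) bn ib ne) eqxx.
Qed.

(** The functional dual to a basis element kills boundaries by minimality, so it reads off the
    coefficient. This permits [contraction] with S equal to the whole basis. *)
Lemma basis_indep_mod : indep_mod (V := restr P) (range (rdiff P)) B.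
Proof.
move=> s c us sB [y _ ye] b bs; have [x xE] := dual_functional b.
have := functional_diff hmin x y; rewrite ye.
rewrite (big_morph _ (functionalD x) (functional0 x)) (bigD1_seq b) //= big1_seq ?addr0.
  have [_ xZ _] := functionalP x.
  by rewrite xZ xE ?eqxx ?mulr1 //; exact: sB.
move=> b' /andP[b'b b's]; have [_ xZ _] := functionalP x.
by rewrite xZ xE ?(negPf b'b) ?mulr0 //; exact: sB.
Qed.

(** The interface for all that follows; the homotopy h no longer appears in it. *)
Record twisting (tau : {linear P -> P}) (phi : seq E -> {linear P -> P}) : Prop := {
  tw_tau : forall n j x, rdeg P (n, j) x -> tau x = sign A n *: x;
  tw_mult : pmult phi;
  tw_par : forall s z, phi (map (si tau) s) z = - tau (phi s (tau z));
  tw_nil : forall z, phi [::] z = rdiff P z;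
  tw_flat : forall s z, Omega tau phi s z = 0;
  tw_aug1 : forall w z, raug P (phi [:: w] z) = - w z;
  tw_aug : forall s z, (1 < size s)%N -> raug P (phi s z) = 0;
  tw_deg : has_deg phi;
  tw_bottom : forall ds s i b, s <> [::] -> forall2 (@fdeg F A P) ds s -> B b ->
    rdeg P i b -> i.1 = (wdeg ds).1 + 1 -> phi s b = base one s b;
  tw_unit1 : forall e : E, (forall z, e z = raug P z) -> forall z, phi [:: e] z = - z;
  tw_unit : forall e : E, (forall z, e z = raug P z) ->
    forall u v z, u ++ v <> [::] -> phi (u ++ e :: v) z = 0 }.

Theorem exists_twisting : exists tau phi, twisting tau phi.
Proof.
have [tau tauE] := parity_ex homB basB.
have [h [hL h_deg dh raug_h hB]] := contraction homB basis_indep_mod B1 deg1 aug1.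
exists tau, (phi homB basB tau h one); split=> //.
- exact: phi_mult.
- exact: phi_par.
- exact: phi_Omega.
- exact: phi_aug1.
- exact: phi_aug.
- exact: phi_deg.
- exact: phi_bottom.
- exact: phi_unit1.
- exact: phi_unit.
Qed.

End MinimalResolution.

(** * The structure on E(A) *)

Section Cochains.
Local Open Scope quotient_scope.
Variables (F : fieldType) (A : gradedAlg F) (P : free_resolution A).
Hypothesis hmin : minimal P.
Local Notation E := (functional P).
Local Notation pi z := (\pi_(quotmod (coboundary_closed P)) z).

(* For a minimal resolution the differential of Hom_A(P, F) vanishes, so that E(A)
   is the space of cochains. *)
Lemma ext_functional : exists rho : Ext P -> E,
  [/\ forall c x y, rho (c *: x + y) = c *: rho x + rho y,
      injective rho,
      forall x, represents (rho x) x,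
      forall i x, bideg i x <-> fdeg i (rho x) &
      forall w : E, cochain w -> exists x, rho x = w].
Proof.
have cob0 (z : cocycles P) : coboundary z -> z = 0.
  case/asboolP=> psi [[psiT _] zd]; apply/val_inj/funext => u; rewrite zd /=.
  have [w wE] := exists_functional psiT.
  by rewrite -wE functional_diff.
have pi_inj (z t : cocycles P) : pi z = pi t -> z = t.
  move/eqP; rewrite quotmodE => /cob0 e; apply/eqP; rewrite -subr_eq0; exact/eqP.
have ex (x : ext_space P) : exists w : E, exists2 z : cocycles P, x = pi z & val z = w.
  have [z ->] := quotmodP x; have /asboolP[[zT _] _] := valP z.
  have [w wE] := exists_functional zT; exists w, z => //.
  by apply/funext => u; rewrite wE.
have [rho rhoP] := choice ex.
have rhoE (x : ext_space P) (z : cocycles P) (w : E) : x = pi z -> val z = w -> rho x = w.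
  move=> xz zw; have [t xt tw] := rhoP x.
  by apply: functional_ext => u; rewrite -tw -zw (pi_inj t z) // -xt.
exists rho; split.
- move=> c x y; have [z xz zx] := rhoP x; have [t yt ty] := rhoP y.
  apply: (rhoE _ (c *: z + t)); first by rewrite quotmodD quotmodZ -xz -yt.
  by rewrite linearP /= zx ty.
- move=> x y e; have [z xz zx] := rhoP x; have [t yt ty] := rhoP y.
  by rewrite xz yt; congr (pi _); apply: val_inj; rewrite zx e ty.
- by move=> x; have [z xz zx] := rhoP x; exists z.
- move=> i x; split=> [[phi [_ phi0] [z zphi xz]]|xi].
    have wE := rhoE x z; have [t xt tw] := rhoP x.
    move=> k u ki ku; rewrite -tw (pi_inj t z) -?xt //= zphi; exact: (phi0 _ _ ki ku).
  have [z xz zx] := rhoP x; exists (rho x); last by exists z.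
  split; first exact: functionalP.
  by move=> k u; exact: xi.
move=> w wC; have wz : (w : P -> F^o) \in cocycle (P := P).
  apply/asboolP; split => //; apply/funext => u /=.
  exact: functional_diff.
by exists (pi (Cocycle wz)); apply: (rhoE _ (Cocycle wz)).
Qed.

Lemma fdeg_cochain i (w : E) : fdeg i w -> cochain w.
Proof.
move=> wi; split; first exact: functionalP.
by exists [:: i] => k z; rewrite inE; exact: wi.
Qed.

Lemma cochain_comb (c : F) (x y : E) : cochain x -> cochain y -> cochain (c *: x + y).
Proof.
move=> [_ [s xs]] [_ [t yt]]; split; first exact: functionalP.
exists (s ++ t) => i z; rewrite mem_cat negb_or => /andP[si ti] iz.
by rewrite -[LHS]/(c * x z + y z) (xs i) // (yt i) // mulr0 addr0.
Qed.

End Cochains.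

Section Pieces.
Variables (F : fieldType) (E : bigraded F) (W : lmodType F) (g : seq E -> W) (K : W -> Prop).
Hypothesis gM : mult g.
Hypothesis K0 : K 0.
Hypothesis KD : forall x y, K x -> K y -> K (x + y).

Lemma mult_pieces (Ds : seq (int * int -> Prop)) s :
  forall2 (fun D => @in_degrees F E D) Ds s ->
  (forall ds t, homog ds t -> forall2 (fun (D : int * int -> Prop) i => D i) Ds ds -> K (g t)) ->
  K (g s).
Proof.
move=> sD gK.
(* p is the initial part of the word, whose letters are already homogeneous; the induction expands
   the next letter. *)
have gen Ds' (p : seq E) dp : homog dp p ->
    forall2 (fun D => @in_degrees F E D) Ds' s ->
    (forall ds t, homog ds t -> forall2 (fun (D : int * int -> Prop) i => D i) Ds' ds ->
       K (g (p ++ t))) -> K (g (p ++ s)).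
  elim: s Ds' p dp {sD gK} => [|x s IH] [|D Ds'] p dp //= hp.
    by move=> _ /(_ [::] [::]); apply.
  move=> [[l [f [lD fdeg ->]]] sD] gK.
  elim: l lD => [|i l IHl] lD; first by rewrite big_nil (mult0 _ _ gM).
  rewrite big_cons (multD _ _ _ _ gM); apply: KD; last first.
    by apply: IHl => k kl; apply: lD; rewrite inE kl orbT.
  rewrite -cat_rcons; apply: (IH Ds' _ (rcons dp i)) => //.
    by rewrite -!cats1; apply: forall2_cat.
  move=> ds t ht dst; rewrite cat_rcons; apply: (gK (i :: ds)) => //=.
  by split=> //; apply: lD; rewrite mem_head.
exact: (gen Ds [::] [::]).
Qed.

Lemma mult_homog s : (forall ds t, homog ds t -> K (g t)) -> K (g s).
Proof.
move=> gK; apply: (@mult_pieces (nseq (size s) (fun _ => True))); last by move=> ds t /gK.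
elim: s => //= x s IH; split=> //.
have [l [f [_ fdeg ->]]] := grading_sum (bideg_grading E) x.
by exists l, f.
Qed.

End Pieces.

Lemma ins_takedrop (X : Type) (b : seq X -> X) (si : X -> X) (W : zmodType)
    (g : seq X -> W) s :
  ins b si g s = \sum_(0 <= i < size s) \sum_(1 <= t < (size s - i).+1)
    g (map si (take i s) ++ b (take t (drop i s)) :: drop (i + t) s).
Proof.
elim: s g => [|x s IH] g; first by rewrite big_nil.
rewrite /= big_nat_recl // IH subn0; congr (_ + _).
by rewrite spl_takedrop big_add1.
Qed.

Section Signs.
Variable R : nzRingType.

Lemma signD (a b : int) : sign R (a + b) = sign R a * sign R b.
Proof.
rewrite !signE -signr_addb; congr (_ ^+ _); congr nat_of_bool.
by case: (boolP (odd _)); case: (boolP (odd (absz a))); case: (boolP (odd (absz b))) => //=; lia.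
Qed.

Lemma sign_sqr (k : int) : sign R k * sign R k = 1.
Proof. by rewrite signE -expr2 sqrr_sign. Qed.

Lemma sign_eq (a b k : int) : a = b + k *+ 2 -> sign R a = sign R b.
Proof. by move=> ->; rewrite mulr2n addrA !signD -mulrA sign_sqr mulr1. Qed.

End Signs.

(** * Signs between E and its suspension *)

Section Suspension.
Variables (F : fieldType) (A : gradedAlg F) (P : free_resolution A) (tau : {linear P -> P}).
Hypothesis tauE : forall n j x, rdeg P (n, j) x -> tau x = sign A n *: x.
Local Notation E := (functional P).
Local Notation sg := (sg tau).
Local Notation si := (si tau).
Local Notation homw := (forall2 (@fdeg F A P)).

Lemma sg_homog i (x : E) : fdeg i x -> sg x = sign F i.1 *: x.
Proof.
move=> xi; apply: functional_ext => z; rewrite sgE fvalZ.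
have [_ xZ _] := functionalP x.
move: z; apply: (grading_ind (K := fun z => x (tau z) = sign F i.1 * x z) (rdeg_grading P)).
- by rewrite linear0 functional0 mulr0.
- by move=> y z ey ez; rewrite linearD !functionalD ey ez mulrDr.
move=> [n j] z zn; rewrite (tauE zn) sign_scale xZ.
have [<- //|ne] := eqVneq (n, j) i.
by rewrite (xi _ _ ne zn) !mulr0.
Qed.

Lemma si_homog i (x : E) : fdeg i x -> si x = sign F (i.1 + 1) *: x.
Proof.
by move=> xi; rewrite -[si x]/(- sg x) (sg_homog xi) signD [sign F 1]expr1 mulrN1 scaleNr.
Qed.

Lemma map_si_homog (W : lmodType F) (g : seq E -> W) ds s q : mult g -> homw ds s ->
  g (map si s ++ q) = sign F (\sum_(d <- ds) d.1 + (size ds)%:Z) *: g (s ++ q).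
Proof.
elim: s g ds => [|x s IH] g [|d ds] gM //=; first by rewrite big_nil add0r scale1r.
move=> [dx dss]; rewrite (si_homog dx) (multZ [::] _ _ _ gM) /=.
rewrite (IH (fun u => g (x :: u)) ds) //; last exact: mult_cons.
rewrite scalerA -signD; congr (sign F _ *: _).
by rewrite big_cons -addn1 PoszD; ring.
Qed.

(* twist is the sign twist relating the operations on E and on its suspension: on
   inputs of degrees p_1, ..., p_n it is (-1)^(sum of the (n - l) p_l). *)
Fixpoint twist (s : seq E) : seq E :=
  if s is x :: s' then iter (size s') sg x :: twist s' else [::].

Fixpoint twexp (ds : seq (int * int)) : int :=
  if ds is d :: ds' then d.1 * (size ds')%:Z + twexp ds' else 0.

Lemma size_twist s : size (twist s) = size s.
Proof. by elim: s => //= x s ->. Qed.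

Lemma iter_sgL k c (x y : E) : iter k sg (c *: x + y) = c *: iter k sg x + iter k sg y.
Proof. by elim: k => //= k ->; rewrite sgL. Qed.

Lemma twist_mult (W : lmodType F) (g : seq E -> W) : mult g -> mult (fun s => g (twist s)).
Proof.
move=> gM s; elim: s g gM => [|a s IH] g gM t c x y /=.
  by rewrite iter_sgL (gM [::]).
rewrite !size_cat /=.
by apply: (IH (fun u => g (_ :: u))); exact: mult_cons.
Qed.

Lemma twist_homog (W : lmodType F) (g : seq E -> W) ds s : mult g -> homw ds s ->
  g (twist s) = sign F (twexp ds) *: g s.
Proof.
elim: s g ds => [|x s IH] g [|d ds] gM //=; first by rewrite scale1r.
move=> [dx dss]; rewrite (IH (fun u => g (_ :: u)) ds) //; last exact: mult_cons.
have -> : iter (size s) sg x = sign F (d.1 * (size ds)%:Z) *: x.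
  rewrite (forall2_size dss); elim: (size s) => [|k IHk]; first by rewrite mulr0 scale1r.
  rewrite iterS IHk; have := sgL tau (sign F (d.1 * k%:Z)) x 0.
  rewrite !addr0 => ->; rewrite [X in _ + X](_ : _ = 0); last first.
    by apply: functional_ext => z; rewrite sgE.
  rewrite addr0 (sg_homog dx) scalerA -signD; congr (sign F _ *: _).
  by rewrite -addn1 PoszD; ring.
rewrite (multZ [::] _ _ _ gM) /= scalerA -signD; congr (sign F _ *: _).
exact: addrC.
Qed.

Lemma twexp_cat ds es : twexp (ds ++ es) =
  twexp ds + (\sum_(d <- ds) d.1) * (size es)%:Z + twexp es.
Proof.
elim: ds => [|d ds IH] /=; first by rewrite big_nil; ring.
by rewrite IH size_cat PoszD big_cons; ring.
Qed.

Lemma wdeg1 ds : (wdeg ds).1 = \sum_(d <- ds) d.1 - (size ds)%:Z.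
Proof.
elim: ds => [|d ds IH]; first by rewrite wdeg_nil big_nil.
by rewrite wdeg_cons big_cons fstD fstD IH /= -addn1 PoszD; ring.
Qed.

(** The sign conventions of the Stasheff sums are matched here once for two uses: with u the
    operation m it yields the Stasheff identities, with u the morphism to End(P) the left side of
    the morphism identities. *)
Lemma insertion_twist (E0 : bigraded F) (rho : E0 -> E) (W : lmodType F)
    (u : seq E0 -> W) (g : seq E -> W) (b : seq E -> E) (m : seq E0 -> E0) ds s :
  mult g -> (forall i x, bideg i x <-> fdeg i (rho x)) ->
  (forall ds s, s <> [::] -> homw ds s -> fdeg (wdeg ds + (2, 0)) (b s)) ->
  (forall ds s, homog ds s -> u s = - (sign F (twexp ds) *: g (map rho s))) ->
  (forall ds s, homog ds s -> rho (m s) = - (sign F (twexp ds) *: b (map rho s))) ->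
  homog ds s ->
  \sum_(0 <= i < size s) \sum_(1 <= t < (size s - i).+1) insertion *:%R u m ds s i t
    = sign F (twexp ds) *: ins b si g (map rho s).
Proof.
move=> gM rhoE bdeg uE mE hs; rewrite ins_takedrop size_map scaler_sumr.
apply: eq_big_nat => i /andP[_ i_s]; rewrite scaler_sumr; apply: eq_big_nat => t /andP[t0 t_s].
set p := take i s; set mid := take t (drop i s); set q := drop (i + t) s.
have es : s = p ++ mid ++ q.
  by rewrite /p /mid /q addnC -drop_drop cat_take_drop cat_take_drop.
have sp : size p = i by rewrite size_takel // ltnW.
have sm : size mid = t by rewrite size_takel // size_drop.
have hs' := hs; rewrite {1}es in hs'.
have [dp [dr [eds hp /forall2_split[dm [dq [edr hm hq]]]]]] := forall2_split hs'.
have sdp : size dp = i by rewrite (forall2_size hp).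
have sdm : size dm = t by rewrite (forall2_size hm).
have dpE : take i ds = dp by rewrite eds take_size_cat.
have rw d0 s0 : homog d0 s0 -> homw d0 (map rho s0).
  by apply: forall2_map => k x; case: (rhoE k x).
have mid0 : map rho mid <> [::] by move/(congr1 size); rewrite size_map sm /=; lia.
have bd : fdeg (wdeg dm + (2, 0)) (b (map rho mid)) by apply: bdeg => //; exact: rw.
have md : bideg (wdeg dm + (2, 0)) (m mid).
  apply/rhoE; rewrite (mE _ _ hm) => k z ne kz.
  by rewrite fvalN fvalZ (bd k) // mulr0 oppr0.
rewrite /insertion dpE -/p -/mid -/q (uE (dp ++ (wdeg dm + (2, 0)) :: dq)); last first.
  by apply: forall2_cat.
have pmE : take i (map rho s) = map rho p by rewrite -map_take.
have mmE : take t (drop i (map rho s)) = map rho mid by rewrite -map_drop -map_take.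
have qmE : drop (i + t) (map rho s) = map rho q by rewrite -map_drop.
rewrite pmE mmE qmE (map_si_homog _ gM (rw _ _ hp)).
rewrite map_cat /= (mE _ _ hm) (multN _ _ _ gM) (multZ _ _ _ _ gM) !scalerN opprK !scalerA.
rewrite -!signD; congr (_ *: _).
have sj : (size s - i - t)%N = size dq.
  by rewrite (forall2_size hq) /q size_drop; lia.
rewrite sj [LHS](_ : _ = sign F ((i + size dq * t)%N%:Z
   + (2 - t%:Z) * \sum_(d <- dp) d.1 + (twexp (dp ++ (wdeg dm + (2, 0)) :: dq) + twexp dm))).
  (* The witness is half the difference of the two exponents. *)
  rewrite eds edr; apply: (@sign_eq F _ _ ((\sum_(d <- dp) d.1) * (1 - t%:Z) + (size dq)%:Z)).
  rewrite !twexp_cat /= ?fstD wdeg1 sdm sdp /= size_cat -addn1 !PoszD PoszM sdm.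
  by rewrite mulr2n; ring.
by rewrite !signD !mulrA.
Qed.

End Suspension.

(** * The operations on E(A) and the morphism to End(P) *)

Section Structure.
Variables (F : fieldType) (A : gradedAlg F) (P : free_resolution A) (B : set P) (one : P).
Hypothesis hmin : minimal P.
Local Notation E := (functional P).
Local Notation homw := (forall2 (@fdeg F A P)).

Variables (tau : {linear P -> P}) (phi : seq E -> {linear P -> P}).
Hypothesis tw : twisting B one tau phi.
Local Notation b := (bop tau phi).
Local Notation si := (si tau).

Variable rho : Ext P -> E.
Hypothesis rhoL : forall c x y, rho (c *: x + y) = c *: rho x + rho y.
Hypothesis rhoI : injective rho.
Hypothesis rhoR : forall x, represents (rho x) x.
Hypothesis rhoD : forall i x, bideg i x <-> fdeg i (rho x).
Hypothesis rhoS : forall w : E, cochain w -> exists x, rho x = w.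

Let tauE := tw_tau tw.
Let tauK := tauK tauE.
Let phiM := tw_mult tw.
Let bM : mult b := bop_mult tau phiM.

Lemma rho_mult (W : lmodType F) (g : seq E -> W) : mult g -> mult (fun s => g (map rho s)).
Proof. by move=> gM s t c x y; rewrite !map_cat /= rhoL gM. Qed.

Lemma rho_homog ds s : homog ds s -> homw ds (map rho s).
Proof. by apply: forall2_map => i x /rhoD. Qed.

Lemma b_deg ds s : s <> [::] -> homw ds s -> fdeg (wdeg ds + (2, 0)) (b s).
Proof. exact: (bop_deg tauE (tw_deg tw)). Qed.

Lemma b_single x : b [:: x] = 0.
Proof. exact: (bop_single hmin tauE x (tw_nil tw)). Qed.

(** The outer minus compensates b(e, x) = -x, so that e becomes a unit for m_2. *)
Definition mbar (s : seq (Ext P)) : E := - b (twist tau (map rho s)).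

Lemma mbar_mult : mult mbar.
Proof.
move=> s t c x y; have := rho_mult (twist_mult tau bM) s t c x y.
by rewrite /mbar /= => ->; rewrite opprD scalerN.
Qed.

Lemma mbar_homog ds s : homog ds s ->
  mbar s = - (sign F (twexp ds) *: b (map rho s)).
Proof. by move=> hs; rewrite /mbar (twist_homog tauE bM (rho_homog hs)). Qed.

Lemma wdegE ds : wdeg ds = \sum_(d <- ds) d - ((size ds)%:Z, 0).
Proof.
elim: ds => [|d ds IH]; first by rewrite wdeg_nil big_nil.
by rewrite wdeg_cons big_cons IH; bidegs.
Qed.

Lemma mbar_deg ds s : s <> [::] -> homog ds s -> fdeg (wdeg ds + (2, 0)) (mbar s).
Proof.
move=> s0 hs; rewrite (mbar_homog hs) => k z ne kz.
rewrite fvalN fvalZ (b_deg _ (rho_homog hs) ne kz) ?mulr0 ?oppr0 //.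
by case: (s) s0.
Qed.

Lemma cochain0 : cochain (0 : E).
Proof. by split; [exact: functionalP|exists [::]]. Qed.

(** The range of rho consists of the finitely supported functionals. Classes are finite sums of
    homogeneous ones, on which the value has a single degree. *)
Lemma mbar_cochain s : cochain (mbar s).
Proof.
apply: (mult_homog (K := fun w : E => cochain w) mbar_mult cochain0).
  by move=> x y xC yC; rewrite -[x]scale1r; exact: cochain_comb.
move=> ds t ht; case: t ht => [|x t] ht.
  by rewrite /mbar /= oppr0; exact: cochain0.
by apply: fdeg_cochain; exact: (mbar_deg _ ht).
Qed.

Lemma operations : exists m : seq (Ext P) -> Ext P, forall s, rho (m s) = mbar s.
Proof.
by have [m mE] := choice (fun s => rhoS (mbar_cochain s)); exists m.
Qed.

Variable m : seq (Ext P) -> Ext P.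
Hypothesis mE : forall s, rho (m s) = mbar s.

Lemma m_homog ds s : homog ds s -> rho (m s) = - (sign F (twexp ds) *: b (map rho s)).
Proof. by rewrite mE; exact: mbar_homog. Qed.

Lemma rho0 : rho 0 = 0.
Proof.
by apply: (@addrI _ (rho 0)); have := rhoL 1 0 0; rewrite !scale1r !addr0.
Qed.

Lemma rhoDD x y : rho (x + y) = rho x + rho y.
Proof. by have := rhoL 1 x y; rewrite !scale1r. Qed.

Lemma stasheff_b s : ins b si b s = 0.
Proof.
case: s => // x s; apply: (stasheff_bop tauK (tw_par tw)) => z.
exact: (tw_flat tw).
Qed.

Lemma m_unit : exists e : Ext P,
  [/\ bideg (0, 0) e, forall x, m [:: e; x] = x, forall x, m [:: x; e] = x &
      forall s, size s != 2%N -> e \in s -> m s = 0].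
Proof.
have [eps epsE] := exists_functional (raug_triv P).
have eps0 : fdeg (0, 0) eps by move=> k z; rewrite epsE; exact: raug_deg.
have [e eE] := rhoS (fdeg_cochain eps0).
have sge : sg tau eps = eps.
  by apply: functional_ext => z; rewrite sgE !epsE (raug_tau tauE).
have itere k : iter k (sg tau) eps = eps by elim: k => //= k ->.
exists e; split.
- by apply/rhoD; rewrite eE.
- move=> x; apply: rhoI; rewrite mE /mbar /= eE sge; apply: functional_ext => z.
  by rewrite fvalN !actE epsE (raug_tau tauE) (tw_aug1 tw) opprK.
- move=> x; apply: rhoI; rewrite mE /mbar /= eE; apply: functional_ext => z.
  by rewrite fvalN !actE tauK (tw_unit1 tw epsE) functionalN opprK.
move=> s s2 es; have {es} [p [q es]] : exists p q, s = p ++ e :: q.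
  by case/splitPr: es => p q; exists p, q.
have b_eps u v : (1 < size (u ++ v))%N -> b (u ++ eps :: v) = 0.
  case: u => [|x u] uv; apply: functional_ext => z; rewrite fval0 bopE.
    by rewrite epsE (raug_tau tauE) (tw_aug tw).
  by rewrite (tw_unit tw epsE) ?linear0 ?functional0 //; case: u uv => //; case: v.
have twp u v : exists u', size u' = size u /\
    twist tau (map rho (u ++ e :: v)) = u' ++ eps :: twist tau (map rho v).
  elim: u => [|x u [u' [su' IH]]]; first by exists [::]; rewrite /= eE itere.
  by exists (iter (size (map rho (u ++ e :: v))) (sg tau) (rho x) :: u'); rewrite /= su' IH.
apply: rhoI; rewrite mE /mbar rho0 es.
have [p' [sp' ->]] := twp p q.
have [pq|pq] := leqP (size (p' ++ twist tau (map rho q))) 1; last by rewrite b_eps ?oppr0.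
rewrite es in s2; move: s2 pq; rewrite !size_cat size_twist size_map /= sp' => s2 pq.
have [p0 q0] : p = [::] /\ q = [::].
  by case: (p) s2 pq => [|? [|? ?]]; case: (q) => [|? [|? ?]].
case: p' sp' => [|? ?]; last by rewrite p0.
by rewrite q0 -[_ ++ _]/[:: eps] b_single oppr0.
Qed.

Lemma m_Ainf : Ainf_algebra m.
Proof.
split.
- move=> s t c x y; apply: rhoI; rewrite rhoL !mE; exact: mbar_mult.
- move=> ds s s0 hs; apply/rhoD; rewrite mE => k z ne kz.
  apply: (mbar_deg _ hs) kz; first by apply/eqP.
  by rewrite wdegE (forall2_size hs); apply: contra ne => /eqP ->; apply/eqP; bidegs.
- move=> ds s hs; apply: rhoI; rewrite rho0.
  rewrite (big_morph rho rhoDD rho0).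
  have E1 : \sum_(0 <= i < size s) \sum_(1 <= t < (size s - i).+1)
      insertion *:%R (fun w => rho (m w)) m ds s i t = 0.
    rewrite (insertion_twist (b := b) tauE bM rhoD) //.
    - by rewrite stasheff_b scaler0.
    - exact: b_deg.
    - exact: m_homog.
    exact: m_homog.
  rewrite -[RHS]E1; apply: eq_bigr => i _; rewrite (big_morph rho rhoDD rho0).
  apply: eq_bigr => t _; rewrite /insertion.
  by rewrite -[X in rho X]addr0 rhoL rho0 addr0.
exact: m_unit.
Qed.

Lemma m1 x : m [:: x] = 0.
Proof.
apply: rhoI; rewrite rho0 mE /mbar -[twist _ _]/[:: rho x].
by rewrite b_single oppr0.
Qed.

Definition fmor (s : seq (Ext P)) : {linear P -> P} :=
  (-%R \o phi (twist tau (map rho s))).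

Lemma fmor_homog ds s z : homog ds s ->
  fmor s z = - ((sign F (twexp ds))%:A *: phi (map rho s) z).
Proof.
move=> hs; rewrite /fmor /=; congr (- _).
exact: (twist_homog tauE (phiM z) (rho_homog hs)).
Qed.

(** This is [tw_flat] with signs restored. Insertions give the left side; the cuts at the two ends,
    where one factor is d, give [end_diff]; the cuts in between give the products. *)
Lemma fmor_morphism : Ainf_morphism_End m fmor.
Proof.
split.
- move=> s t c x y z; have /= e := rho_mult (twist_mult tau (phiM z)) s t c x y.
  by rewrite /fmor /= e opprD -scalerN.
- move=> ds s s0 hs k z kz; rewrite (fmor_homog _ hs).
  have := tw_deg tw (rho_homog hs) kz; rewrite wdegE (forall2_size hs).
  rewrite (_ : k - (_ + _) = k - (\sum_(d <- ds) d + (1 - (size s)%:Z, 0))); last by bidegs.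
  case: (_ - _) => n j nj; apply: (gradingN (rdeg_grading P)); rewrite -[j]add0r.
  by apply: (rdegZ (k := 0)) => //; apply: gdegZ; exact: gdeg1.
move=> ds s z s0 hs.
have E1 : \sum_(0 <= i < size s) \sum_(1 <= t < (size s - i).+1)
    insertion (fun (c : F) (v : P) => c%:A *: v) (fun s => fmor s z) m ds s i t
    = (sign F (twexp ds))%:A *: ins b si (fun w => phi w z) (map rho s).
  apply: (insertion_twist (b := b) tauE (phiM z) rhoD) => //.
  - exact: b_deg.
  - by move=> ds' s'; exact: fmor_homog.
  exact: m_homog.
rewrite E1; have := tw_flat tw (map rho s) z; rewrite /Omega => /eqP.
rewrite addrC addr_eq0 => /eqP ->; rewrite spl_takedrop size_map big_nat_recl //.
have [n sn] : exists n, size s = n.+1 by case: (s) s0 => // x w _; exists (size w).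
rewrite sn big_nat_recr //= take0 drop0 /= (tw_nil tw) -sn.
rewrite !drop_oversize ?size_map ?take_oversize ?size_map // (tw_nil tw).
rewrite scalerN !scalerDr !opprD addrA addrAC -/(fmor s).
have hw := rho_homog hs.
have siA d0 s1 y : homog d0 s1 -> phi (map si (map rho s1)) y
    = (sign F (\sum_(d <- d0) d.1 + (size d0)%:Z))%:A *: phi (map rho s1) y.
  move=> /rho_homog h1; have := map_si_homog tauE [::] (phiM y) h1.
  by rewrite !cats0.
have AA (c c' : F) (y : P) : c%:A *: (c'%:A *: y) = (c * c')%:A *: y.
  by rewrite scalerA -scalerAl mul1r scalerA.
congr (_ + _).
  rewrite /end_diff !(fmor_homog _ hs) (siA _ _ _ hs) sign_scale linearN [rdiff P (_ *: _)]linearZ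
    [X in _ = _ - X]scalerN opprK.
  congr (_ + _); rewrite !AA -scaleNr -scaleNr mulrC -mulNr; congr ((_ * _)%:A *: _).
  rewrite -mulrN1 -[- 1 in LHS](expr1 (-1 : F)) -[_ ^+ 1]/(sign F 1) -signD.
  apply: (@sign_eq F _ _ (size s)%:Z); rewrite (forall2_size hs) mulr2n; ring.
rewrite sn big_add1 /= scaler_sumr -sumrN; apply: eq_big_nat => i /andP[_ i_n].
have i_s : (i.+1 <= size s)%N by rewrite sn ltnS ltnW.
have hs' := hs; rewrite -{1}(cat_take_drop i.+1 s) in hs'.
have [dp [dq [eds hp hq]]] := forall2_split hs'.
have sdp : size dp = i.+1 by rewrite (forall2_size hp) size_takel.
have sdq : size dq = (n.+1 - i.+1)%N by rewrite (forall2_size hq) size_drop sn.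
have -> : take i.+1 ds = dp by rewrite eds take_size_cat.
rewrite -/(fmor (take i.+1 s)) -/(fmor (drop i.+1 s)).
rewrite -map_take -map_drop (siA _ _ _ hp) AA.
rewrite -[RHS]/(_ *: (fmor (take i.+1 s) (fmor (drop i.+1 s) z))).
rewrite (fmor_homog _ hp) (fmor_homog _ hq) linearN linearZ /= !scalerN opprK !sign_scale.
rewrite -scalerAl mul1r !scalerA -!scalerAl !mul1r !scalerA [X in _ = _ *: X]linearZ /= AA.
rewrite -scaleNr -scaleNr; congr (_%:A *: _).
rewrite -mulrN1 -[- 1 in LHS](expr1 (-1 : F)) -[_ ^+ 1]/(sign F 1) -!signD.
apply: (@sign_eq F _ _ (1 + (size dq)%:Z * (\sum_(d <- dp) d.1))).
rewrite eds twexp_cat -sdq sdp mulr2n; ring.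
Qed.

Lemma Ext_structure : Ext_Ainf_structure m.
Proof.
split; [exact: m_Ainf|exact: m1|exists fmor; first exact: fmor_morphism].
move=> x; have := rhoR x; congr (represents _ x); apply/funext => z /=.
by rewrite raugN (tw_aug1 tw) opprK.
Qed.

End Structure.

(** * Existence of minimal resolutions *)

Section Free.
Variables (R : nzRingType) (T : choiceType) (I : set T).

(** The index set is a predicate on a fixed type T, so that free modules on different index sets can
    be compared coordinate by coordinate. *)
Definition supported : {pred T -> R^o} :=
  [pred x | `[< (exists s : seq T, forall t, t \notin s -> x t = 0) /\
                forall t, ~ I t -> x t = 0 >]].

Lemma supported_closed : submod_closed supported.
Proof.
split; first by apply/asboolP; split=> //; exists [::].
move=> c x y /asboolP[[s xs] xI] /asboolP[[t yt] yI]; apply/asboolP; split.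
  exists (s ++ t) => u; rewrite mem_cat negb_or => /andP[us ut].
  by rewrite !fctE xs // yt // scaler0 addr0.
by move=> u nu; rewrite !fctE xI // yI // scaler0 addr0.
Qed.
HB.instance Definition _ :=
  GRing.isSubmodClosed.Build R (T -> R^o) supported supported_closed.

Record freemod := Free { free_val :> T -> R^o; _ : free_val \in supported }.
HB.instance Definition _ := [isSub for free_val].
HB.instance Definition _ := [Choice of freemod by <:].
HB.instance Definition _ := [SubChoice_isSubLmodule of freemod by <:].

Lemma coordD (x y : freemod) t : (x + y) t = x t + y t. Proof. by []. Qed.
Lemma coordZ a (x : freemod) t : (a *: x) t = a * x t. Proof. by []. Qed.

Lemma free_ext (x y : freemod) : (forall t, x t = y t) -> x = y.
Proof. by move=> e; apply/val_inj/funext. Qed.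

Lemma coord_out (x : freemod) t : ~ I t -> x t = 0.
Proof. by have /asboolP[_ xI] := valP x; exact: xI. Qed.

Lemma free_make (f : T -> R) : (exists s : seq T, forall t, t \notin s -> f t = 0) ->
  (forall t, ~ I t -> f t = 0) -> exists x : freemod, forall t, x t = f t.
Proof.
move=> fs fI; have fP : (f : T -> R^o) \in supported by apply/asboolP.
by exists (Free fP).
Qed.

Definition freegen (t : T) : freemod := insubd 0 ((fun t' => (t' == t)%:R) : T -> R^o).

Lemma freegenE t t' : I t -> freegen t t' = (t' == t)%:R.
Proof.
move=> It; rewrite /freegen -[LHS]/(val _ t') val_insubd.
suff -> : ((fun t' => (t' == t)%:R) : T -> R^o) \in supported by [].
apply/asboolP; split; first by exists [:: t] => u; rewrite inE => /negPf ->.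
by move=> u nIu; case: eqP => // e; case: nIu; rewrite e.
Qed.

Lemma coord_sum (J : Type) (s : seq J) (f : J -> freemod) t :
  (\sum_(i <- s) f i) t = \sum_(i <- s) f i t.
Proof.
by elim: s => [|i s IH]; rewrite ?big_nil // !big_cons coordD IH.
Qed.

Lemma free_expand (x : freemod) : exists s : seq T,
  [/\ uniq s, forall t, t \in s -> I t, forall t, t \notin s -> x t = 0 &
      x = \sum_(t <- s) x t *: freegen t].
Proof.
have /asboolP[[s xs] xI] := valP x.
pose s' := [seq t <- undup s | `[< I t >]].
have us' : uniq s' by rewrite filter_uniq // undup_uniq.
have Is' t : t \in s' -> I t by rewrite mem_filter => /andP[/asboolP].
have xs' t : t \notin s' -> x t = 0.
  rewrite mem_filter mem_undup negb_and => /orP[/asboolPn|]; first exact: xI.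
  exact: xs.
exists s'; split=> //; apply: free_ext => t; rewrite coord_sum.
rewrite (eq_big_seq (fun u => x u * (t == u)%:R)); last first.
  by move=> u us; rewrite coordZ freegenE //; exact: Is'.
have [ts|ts] := boolP (t \in s').
  rewrite (bigD1_seq t) //= eqxx mulr1 big1 ?addr0 // => u ut.
  by rewrite (eq_sym t) (negPf ut) mulr0.
rewrite xs' // big_seq big1 // => u us.
by case: eqP => [e|_]; rewrite ?mulr0 //; case/negP: ts; rewrite e.
Qed.

Definition freegen_set : set freemod := [set x | exists2 t, I t & x = freegen t].

Lemma freegen_inj t t' : I t -> I t' -> freegen t = freegen t' -> t = t'.
Proof.
move=> It It' /(congr1 (fun x : freemod => x t)); rewrite !freegenE // eqxx.
by case: eqP => // _ /eqP; rewrite oner_eq0.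
Qed.

Lemma free_basis : is_basis freegen_set.
Proof.
split=> [x|s c us sB s0 b bs].
  have [s [us Is xs ->]] := free_expand x.
  exists [seq (x t, freegen t) | t <- s]; split; last by rewrite big_map.
  by move=> e /mapP[t ts ->]; exists t => //; exact: Is.
have [t It bt] := sB b bs.
have := congr1 (fun x : freemod => x t) s0; rewrite coord_sum.
rewrite (eq_big_seq (fun u => c u * (u == b)%:R)); last first.
  move=> u us'; have [t' It' ut'] := sB u us'; rewrite coordZ ut' freegenE // bt.
  by congr (_ * (_ : bool)%:R); apply/eqP/eqP => [->//|/freegen_inj ->].
by rewrite (bigD1_seq b) //= eqxx mulr1 big1 ?addr0 // => u /negPf ->; rewrite mulr0.
Qed.

End Free.

Lemma grading_of_proj (I : eqType) (V : zmodType) (V_ : I -> set V) (p : I -> V -> V) :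
  (forall i, V_ i 0) -> (forall i x y, V_ i x -> V_ i y -> V_ i (x - y)) ->
  (forall i x y, p i (x + y) = p i x + p i y) ->
  (forall i x, V_ i x -> p i x = x) ->
  (forall i j x, V_ j x -> i != j -> p i x = 0) ->
  (forall i x, V_ i (p i x)) ->
  (forall K : V -> Prop, K 0 -> (forall x y, K x -> K y -> K (x + y)) ->
     (forall i x, V_ i x -> K x) -> forall x, K x) ->
  grading V_.
Proof.
move=> V0 VB pD pid pne pV gen.
have p0 i : p i 0 = 0 by apply: (@addrI _ (p i 0)); rewrite -pD !addr0.
pose Q x := exists s : seq I, [/\ uniq s, forall i, i \notin s -> p i x = 0 &
  x = \sum_(i <- s) p i x].
have ext x (s t : seq I) : uniq s -> uniq t -> {subset s <= t} ->
    (forall i, i \notin s -> p i x = 0) -> \sum_(i <- t) p i x = \sum_(i <- s) p i x.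
  move=> us ut st xs; rewrite (bigID (mem s)) /= [X in _ + X]big1 ?addr0; last first.
    by move=> i; exact: xs.
  rewrite -big_filter; apply: perm_big; apply: uniq_perm; rewrite ?filter_uniq // => i.
  by rewrite mem_filter; case: (boolP (i \in s)) => // /st.
have Qall : forall x, Q x.
  apply: gen => [|x y [s [us xs xe]] [t [ut yt ye]]|i x xi].
  - by exists [::]; rewrite big_nil; split.
  - exists (undup (s ++ t)); split=> [|i|]; first exact: undup_uniq.
      by rewrite mem_undup mem_cat negb_or pD => /andP[/xs -> /yt ->]; rewrite addr0.
    rewrite (eq_bigr _ (fun i _ => pD i x y)) big_split /=.
    rewrite (ext x s) ?undup_uniq // ?(ext y t) ?undup_uniq // -?xe -?ye // => i;
      by rewrite mem_undup mem_cat => ->; rewrite ?orbT.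
  exists [:: i]; split=> // [k|]; last by rewrite big_seq1 pid.
  by rewrite inE; exact: pne.
split=> // [x|s f us fV s0 i si].
  by have [s [us xs xe]] := Qall x; exists s, (fun i => p i x).
have := p0 i; rewrite -s0 (big_morph (p i) (pD i) (p0 i)) (bigD1_seq i) //= pid //.
by rewrite big1 ?addr0 // => k ki; apply: (pne i k) => //; rewrite eq_sym.
Qed.

(** * Graded free modules *)

Section BigradedAlgebra.
Variables (F : fieldType) (A : gradedAlg F).

(** A is placed in the bidegrees (0, k) with k >= 0 and is zero elsewhere, so that a coordinate can
    be required to have degree i - dg t without side conditions on that difference. *)
Definition gdegi (i : int * int) (a : A) : Prop :=
  if i is (0%:Z, Posz k) then gdeg k a else a = 0.

Lemma gdegi0 i : gdegi i 0.
Proof. by case: i => [[[|n]|n] [k|k]] //; exact: (grading0 (gdeg_grading A)). Qed.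

Lemma gdegiB i x y : gdegi i x -> gdegi i y -> gdegi i (x - y).
Proof.
case: i => [[[|n]|n] [k|k]] /=; try by move=> -> ->; rewrite subrr.
exact: (gradingB (gdeg_grading A)).
Qed.

Lemma gdegi_nat (k : nat) a : gdegi (0, k%:Z) a = gdeg k a. Proof. by []. Qed.

Lemma gdegiP i a : gdegi i a -> a = 0 \/ exists2 k : nat, i = (0, k%:Z) & gdeg k a.
Proof. by case: i => [[[|n]|n] [k|k]] /=; [right; exists k|left..]. Qed.

Lemma gdegi_grading : grading gdegi.
Proof.
have [p [pV pB pid p0 _]] := grading_proj (gdeg_grading A).
have pD i x y : p i (x + y) = p i x + p i y.
  by have := pB i (x + y) y; rewrite addrK => ->; rewrite subrK.
pose q (i : int * int) a := if i is (0%:Z, Posz k) then p k a else 0.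
apply: (grading_of_proj (p := q)).
- exact: gdegi0.
- exact: gdegiB.
- by case=> [[[|n]|n] [k|k]] x y /=; rewrite ?addr0 ?pD.
- by case=> [[[|n]|n] [k|k]] x //= xk; exact: pid.
- move=> i j x xj ij; have [-> |[k jk xk]] := gdegiP xj.
    case: i ij => [[[|n]|n] [l|l]] //= _.
    by rewrite -[X in p _ X](subrr 0) pB subrr.
  case: i ij => [[[|n]|n] [l|l]] //= ij; apply: (p0 _ k) => //.
  by apply: contra ij => /eqP ->; rewrite jk.
- by case=> [[[|n]|n] [k|k]] x //=.
move=> K K0 KD KV x; apply: (grading_ind (gdeg_grading A)) => // k y yk.
exact: (KV (0, k%:Z)).
Qed.

Lemma gdegiM k i (a x : A) : gdeg k a -> gdegi i x -> gdegi (i + (0, k%:Z)) (a * x).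
Proof.
move=> ka /gdegiP[->|[l -> xl]]; first by rewrite mulr0; exact: gdegi0.
rewrite (_ : _ + _ = (0, (k + l)%N%:Z)); first by rewrite gdegi_nat; exact: gdegM.
by bidegs.
Qed.

End BigradedAlgebra.

Section FreeGraded.
Variables (F : fieldType) (A : gradedAlg F) (T : choiceType) (I : set T).
Variable dg : T -> int * int.
Local Notation M := (freemod A I).

Definition fr_deg (i : int * int) (x : M) := forall t, gdegi (i - dg t) (x t).

Lemma freegen_deg t : I t -> fr_deg (dg t) (freegen A I t).
Proof.
move=> It t'; rewrite freegenE //; case: eqP => [->|_]; last exact: gdegi0.
by rewrite subrr; exact: gdeg1.
Qed.

Lemma fr_degZ k i (a : A) x : gdeg k a -> fr_deg i x -> fr_deg (i + (0, k%:Z)) (a *: x).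
Proof.
move=> ka ix t; rewrite coordZ; have := gdegiM ka (ix t).
by rewrite addrAC.
Qed.

Lemma fr_grading : grading fr_deg.
Proof.
have gA := gdegi_grading A.
have [q [qV qB qid q0 _]] := grading_proj gA.
have qD i x y : q i (x + y) = q i x + q i y.
  by have := qB i (x + y) y; rewrite addrK => ->; rewrite subrK.
have q00 i : q i 0 = 0 by rewrite -[X in q _ X](subrr 0) qB subrr.
have ex (ix : (int * int) * M) : exists y : M, forall t, y t = q (ix.1 - dg t) (ix.2 t).
  apply: free_make; last by move=> t nI; rewrite coord_out.
  by have [s [_ _ xs _]] := free_expand ix.2; exists s => t ts; rewrite xs.
have [p pE] := choice ex.
apply: (grading_of_proj (p := fun i x => p (i, x))).
- by move=> i t; exact: gdegi0.
- by move=> i x y ix iy t; apply: gdegiB.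
- by move=> i x y; apply: free_ext => t; rewrite coordD !pE /= qD.
- by move=> i x ix; apply: free_ext => t; rewrite pE /= qid //; exact: ix.
- move=> i j x jx ij; apply: free_ext => t; rewrite pE /=; apply: q0 (jx t) _.
  by apply: contra ij => /eqP/addIr ->.
- by move=> i x t; rewrite pE.
move=> K K0 KD KV x; have [s [us Is _ ->]] := free_expand x.
rewrite big_seq; elim/big_ind: _ => // t /Is It.
apply: (grading_ind (K := fun a : A => K (a *: freegen A I t)) (gdeg_grading A)).
- by rewrite scale0r.
- by move=> a b Ka Kb; rewrite scalerDl; exact: KD.
by move=> k a ka; apply: KV (fr_degZ ka (freegen_deg It)).
Qed.

End FreeGraded.

Lemma free_lift (R : nzRingType) (T : choiceType) (I : set T) (N : lmodType R) (f : T -> N) :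
  exists L : {linear freemod R I -> N}, forall t, I t -> L (freegen R I t) = f t.
Proof.
have ex (b : freemod R I) : exists y, forall t, I t -> b = freegen R I t -> y = f t.
  have [[t It bt]|no] := pselect (freegen_set b); last first.
    by exists 0 => t It bt; case: no; exists t.
  by exists (f t) => t' It' bt'; congr f; apply: (@freegen_inj R T I) => //; rewrite -bt.
have [g gP] := choice ex.
have [L LE] := basis_lift (@free_basis R T I) g.
by exists L => t It; rewrite LE; [exact: gP|exists t].
Qed.

(* Generators of the minimal resolution: a node records the homological and the
   internal degree of a generator and, as a formal combination of generators,
   its image under the differential. *)
Inductive tree (X : Type) : Type := Node of nat & nat & seq (X * tree X).
HB.instance Definition _ X := gen_eqMixin (tree X).
HB.instance Definition _ X := gen_choiceMixin (tree X).

(** * Minimal generators, one homological degree at a time *)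

Section Build.
Variables (F : fieldType) (A : gradedAlg F).
Hypothesis hconn : connected A.

Lemma augmentation : exists eps : A -> F,
  [/\ forall a b, eps (a + b) = eps a + eps b,
      forall c a, eps (c%:A * a) = c * eps a,
      forall n a b, (0 < n)%N -> gdeg n a -> eps (a * b) = 0,
      eps 1 = 1 & forall a, gdeg 0 a -> a = (eps a)%:A].
Proof.
have [p [pV pB pid p0 psum]] := grading_proj (gdeg_grading A).
have pD i x y : p i (x + y) = p i x + p i y.
  by have := pB i (x + y) y; rewrite addrK => ->; rewrite subrK.
have ex a : exists c : F, p 0%N a = c%:A by exact: hconn.
have [eps epsE] := choice ex.
have scI (c c' : F) : c%:A = c'%:A :> A -> c = c'.
  move=> e; apply/eqP; rewrite -subr_eq0; apply: contraT => ne.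
  have : (c - c')%:A = 0 :> A by rewrite scalerBl e subrr.
  move/(congr1 (fun z : A => (c - c')^-1 *: z)); rewrite scalerA mulVf // scale1r scaler0.
  by move/eqP; rewrite oner_eq0.
have g0 : gdeg 0 (1 : A) := gdeg1 A.
have p00 i : p i 0 = 0 by rewrite -[X in p _ X](subrr 0) pB subrr.
have pZ (c : F) a : p 0%N (c%:A * a) = c%:A * p 0%N a.
  move: a; apply: (grading_ind (gdeg_grading A)) => [|x y e1 e2|i x xi].
  - by rewrite mulr0 !p00 mulr0.
  - by rewrite mulrDr !pD e1 e2 mulrDr.
  have cx : gdeg i (c%:A * x) by rewrite -[i]add0n; apply: gdegM => //; exact: gdegZ.
  have [i0|i0] := eqVneq 0%N i; first by rewrite i0 !pid.
  by rewrite (p0 _ _ _ cx i0) (p0 _ _ _ xi i0) mulr0.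
exists eps; split.
- by move=> a b; apply: scI; rewrite scalerDl -!epsE pD.
- by move=> c a; apply: scI; rewrite -epsE pZ epsE -scalerAl mul1r scalerA.
- move=> n a b n0 an; apply: scI; rewrite -epsE scale0r.
  move: b; apply: (grading_ind (gdeg_grading A)) => [|x y e1 e2|i x xi].
  + by rewrite mulr0 p00.
  + by rewrite mulrDr pD e1 e2 addr0.
  apply: (p0 _ (n + i)%N); first exact: gdegM.
  by case: n n0 {an}.
- by apply: scI; rewrite -epsE pid // scale1r.
by move=> a a0; rewrite -epsE pid.
Qed.

Variable eps : A -> F.
Hypothesis epsD : forall a b, eps (a + b) = eps a + eps b.
Hypothesis epsZ : forall c a, eps (c%:A * a) = c * eps a.
Hypothesis eps_pos : forall n a b, (0 < n)%N -> gdeg n a -> eps (a * b) = 0.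
Hypothesis eps1 : eps 1 = 1.
Hypothesis eps_id : forall a, gdeg 0 a -> a = (eps a)%:A.

Local Notation T := (tree A).
Local Notation Fr := (freemod A [set: T]).
Local Notation gen t := (freegen A [set: T] t).
Definition root : T := Node 0 0 [::].
Definition hdeg (t : T) : nat := let: Node n _ _ := t in n.
Definition jdeg (t : T) : nat := let: Node _ j _ := t in j.
Definition dg (t : T) : int * int := ((hdeg t)%:Z, (jdeg t)%:Z).

Definition value (t : T) : Fr :=
  let: Node _ _ l := t in \sum_(e <- l) e.1 *: gen e.2.

(** On the module on all trees this need not square to zero; it does on the span of the trees
    selected in [Iall]. *)
Definition dF : {linear Fr -> Fr} := projT1 (cid (free_lift [set: T] value)).

Lemma dFE t : dF (gen t) = value t.
Proof. by rewrite /dF; case: cid => L LE /=; exact: LE. Qed.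

Lemma terms_ex (x : Fr) : exists l : seq (A * T), x = \sum_(e <- l) e.1 *: gen e.2.
Proof.
have [s [_ _ _ {1}->]] := free_expand x.
by exists [seq (x t, t) | t <- s]; rewrite big_map.
Qed.

Definition terms (x : Fr) : seq (A * T) := projT1 (cid (terms_ex x)).

Lemma termsE x : value (Node 0 0 (terms x)) = x.
Proof. by rewrite /terms; case: cid. Qed.

Lemma value_terms n j x : value (Node n j (terms x)) = x.
Proof. exact: termsE. Qed.

Definition cycles (S : set T) (n j : nat) : set (restr Fr) := [set x : Fr |
  [/\ forall t, ~ S t -> x t = 0, fr_deg dg (n%:Z, j%:Z) x &
      if n is 0%N then eps (x root) = 0 else dF x = 0]].

Definition decomposables (S : set T) (n j : nat) : set (restr Fr) :=
  fspan (V := restr Fr) [set y : Fr | exists k j' (a : A) z,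
    [/\ (0 < k)%N, gdeg k a, cycles S n j' z, (j' + k)%N = j & y = a *: z]].

(** In each internal degree G is a basis of the cycles modulo those obtained from lower degrees.
    Spanning will give exactness, independence will give minimality. *)
Lemma gens_ex S n j : exists G : set (restr Fr),
  [/\ G `<=` cycles S n j, indep_mod (decomposables S n j) G &
    forall x, cycles S n j x -> exists2 g, fspan G g & decomposables S n j (x - g)].
Proof.
have [G [_ GH indG GD]] := @indep_extend F (restr Fr) (decomposables S n j) set0
  (cycles S n j) (fspan_subspace _) (@sub0set _ _) (fun s c us s0 _ b bs => match s0 b bs with end).
by exists G.
Qed.

Definition gens S n j : set (restr Fr) := projT1 (cid (gens_ex S n j)).

Lemma gensP S n j : [/\ gens S n j `<=` cycles S n j,
  indep_mod (decomposables S n j) (gens S n j) &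
  forall x, cycles S n j x -> exists2 g, fspan (gens S n j) g & decomposables S n j (x - g)].
Proof. by rewrite /gens; case: cid. Qed.

Fixpoint Iset (n : nat) : set T :=
  if n is n'.+1 then
    [set t | exists j x, gens (Iset n') n' j x /\ t = Node n j (terms x)]
  else [set root].

Lemma Iset_hdeg n t : Iset n t -> hdeg t = n.
Proof. by case: n => [->|n [j [x [_ ->]]]]. Qed.

Definition Iall : set T := [set t | exists n, Iset n t].

Lemma Iset_of t : Iall t -> Iset (hdeg t) t.
Proof. by case=> n nt; rewrite (Iset_hdeg nt). Qed.

Lemma value_root : value root = 0. Proof. exact: big_nil. Qed.

Lemma value_gens n t : Iset n.+1 t -> gens (Iset n) n (jdeg t) (value t).
Proof. by move=> [j [x [Gx ->]]]; rewrite value_terms. Qed.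

Lemma value_cycle n t : Iset n.+1 t -> cycles (Iset n) n (jdeg t) (value t).
Proof. by move=> /value_gens; case: (gensP (Iset n) n (jdeg t)) => sub _ _ /sub. Qed.

Lemma value_inj n t t' : Iset n.+1 t -> Iset n.+1 t' -> jdeg t = jdeg t' ->
  value t = value t' -> t = t'.
Proof.
move=> [j [x [_ ->]]] [j' [x' [_ ->]]]; rewrite !value_terms /= => -> ->.
by [].
Qed.

Lemma cycles_deg_ge n j x t : cycles (Iset n) n j x -> x t <> 0 ->
  Iset n t /\ (jdeg t <= j)%N.
Proof.
move=> [xI xdeg _] xt; split; first by apply: contrapT => /xI.
have [//|[k /(congr1 snd) e _]] := gdegiP (xdeg t).
by rewrite sndD sndN /= in e; lia.
Qed.

(* A coefficient of the boundary of a generator cannot be a nonzero scalar: this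
   would contradict the independence of the chosen generators. *)
Lemma value_pos n t t' : Iset n.+1 t -> value t t' <> 0 ->
  exists2 k, (0 < k)%N & gdeg k (value t t').
Proof.
move=> It vt; have cyc := value_cycle It; set x := value t in vt cyc *.
have [It' _] := cycles_deg_ge cyc vt; have [xI xdeg xd] := cyc.
have [//|[k ke xk]] := gdegiP (xdeg t'); exists k => //; rewrite lt0n; apply/eqP => k0.
rewrite {}k0 in ke xk; have {ke} jt : jdeg t' = jdeg t.
  by move/(congr1 snd): ke; rewrite sndD sndN /=; lia.
apply: vt; rewrite (eps_id xk); suff -> : eps (x t') = 0 by rewrite scale0r.
have eps0 : eps 0 = 0 by apply: (@addrI _ (eps 0)); rewrite -epsD !addr0.
(* Over the root the claim is the augmentation condition built into [cycles]; higher up independence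
   is needed. *)
case: n It It' cyc xI xdeg xd => [|n] It It' cyc xI xdeg xd; first by rewrite It'.
rewrite /= in xd; have [s [us _ xs xe]] := free_expand x.
have [ts|/xs ->] := boolP (t' \in s); last exact: eps0.
pose Q u := `[< Iset n.+1 u /\ jdeg u = jdeg t >].
have nodeE u : Q u -> u = Node n.+1 (jdeg t) (terms (value u)).
  by move=> /asboolP[[j [y [_ ->]]] <-]; rewrite value_terms.
(* [indep_mod] takes coefficients as a function of the elements, so they are indexed by the value y;
   [nodeE] recovers the tree. *)
pose c (y : Fr) := eps (x (Node n.+1 (jdeg t) (terms y))).
pose D := decomposables (Iset n) n (jdeg t).
have sD : subspace D by exact: fspan_subspace.
(* In dF x = 0 the terms with scalar coefficients are minus the remaining ones, which come from
   generators of smaller internal degree and are therefore decomposable. *)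
have Dsum : D (\sum_(u <- s | Q u) (c (value u))%:A *: value u).
  have : \sum_(u <- s) x u *: value u = 0.
    rewrite -[RHS]xd [in RHS]xe linear_sum; apply: eq_bigr => u _.
    by rewrite linearZ /= dFE.
  rewrite (bigID Q) /= => /eqP; rewrite addr_eq0 => /eqP e.
  rewrite (eq_bigr (fun u => x u *: value u)); last first.
    move=> u Qu; rewrite /c -(nodeE u Qu) -eps_id //.
    have [Iu ju] := asboolW Qu; have := xdeg u; rewrite (_ : _ - _ = (0, 0%:Z)) //.
    by apply: bideg_eq; rewrite ?(fstD, fstN, sndD, sndN) /= ?(Iset_hdeg Iu) ?ju; lia.
  rewrite e; apply: (subspaceN sD); rewrite -big_filter.
  apply: (subspace_sum sD) => u; rewrite mem_filter => /andP[/asboolPn nQ _].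
  have [xu|/eqP xu] := eqVneq (x u) 0.
    by rewrite xu scale0r; case: sD.
  have [Iu ju] := cycles_deg_ge cyc xu.
  have ltj : (jdeg u < jdeg t)%N.
    by rewrite ltn_neqAle ju andbT; apply/eqP => e'; apply: nQ.
  apply: sub_fspan; exists (jdeg t - jdeg u)%N, (jdeg u), (x u), (value u); split.
  - by rewrite subn_gt0.
  - have := xdeg u; rewrite (_ : _ - _ = (0, (jdeg t - jdeg u)%N%:Z)) //.
    by apply: bideg_eq; rewrite ?(fstD, fstN, sndD, sndN) /= ?(Iset_hdeg Iu); lia.
  - exact: value_cycle.
  - exact: subnKC.
  by [].
pose V := [seq value u | u <- [seq u <- s | Q u]].
have uV : uniq V.
  rewrite map_inj_in_uniq ?filter_uniq // => u v.
  rewrite !mem_filter => /andP[/asboolP[Iu ju] _] /andP[/asboolP[Iv jv] _].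
  by apply: (value_inj Iu Iv); rewrite ju jv.
have [_ ind _] := gensP (Iset n) n (jdeg t).
have Vg y : y \in V -> gens (Iset n) n (jdeg t) y.
  move=> /mapP[u]; rewrite mem_filter => /andP[/asboolP[Iu <-] _] ->.
  exact: value_gens.
have Qt' : Q t' by apply/asboolP.
have := ind V c uV Vg; rewrite big_map big_filter => /(_ Dsum (value t')).
by rewrite /c -(nodeE _ Qt'); apply; apply: map_f; rewrite mem_filter Qt'.
Qed.

Lemma dF_expand (K : Fr -> Prop) (x : Fr) : K 0 -> (forall y z, K y -> K z -> K (y + z)) ->
  (forall t, x t <> 0 -> K (x t *: value t)) -> K (dF x).
Proof.
move=> K0 KD Kt; have [s [_ _ _ xe]] := free_expand x.
rewrite {1}xe linear_sum; elim/big_ind: _ => // t _.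
rewrite linearZ /= dFE; have [->|/eqP /Kt //] := eqVneq (x t) 0.
by rewrite scale0r.
Qed.

Lemma value_supp t u : Iall t -> value t u <> 0 -> Iall u.
Proof.
move=> /Iset_of; case: (hdeg t) => [->|n /value_cycle cyc]; first by rewrite value_root.
by move=> /(cycles_deg_ge cyc) [Iu _]; exists n.
Qed.

Lemma dF_value t : Iall t -> dF (value t) = 0.
Proof.
move=> /Iset_of; case: (hdeg t) => [->|n /value_cycle cyc].
  by rewrite value_root linear0.
case: n cyc => [|n] cyc; last by case: cyc.
apply: (dF_expand (K := fun y => y = 0)) => // [y z -> ->|u]; first by rewrite addr0.
by move=> /(cycles_deg_ge cyc) [-> _]; rewrite value_root scaler0.
Qed.

Lemma aug_value t : Iall t -> eps (value t root) = 0.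
Proof.
have eps0 : eps 0 = 0 by apply: (@addrI _ (eps 0)); rewrite -epsD !addr0.
move=> /Iset_of; case: (hdeg t) => [->|n /value_cycle cyc]; first by rewrite value_root.
case: n cyc => [|n] cyc; first by case: cyc.
have [-> //|/eqP] := eqVneq (value t root) 0.
by move=> /(cycles_deg_ge cyc) [/Iset_hdeg].
Qed.

Lemma dF_deg n j (x : Fr) : (forall t, ~ Iall t -> x t = 0) -> fr_deg dg (n, j) x ->
  fr_deg dg (n - 1, j) (dF x).
Proof.
move=> xI xdeg; have gF := fr_grading A [set: T] dg.
apply: dF_expand => [|y z|t xt]; [exact: (grading0 gF)|exact: gradingD|].
have It : Iall t by apply: contrapT => /xI.
have [//|[k ke xk]] := gdegiP (xdeg t); move: (Iset_of It).
case ht: (hdeg t) => [|m] It'; first by rewrite It' value_root scaler0; exact: (grading0 gF).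
have [_ vdeg _] := value_cycle It'.
have := fr_degZ xk vdeg; congr (fr_deg _ _ _).
have e1 := congr1 fst ke; have e2 := congr1 snd ke.
rewrite ?(fstD, fstN, sndD, sndN) /= ht in e1 e2.
by apply: bideg_eq; rewrite ?(fstD, fstN, sndD, sndN) /=; lia.
Qed.

(** Induction on the internal degree: elements of [gens] are values of nodes one level up, and a
    decomposable a *: z has z in a smaller degree. *)
Lemma cycles_boundary n j x : cycles (Iset n) n j x ->
  exists y : Fr, (forall t, ~ Iset n.+1 t -> y t = 0) /\ x = dF y.
Proof.
pose K : set (restr Fr) := [set x : Fr |
  exists y : Fr, (forall t, ~ Iset n.+1 t -> y t = 0) /\ x = dF y].
have KZ (a : A) (u v : Fr) : K u -> K v -> K (a *: u + v).
  move=> [y [y0 ->]] [z [z0 ->]]; exists (a *: y + z); rewrite linearP; split => // t nI.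
  by rewrite coordD coordZ y0 // z0 // mulr0 addr0.
have K0 : K 0 by exists 0; rewrite linear0.
have sK : subspace K by split=> // c u v; exact: KZ.
elim/ltn_ind: j x => j IH x xc; change (K x).
have [_ _ /(_ x xc) [g gG xg]] := gensP (Iset n) n j.
have -> : x = (1 : A) *: (g : Fr) + (x - g) by rewrite scale1r addrC subrK.
apply: (KZ 1).
  apply: (gG _ sK) => u Gu; exists (gen (Node n.+1 j (terms u))).
  rewrite dFE value_terms; split => // t nI; rewrite freegenE //.
  by case: eqP => // tE; case: nI; exists j, u.
apply: (xg _ sK) => u [k [j' [a [z [k0 ka zc jk ->]]]]].
rewrite -[a *: z]addr0; apply: KZ => //; apply: (IH j') => //.
by rewrite -jk -addn1 leq_add2l.
Qed.

Local Notation P0 := (freemod A Iall).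

Lemma inclusion_ex : exists inc : {linear P0 -> Fr}, forall x t, inc x t = x t.
Proof.
have [inc incE] := free_lift Iall (fun t => gen t); exists inc => x t.
move: x; apply: (basis_ind (@free_basis A T Iall)) => [|a x y e1 e2|b [u Iu ->]].
- by rewrite linear0.
- by rewrite linearP !coordD !coordZ e1 e2.
by rewrite incE // !freegenE.
Qed.

Variable inc : {linear P0 -> Fr}.
Hypothesis incE : forall x t, inc x t = x t.

Lemma inc_inj : injective inc.
Proof. by move=> x y e; apply: free_ext => t; rewrite -!incE e. Qed.

Lemma inc_supp x t : ~ Iall t -> inc x t = 0.
Proof. by move=> nI; rewrite incE coord_out. Qed.

Lemma inc_surj (y : Fr) : (forall t, ~ Iall t -> y t = 0) -> exists x, inc x = y.
Proof.
move=> yI; have [|x xE] := free_make (I := Iall) (f := y) _ yI.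
  by have [s [_ _ ys _]] := free_expand y; exists s.
by exists x; apply: free_ext => t; rewrite incE xE.
Qed.

(** The values of selected trees are supported on selected trees, by [value_supp], so [dF]
    restricts. *)
Lemma diff_ex : exists dP : {linear P0 -> P0}, forall x, inc (dP x) = dF (inc x).
Proof.
have ex t : exists x, Iall t -> inc x = value t.
  have [It|nI] := pselect (Iall t); last by exists 0.
  have [x xE] : exists x, inc x = value t.
    by apply: inc_surj => u nI; apply: contrapT => /(value_supp It).
  by exists x.
have [f fE] := choice ex; have [dP dPE] := free_lift Iall f; exists dP.
apply: (basis_ind (@free_basis A T Iall)) => [|a x y e1 e2|b [u Iu ->]].
- by rewrite !linear0.
- by rewrite !linearP /= e1 e2.
rewrite dPE // fE // -dFE; congr (dF _); apply: free_ext => t.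
by rewrite incE !freegenE.
Qed.

Variable dP : {linear P0 -> P0}.
Hypothesis dPE : forall x, inc (dP x) = dF (inc x).

Lemma inc_deg i x : fr_deg dg i (inc x) <-> fr_deg dg i x.
Proof. by split=> ix t; have := ix t; rewrite incE. Qed.

Lemma dP_deg n j x : fr_deg dg (n, j) x -> fr_deg dg (n - 1, j) (dP x).
Proof.
move=> /inc_deg xnj; apply/inc_deg; rewrite dPE; apply: dF_deg => // t.
exact: inc_supp.
Qed.

Lemma dPK x : dP (dP x) = 0.
Proof.
apply: inc_inj; rewrite !dPE linear0.
move: x; apply: (basis_ind (@free_basis A T Iall)) => [|a x y e1 e2|b [u Iu ->]].
- by rewrite !linear0.
- by rewrite !linearP /= e1 e2 scaler0 addr0.
have -> : inc (freegen A Iall u) = gen u.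
  by apply: free_ext => t; rewrite incE !freegenE.
by rewrite dFE dF_value.
Qed.

Definition augP (x : P0) : F := eps (x root).

Lemma augP_trivial : to_trivial augP.
Proof.
split=> [x y|c x|n a x n0 an]; rewrite /augP.
- by rewrite coordD epsD.
- by rewrite coordZ epsZ.
by rewrite coordZ (eps_pos _ n0 an).
Qed.

Lemma augP_diff x : augP (dP x) = 0.
Proof.
have [e eE] := exists_functional augP_trivial.
suff z : act e dP = 0 by rewrite -eE -actE z.
apply: (functional_eq hconn (@free_basis A T Iall)) => b [t It ->].
rewrite actE eE fval0 /augP -incE dPE.
have -> : inc (freegen A Iall t) = gen t.
  by apply: free_ext => u; rewrite incE !freegenE.
by rewrite dFE aug_value.
Qed.

Lemma augP_deg i x : i != (0, 0) -> fr_deg dg i x -> augP x = 0.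
Proof.
move=> i0 /(_ root); rewrite subr0 => /gdegiP[|[k ik xk]]; rewrite /augP.
  by move=> ->; apply: (@addrI _ (eps 0)); rewrite -epsD !addr0.
rewrite -[x root]mulr1; apply: (eps_pos _ _ xk).
by rewrite lt0n; apply: contra i0 => /eqP k0; rewrite ik k0.
Qed.

Lemma fr_deg_neg n j (x : P0) : (n < 0)%R \/ (j < 0)%R -> fr_deg dg (n, j) x -> x = 0.
Proof.
move=> nj xnj; apply: free_ext => t.
have [//|[k ke _]] := gdegiP (xnj t); exfalso.
have e1 := congr1 fst ke; have e2 := congr1 snd ke.
rewrite ?(fstD, fstN, sndD, sndN) /= in e1 e2; lia.
Qed.

Lemma P0_exact n j x : fr_deg dg (n%:Z, j) x -> (if n is 0%N then augP x = 0 else dP x = 0) ->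
  exists y, x = dP y.
Proof.
move=> xnj xc; case: j xnj => j xnj; last first.
  by exists 0; rewrite linear0; apply: fr_deg_neg xnj; right.
have [|y [yI xy]] := @cycles_boundary n j (inc x).
  split; [|exact/inc_deg|].
    move=> t nI; apply: contrapT; rewrite incE => xt; apply: nI.
    have It : Iall t by apply: contrapT => /(coord_out x).
    have [//|[k ke _]] := gdegiP (xnj t); have e1 := congr1 fst ke.
    rewrite ?(fstD, fstN, sndD, sndN) /= in e1; rewrite (_ : n = hdeg t); last by lia.
    exact: Iset_of.
  by case: (n) xc => [|m] xc; rewrite ?incE // -dPE xc linear0.
have [z zy] : exists z, inc z = y.
  by apply: inc_surj => t nI; apply: yI => It; apply: nI; exists n.+1.
by exists z; apply: inc_inj; rewrite dPE zy.
Qed.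

Lemma Iall_root : Iall root. Proof. by exists 0%N. Qed.

Lemma augP_root : augP (freegen A Iall root) = 1.
Proof. by rewrite /augP freegenE ?eqxx ?eps1 //; exact: Iall_root. Qed.

Lemma fr_degZ' k n j (a : A) (x : P0) :
  gdeg k a -> fr_deg dg (n, j) x -> fr_deg dg (n, k%:Z + j) (a *: x).
Proof.
move=> ka xnj; have := fr_degZ ka xnj; congr (fr_deg _ _ _).
by bidegs.
Qed.

Definition build : free_resolution A.
Proof.
refine (@FreeResolution F A P0 (fr_deg dg) dP augP (fr_grading A Iall dg) fr_degZ'
  _ _ dP_deg dPK augP_trivial augP_deg augP_diff _ _ _).
- by move=> n j x n0; apply: fr_deg_neg; left.
- exists (freegen_set (R := A) (I := Iall)); split; last exact: free_basis.
  by move=> b [t It ->]; exists (dg t); exact: freegen_deg.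
- by exists (freegen A Iall root); rewrite augP_root oner_eq0.
- by move=> j x xj x0; apply: (P0_exact (n := 0) xj).
move=> [[|n]|n] j x // _ xj x0; exact: (P0_exact (n := n.+1) xj).
Defined.

Lemma build_minimal : minimal build.
Proof.
pose pos (x : P0) := lspan (fun (a : A) (_ : P0) => exists2 k, (0 < k)%N & gdeg k a) x.
have pos0 : pos 0 by exists [::]; rewrite big_nil.
have posD x y : pos x -> pos y -> pos (x + y).
  move=> [s [sP ->]] [t [tP ->]]; exists (s ++ t); rewrite big_cat; split=> // e.
  by rewrite mem_cat => /orP[/sP|/tP].
have posZ (a : A) x : pos x -> pos (a *: x).
  move=> [s [sP ->]].
  apply: (grading_ind (K := fun a : A => pos (a *: _)) (gdeg_grading A)) a.
  - by rewrite scale0r.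
  - by move=> a b pa pb; rewrite scalerDl; exact: posD.
  move=> k a ka; exists [seq (a * e.1, e.2) | e <- s]; split.
    move=> e /mapP[e' /sP [l l0 le] ->] /=; exists (k + l)%N; last exact: gdegM.
    by rewrite addn_gt0 l0 orbT.
  by rewrite big_map scaler_sumr; apply: eq_bigr => e _; rewrite scalerA.
move=> x; change (pos (dP x)); move: x.
apply: (basis_ind (@free_basis A T Iall)) => [|a x y px py|b [t It ->]].
- by rewrite linear0.
- by rewrite linearP; apply: posD => //; exact: posZ.
have incg : inc (freegen A Iall t) = gen t.
  by apply: free_ext => u; rewrite incE !freegenE.
have dPt u : dP (freegen A Iall t) u = value t u by rewrite -incE dPE incg dFE.
have [s [_ _ _ ->]] := free_expand (dP (freegen A Iall t)).
elim/big_ind: _ => // u _; rewrite dPt.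
have [->|/eqP vu] := eqVneq (value t u) 0; first by rewrite scale0r.
have := Iset_of It; case: (hdeg t) => [tr|n It'].
  by case: vu; rewrite tr value_root.
have [k k0 vk] := value_pos It' vu.
exists [:: (value t u, freegen A Iall u)]; split; last by rewrite big_seq1.
by move=> e; rewrite inE => /eqP -> /=; exists k.
Qed.

Lemma build_basis0 t j : Iall t -> fr_deg dg (0, j) (freegen A Iall t) -> t = root.
Proof.
move=> It /(_ t); rewrite freegenE // eqxx => /gdegiP[/eqP|[k ke _]].
  by rewrite oner_eq0.
have e1 := congr1 fst ke; rewrite ?(fstD, fstN) /= in e1.
by have := Iset_of It; rewrite (_ : hdeg t = 0%N); last by lia.
Qed.

End Build.

Theorem minimal_resolution (F : fieldType) (A : gradedAlg F) : connected A ->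
  exists (P : free_resolution A) (B : set P) (one : P),
    [/\ minimal P, (forall b, B b -> exists i, rdeg P i b) /\ is_basis B,
        [/\ B one, rdeg P (0, 0) one & raug P one = 1] &
        forall b j, B b -> rdeg P (0, j) b -> b = one].
Proof.
move=> hconn; have [eps [epsD epsZ eps_pos eps1 eps_id]] := augmentation hconn.
have [inc incE] := inclusion_ex (A := A) eps.
have [dP dPE] := diff_ex incE.
exists (build hconn epsD epsZ eps_pos eps1 incE dPE).
exists (freegen_set (R := A) (I := Iall eps)), (freegen A (Iall eps) (root A)).
split.
- exact: build_minimal.
- split; last exact: free_basis.
  by move=> b [t It ->]; exists (dg t); exact: freegen_deg.
- split; [by exists (root A) => //; exact: Iall_root|exact: (@freegen_deg F A _ (Iall eps) (@dg F A) (root A) (Iall_root eps))|].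
  exact: augP_root.
by move=> b j [t It ->] bj; rewrite (build_basis0 It bj).
Qed.

(** * Concentration of Ext and the table of multiplications *)

Section Comparison.
Variables (F : fieldType) (A : gradedAlg F).
Hypothesis hconn : connected A.

Lemma trivial_scalar (a : A) : exists c : F, forall (M : lmodType A) (w : M -> F) z,
  to_trivial w -> w (a *: z) = c * w z.
Proof.
apply: (grading_ind (K := fun a : A => exists c : F, forall (M : lmodType A) (w : M -> F) z,
  to_trivial w -> w (a *: z) = c * w z) (gdeg_grading A)) a.
- exists 0 => M w z [wD _ _]; rewrite scale0r mul0r.
  by apply: (@addrI _ (w 0)); rewrite -wD !addr0.
- move=> a b [c cE] [c' cE']; exists (c + c') => M w z wT.
  by have [wD _ _] := wT; rewrite scalerDl wD cE // cE' // mulrDl.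
move=> [|n] a an.
  by have [c ->] := hconn an; exists c => M w z [_ wZ _].
by exists 0 => M w z [_ _ w0]; rewrite mul0r (w0 n.+1).
Qed.

Lemma exists_one (P : free_resolution A) : exists one : P,
  rdeg P (0, 0) one /\ raug P one = 1.
Proof.
have [p [[pV _ _] _ _ _ [_ [r00 _]]]] := res_proj P.
have [x x0] := raug_surj P; exists ((raug P x)^-1%:A *: p (0, 0) x); split.
  by apply: (rdegZ (k := 0) (j := 0)) => //; apply: gdegZ; exact: gdeg1.
by rewrite raugZ r00 mulVf.
Qed.

Lemma res_contraction (P : free_resolution A) : exists (one : P) (h : P -> P),
  [/\ rdeg P (0, 0) one, raug P one = 1,
      (forall x y, h (x + y) = h x + h y) /\ (forall n j x, rdeg P (n, j) x -> rdeg P (n + 1, j) (h x)),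
      forall x, rdiff P (h x) + h (rdiff P x) = x - (raug P x)%:A *: one &
      forall x, raug P (h x) = 0].
Proof.
have [one [one_deg one_aug]] := exists_one P; exists one.
have homS x : [set one] x -> exists i, rdeg P i x by move=> ->; exists (0, 0).
have indS : indep_mod (V := restr P) (range (rdiff P)) [set one].
  move=> s c us sS [y _ ye] b bs; have := congr1 (raug P) ye; rewrite raug_diff.
  rewrite (big_morph _ (@raugD _ _ P) (raug0 P)) (bigD1_seq b) //= raugZ (sS b bs).
  rewrite one_aug mulr1 big1_seq ?addr0 // => b' /andP[b'b b's].
  by move: b'b; rewrite (sS b' b's) ?(sS b bs) eqxx.
have [h [hL h_deg dh raug_h _]] := contraction homS indS erefl one_deg one_aug.
exists h; split=> //; split=> // x y.
by have := hL 1 x y; rewrite !scale1r.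
Qed.

Variables (P : free_resolution A) (B : set P).
Hypothesis homB : forall b, B b -> exists i, rdeg P i b.
Hypothesis basB : is_basis B.

(** The comparison map with h in place of chosen preimages: u b = raug(b) one + h (u (d b)). On a
    cycle z of augmentation 0 the homotopy formula reads d (h z) = z. *)
Lemma chain_lift (Q : free_resolution A) : exists u : {linear P -> Q},
  [/\ forall x, rdiff Q (u x) = u (rdiff P x), forall x, raug Q (u x) = raug P x &
      forall i x, rdeg P i x -> rdeg Q i (u x)].
Proof.
have [one [h [deg1 aug1 [hD h_deg] dh raug_h]]] := res_contraction Q.
have d1 : rdiff Q one = 0 by exact: rdeg_ge0 (rdiff_deg deg1).
have [f fE] := rec_lift homB basB (fun s : unit => s)
  (fun _ b => (raug P b)%:A *: one) h.
pose u := f tt; have uE b : B b -> u b = (raug P b)%:A *: one + h (u (rdiff P b)) by exact: fE.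
have rT (M : free_resolution A) : to_trivial (raug M) by exact: raug_triv.
have h0 : h 0 = 0 by apply: (@addrI _ (h 0)); rewrite -hD !addr0.
exists u.
suff K x : rdiff Q (u x) = u (rdiff P x) /\ raug Q (u x) = raug P x.
  split=> [x|x|i x xi]; [by case: (K x)|by case: (K x)|].
  rewrite -[i]addr0; move: i x xi; apply: (res_deg_ind homB basB) => b i Bb ib.
  rewrite !addr0 (uE b Bb) => IH; apply: (gradingD (rdeg_grading Q)).
    have [i0|i0] := eqVneq i (0, 0).
      rewrite i0; apply: (rdegZ (k := 0) (j := 0)) => //.
      by apply: gdegZ; exact: gdeg1.
    by rewrite (raug_deg i0 ib) !scale0r; exact: (grading0 (rdeg_grading Q)).
    by case: i {ib} IH => n j IH; have := h_deg (n - 1) (j - 0) _ IH; rewrite subrK subr0.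
move: x; apply: (res_ind homB basB) => [|a x y [dx rx] [dy ry]|b Bb [dx rx]].
- by rewrite !linear0 !raug0.
- rewrite !linearP /= dx dy; split=> //; have [c cE] := trivial_scalar a.
  by rewrite !raugD !cE // rx ry.
have dd : rdiff P (rdiff P b) = 0 by exact: rdiffK.
rewrite dd linear0 in dx; rewrite raug_diff in rx.
rewrite (uE b Bb) linearD linearZ /= d1 scaler0 add0r raugD raugZ aug1 mulr1 raug_h addr0.
split=> //; have := dh (u (rdiff P b)); rewrite dx h0 addr0 rx !scale0r subr0.
by [].
Qed.

(** On the basis k b = h (g b - k (d b)); the argument is a cycle by induction, and its augmentation
    vanishes because those of g and k do. *)
Lemma chain_homotopy (g : {linear P -> P}) :
  (forall x, rdiff P (g x) = g (rdiff P x)) -> (forall x, raug P (g x) = 0) ->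
  (forall i x, rdeg P i x -> rdeg P i (g x)) ->
  exists k : {linear P -> P}, (forall x, rdiff P (k x) + k (rdiff P x) = g x) /\
    forall n j x, rdeg P (n, j) x -> rdeg P (n + 1, j) (k x).
Proof.
move=> gd gr gdeg_; have [one [h [deg1 aug1 [hD h_deg] dh raug_h]]] := res_contraction P.
have [f fE] := rec_lift homB basB (fun s : unit => s)
  (fun _ b => h (g b)) (fun z => - h z).
have h0 : h 0 = 0 by apply: (@addrI _ (h 0)); rewrite -hD !addr0.
have hN x : h (- x) = - h x by apply: (@addrI _ (h x)); rewrite -hD !subrr h0.
pose k := f tt; have kE b : B b -> k b = h (g b) - h (k (rdiff P b)) by exact: fE.
exists k; split.
  suff K x : rdiff P (k x) + k (rdiff P x) = g x /\ raug P (k x) = 0 by move=> x; case: (K x).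
  move: x; apply: (res_ind homB basB) => [|a x y [dx rx] [dy ry]|b Bb [dx rx]].
  - by rewrite !linear0 addr0 raug0.
  - rewrite !linearP /= addrACA -scalerDr dx dy; split=> //.
    have [c cE] := trivial_scalar a; rewrite raugD cE ?rx ?ry ?mulr0 ?addr0 //.
    exact: raug_triv.
  rewrite rdiffK linear0 addr0 in dx.
  rewrite (kE b Bb) -hN -hD; split; last exact: raug_h.
  set z := _ - _; have := dh z; rewrite linearB /= gd dx subrr h0 addr0.
  by rewrite raugD raugN gr rx subrr !scale0r subr0 /z => ->; rewrite subrK.
move=> n j x xn; have : rdeg P ((n, j) + (1, 0)) (k x).
  move: (n, j) x xn => {n j}; apply: (res_deg_ind homB basB) => b [n j] Bb ib IH.
  rewrite (kE b Bb) -[_ + _]/(n + 1, j + 0) addr0; apply: (gradingB (rdeg_grading P)).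
    by apply: h_deg; exact: gdeg_.
  apply: h_deg; move: IH; rewrite -[_ + _]/(n - 1 + 1, j - 0 + 0).
  by rewrite subrK subr0 addr0.
by rewrite -[_ + _]/(n + 1, j + 0) addr0.
Qed.

End Comparison.

Local Open Scope quotient_scope.

(** With u : P -> Q, w : Q -> P and a homotopy k from w o u to the identity, a cocycle phi that
    kills the image of w equals phi o k o d, a coboundary. *)
Theorem ext_concentrated (F : fieldType) (A : gradedAlg F) (d : nat)
    (P : free_resolution A) (p j : int) (x : Ext P) :
  connected A -> bi_Koszul d A -> bideg (p, j) x -> x <> 0 ->
  exists n : nat, p = n%:Z /\ (j = (Delta d n).1%:Z \/ j = (Delta d n).2%:Z).
Proof.
move=> hconn [Q [_ Qgen]] [phi [phiT phi0] [z zphi xz]] x0; apply: contrapT => no.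
have [B [homB basB]] := res_free P; have [BQ [homBQ basBQ]] := res_free Q.
have [w [wd wr wdeg_]] := chain_lift hconn homBQ basBQ P.
have [u [ud ur udeg]] := chain_lift hconn homB basB Q.
have [phiD _ _] := phiT; have phi00 : phi 0 = 0.
  by apply: (@addrI _ (phi 0)); rewrite -phiD !addr0.
(* No generator of Q_p has internal degree j, w preserves degrees, and coefficients in A act on
   values of phi by scalars. *)
have phiw y : phi (w y) = 0.
  move: y; apply: (grading_ind (K := fun y => phi (w y) = 0) (rdeg_grading Q)).
  - by rewrite linear0.
  - by move=> y y' e1 e2; rewrite linearD phiD e1 e2 addr0.
  move=> i y yi; have [ip|ip] := eqVneq i (p, j); last exact: phi0 (wdeg_ _ _ yi).
  rewrite {}ip in yi; case: p phi0 no yi => p phi0 no yi; last first.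
    by rewrite (rdeg_ge0 _ yi) // linear0.
  have [s [sP ->]] := Qgen p j y yi.
  elim: s sP => [|e s IH] sP; first by rewrite big_nil linear0.
  rewrite big_cons linearD phiD IH ?addr0; last first.
    by move=> e' e's; apply: sP; rewrite inE e's orbT.
  have [c cE] := trivial_scalar hconn e.1; rewrite linearZ /= cE //.
  have [k kD ek] := sP e (mem_head _ _).
  rewrite (phi0 _ _ _ (wdeg_ _ _ ek)) ?mulr0 //.
  apply/eqP => -[kj]; apply: no; exists p; split=> //.
  by move: kD; rewrite !inE -kj => /orP[/eqP ->|/eqP ->]; [left|right].
have gL : linear (fun y : P => y - w (u y)).
  move=> a y y'; have -> : w (u (a *: y + y')) = a *: w (u y) + w (u y') by rewrite !linearP.
  by rewrite scalerBr opprD addrACA.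
pose gLm := GRing.isLinear.Build A P P *:%R (fun y : P => y - w (u y)) gL.
pose g : {linear P -> P} := HB.pack (fun y : P => y - w (u y)) gLm.
have [||i y yi|k [kg kdeg]] := chain_homotopy hconn homB basB (g := g).
- by move=> y; rewrite /= linearB /= wd ud.
- by move=> y; rewrite /= raugD raugN wr ur subrr.
- by apply: (gradingB (rdeg_grading P)) => //; apply: wdeg_; apply: udeg.
apply: x0; rewrite xz.
suff zc : z \in coboundary (P := P).
  have : \pi_(quotmod (coboundary_closed P)) z == \pi_(quotmod (coboundary_closed P)) 0.
    by rewrite quotmodE subr0.
  move=> /eqP ->; apply: (@addrI _ (\pi_(quotmod (coboundary_closed P)) 0)).
  by rewrite addr0 -quotmodD addr0.
apply/asboolP; exists (phi \o k : P -> F^o); split.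
  split; first exact: to_trivial_comp.
  exists [:: (p - 1, j)] => -[n l] y; rewrite inE => ne yn; apply: phi0 (kdeg _ _ _ yn).
  by apply: contra ne => /eqP[<- <-]; rewrite addrK.
have phid y : phi (rdiff P y) = 0.
  by have /asboolP[_ e] := valP z; rewrite -zphi; exact: (congr1 (@^~ y) e).
apply/funext => y; rewrite zphi /=.
have := congr1 phi (kg y); rewrite /= !phiD phid add0r => ->.
have phiN t : phi (- t) = - phi t.
  by apply: (@addrI _ (phi t)); rewrite -phiD !subrr phi00.
by rewrite phiN phiw subr0.
Qed.

(** * Degree arithmetic of the table *)

Definition cnt (l : piece) (ls : seq piece) : nat := count_mem l ls.

Lemma perm_cnt (s t : seq piece) : (forall l, cnt l s = cnt l t) -> perm_eq s t.
Proof. by move=> e; apply/allP => l _; apply/eqP; exact: e. Qed.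

Lemma sum_cnt (f : piece -> nat) ls : \sum_(l <- ls) f l =
  (cnt E0 ls * f E0 + cnt E1 ls * f E1 + cnt E2d ls * f E2d + cnt E2d1 ls * f E2d1)%N.
Proof.
elim: ls => [|l ls IH]; first by rewrite big_nil.
by rewrite big_cons IH /cnt /=; case: l; rewrite /= ?eqxx; lia.
Qed.

Lemma size_cnt ls : size ls = (cnt E0 ls + cnt E1 ls + cnt E2d ls + cnt E2d1 ls)%N.
Proof. by rewrite -sum1_size (sum_cnt (fun _ => 1%N)); lia. Qed.

Section Table.
Variable d : nat.
Hypothesis d2 : (2 <= d)%N.

Definition res_of (l : piece) : nat := match l with E0 => 0 | E1 => 1 | E2d => 2 | E2d1 => 2 end.
Definition off_of (l : piece) : nat := match l with E0 => 0 | E1 => 1 | E2d => d | E2d1 => d.+1 end.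
Definition exact_deg (k : nat) (l : piece) : int * int :=
  ((3 * k + res_of l)%N%:Z, (2 * d * k + off_of l)%N%:Z).

Lemma Delta_exact n j : j = (Delta d n).1%:Z \/ j = (Delta d n).2%:Z ->
  exists k l, (n%:Z, j) = exact_deg k l.
Proof.
rewrite /Delta /exact_deg => jE; exists (n %/ 3)%N.
have := divn_eq n 3; have : (n %% 3 < 3)%N by exact: ltn_pmod.
move: jE; case: (n %% 3)%N => [|[|[|//]]] /= jE _ ne.
- by exists E0; congr (_, _); rewrite /=; [lia|case: jE => ->; rewrite addn0].
- by exists E1; congr (_, _); rewrite /=; [lia|case: jE => ->].
case: jE => ->; [exists E2d|exists E2d1]; congr (_, _); rewrite //=; try lia.
Qed.

(** The table by multiplicities, in the order of [reduced_table], in a form accessible to linear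
    arithmetic. *)
Definition in_table (a b c e : nat) : Prop := (
  (a = 2 /\ b = 0 /\ c = 0 /\ e = 0) \/
  (a = 1 /\ b = 1 /\ c = 0 /\ e = 0) \/
  (a = 0 /\ b = 0 /\ c = 1 /\ e = 1) \/
  (a = 1 /\ b = 0 /\ c = 1 /\ e = 0) \/
  (a = 1 /\ b = 0 /\ c = 0 /\ e = 1) \/
  (a = 1 /\ b = 0 /\ c = 2 /\ e = 0) \/
  (a = 0 /\ b = 1 /\ c = 2 /\ e = 0) \/
  (a = 1 /\ b = 1 /\ c = 1 /\ e = 0) \/
  (a = 0 /\ b = 0 /\ c = 3 /\ e = 0) \/
  (a = 0 /\ b = 0 /\ c = 2 /\ e = 1) \/
  (a = 0 /\ b = 0 /\ c = 4 /\ e = 0) \/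
  (a = 0 /\ b = 1 /\ c = 3 /\ e = 0) \/
  (a = 0 /\ b = d.-1 /\ c = 0 /\ e = 1) \/
  (a = 0 /\ b = d /\ c = 0 /\ e = 0) \/
  (a = 0 /\ b = d /\ c = 1 /\ e = 0) \/
  (a = 0 /\ b = d.+1 /\ c = 0 /\ e = 0))%N.

(* A product of a factors of type E0, b of type E1, c of type E2d and e of type E2d1
   has a degree occurring in E(A) only for the entries of the table. *)
Lemma table_arith (l : piece) (K L a b c e : nat) :
  ((3 * K + (b + 2 * c + 2 * e))%N%:Z + 2 - (a + b + c + e)%N%:Z = (3 * L + res_of l)%N%:Z)%R ->
  (2 * d * K + (b + d * c + d.+1 * e))%N = (2 * d * L + off_of l)%N ->
  in_table a b c e.
Proof.
move=> e1 e2.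
(* Three times the internal equation minus 2d times the homological one eliminates both K and L. *)
have key : (d * (c + e + 2 * a) + 3 * b + 3 * e + 2 * d * res_of l = 4 * d + 3 * off_of l)%N.
  have : (3 * d * (2 * K) + 3 * (b + d * c + d.+1 * e) = 3 * d * (2 * L) + 3 * off_of l)%N by lia.
  have : (2 * d * (3 * K + (b + 2 * c + 2 * e) + 2)
    = 2 * d * (3 * L + res_of l + (a + b + c + e)))%N by congr (_ * _)%N; lia.
  lia.
have mod3 : exists M : int, (2 + c%:Z + e%:Z - a%:Z - (res_of l)%:Z = 3 * M)%R.
  by exists (L%:Z - K%:Z)%R; lia.
(* Since d >= 2, the right side of [key] is less than 5d + 2d res_of l. So finitely many a, c, e
   remain, and together with l they determine b. *)
have X4 : (c + e + 2 * a <= 4)%N.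
  rewrite leqNgt; apply/negP => X5.
  have : (d * 5 <= d * (c + e + 2 * a))%N by rewrite leq_mul2l X5 orbT.
  by case: l {e1 e2 mod3} key => /=; lia.
have [M mM] := mod3.
have a2 : (a <= 2)%N by lia.
have c4 : (c <= 4)%N by lia.
have e4 : (e <= 4)%N by lia.
clear e1 e2 mod3 K L.
rewrite /in_table.
case: l key mM => /= key mM;
case: a a2 X4 key mM => [|[|[|//]]] _ X4 key mM;
case: c c4 X4 key mM => [|[|[|[|[|//]]]]] _ X4 key mM;
case: e e4 X4 key mM => [|[|[|[|[|//]]]]] _ X4 key mM; lia.
Qed.

Lemma in_table_has ls : in_table (cnt E0 ls) (cnt E1 ls) (cnt E2d ls) (cnt E2d1 ls) ->
  has (fun e => perm_eq ls e.1) (reduced_table d).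
Proof.
have perm t : (cnt E0 ls = cnt E0 t) /\ (cnt E1 ls = cnt E1 t) /\ (cnt E2d ls = cnt E2d t)
    /\ (cnt E2d1 ls = cnt E2d1 t) -> perm_eq ls t.
  by case=> ? [? [? ?]]; apply: perm_cnt; case.
rewrite /reduced_table => H; apply/hasP.
case: H => [[ha [hb [hc he]]]|
  [[ha [hb [hc he]]]|
  [[ha [hb [hc he]]]|
  [[ha [hb [hc he]]]|
  [[ha [hb [hc he]]]|
  [[ha [hb [hc he]]]|
  [[ha [hb [hc he]]]|
  [[ha [hb [hc he]]]|
  [[ha [hb [hc he]]]|
  [[ha [hb [hc he]]]|
  [[ha [hb [hc he]]]|
  [[ha [hb [hc he]]]|
  [[ha [hb [hc he]]]|
  [[ha [hb [hc he]]]|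
  [[ha [hb [hc he]]]|[ha [hb [hc he]]]]]]]]]]]]]]]]]].
- exists ([:: E0; E0], 0%N); first by rewrite !inE eqxx ?orbT.
  by apply: perm; rewrite ha hb hc he /cnt /= ?count_nseq /=; lia.
- exists ([:: E0; E1], 1%N); first by rewrite !inE eqxx ?orbT.
  by apply: perm; rewrite ha hb hc he /cnt /= ?count_nseq /=; lia.
- exists ([:: E2d; E2d1], 1%N); first by rewrite !inE eqxx ?orbT.
  by apply: perm; rewrite ha hb hc he /cnt /= ?count_nseq /=; lia.
- exists ([:: E0; E2d], 2%N); first by rewrite !inE eqxx ?orbT.
  by apply: perm; rewrite ha hb hc he /cnt /= ?count_nseq /=; lia.
- exists ([:: E0; E2d1], 2%N); first by rewrite !inE eqxx ?orbT.
  by apply: perm; rewrite ha hb hc he /cnt /= ?count_nseq /=; lia.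
- exists ([:: E0; E2d; E2d], 0%N); first by rewrite !inE eqxx ?orbT.
  by apply: perm; rewrite ha hb hc he /cnt /= ?count_nseq /=; lia.
- exists ([:: E1; E2d; E2d], 1%N); first by rewrite !inE eqxx ?orbT.
  by apply: perm; rewrite ha hb hc he /cnt /= ?count_nseq /=; lia.
- exists ([:: E0; E1; E2d], 2%N); first by rewrite !inE eqxx ?orbT.
  by apply: perm; rewrite ha hb hc he /cnt /= ?count_nseq /=; lia.
- exists ([:: E2d; E2d; E2d], 2%N); first by rewrite !inE eqxx ?orbT.
  by apply: perm; rewrite ha hb hc he /cnt /= ?count_nseq /=; lia.
- exists ([:: E2d1; E2d; E2d], 2%N); first by rewrite !inE eqxx ?orbT.
  by apply: perm; rewrite ha hb hc he /cnt /= ?count_nseq /=; lia.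
- exists ([:: E2d; E2d; E2d; E2d], 0%N); first by rewrite !inE eqxx ?orbT.
  by apply: perm; rewrite ha hb hc he /cnt /= ?count_nseq /=; lia.
- exists ([:: E1; E2d; E2d; E2d], 2%N); first by rewrite !inE eqxx ?orbT.
  by apply: perm; rewrite ha hb hc he /cnt /= ?count_nseq /=; lia.
- exists (E2d1 :: nseq d.-1 E1, 0%N); first by rewrite !inE eqxx ?orbT.
  by apply: perm; rewrite ha hb hc he /cnt /= ?count_nseq /=; lia.
- exists (nseq d E1, 2%N); first by rewrite !inE eqxx ?orbT.
  by apply: perm; rewrite ha hb hc he /cnt /= ?count_nseq /=; lia.
- exists (E2d :: nseq d E1, 0%N); first by rewrite !inE eqxx ?orbT.
  by apply: perm; rewrite ha hb hc he /cnt /= ?count_nseq /=; lia.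
- exists (nseq d.+1 E1, 2%N); first by rewrite !inE eqxx ?orbT.
  by apply: perm; rewrite ha hb hc he /cnt /= ?count_nseq /=; lia.
Qed.

(** The second equation gives the residue of the value: the product has homological degree 2 + #E2d
    + #E2d1 - #E0 modulo 3, and this is [e.2]. *)
Lemma table_in e ls : e \in reduced_table d -> perm_eq ls e.1 ->
  in_table (cnt E0 ls) (cnt E1 ls) (cnt E2d ls) (cnt E2d1 ls) /\
  (size ls + e.2 + 3 * ((2 + cnt E2d ls + cnt E2d1 ls - cnt E0 ls - e.2) %/ 3)
    = 2 + size ls + cnt E2d ls + cnt E2d1 ls - cnt E0 ls)%N.
Proof.
move=> eT pe; have cE l : cnt l ls = cnt l e.1 by exact: (permP pe).
rewrite !cE size_cnt !cE /in_table.
move: eT; rewrite !inE.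
repeat (case/orP => [/eqP ->|]; first by rewrite /cnt /= ?count_nseq /=; split; lia).
by move=> /eqP ->; rewrite /cnt /= ?count_nseq /=; split; lia.
Qed.

End Table.

(** * Concentration implies reducedness *)

Section Reducedness.
Variables (F : fieldType) (d : nat) (E : bigraded F) (m : seq E -> E).
Hypothesis d2 : (2 <= d)%N.
Hypothesis mA : Ainf_algebra m.
Hypothesis conc : forall (p j : int) (x : E), bideg (p, j) x -> x <> 0 ->
  exists n : nat, p = n%:Z /\ (j = (Delta d n).1%:Z \/ j = (Delta d n).2%:Z).

Let mM : mult m := Ainf_multilinear mA.
Local Notation exacts := (forall2 (fun l i => exists k, i = exact_deg d k l)).

Lemma conc_exact i (x : E) : bideg i x -> x <> 0 -> exists k l, i = exact_deg d k l.
Proof.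
case: i => p j xi x0; have [n [-> jE]] := conc xi x0.
exact: Delta_exact jE.
Qed.

Lemma exact_sum ls ds : exacts ls ds -> exists K,
  \sum_(i <- ds) i = ((3 * K + \sum_(l <- ls) res_of l)%N%:Z,
                      (2 * d * K + \sum_(l <- ls) off_of d l)%N%:Z).
Proof.
elim: ls ds => [|l ls IH] [|i ds] //=.
  by move=> _; exists 0%N; rewrite !big_nil !muln0.
move=> [[k ->] /IH[K e]]; exists (k + K)%N; rewrite !big_cons e /exact_deg.
by bidegs.
Qed.

Lemma nonzero_entries s : m s <> 0 -> forall p x q, s = p ++ x :: q -> x <> 0.
Proof. by move=> ms p x q es x0; apply: ms; rewrite es x0 mult0. Qed.

Lemma labels ds (s : seq E) : homog ds s -> (forall p x q, s = p ++ x :: q -> x <> 0) ->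
  exists ls, exacts ls ds.
Proof.
elim: s ds => [|x s IH] [|i ds] //=; first by exists [::].
move=> [xi hs] nz; have [k [l il]] := conc_exact xi (nz [::] x s erefl).
have [|ls e] := IH ds hs; first by move=> p y q es; apply: (nz (x :: p) y q); rewrite es.
by exists (l :: ls); split => //; exists k.
Qed.

(** For [E0] and [E1] the piece fixes only the homological degree modulo 3; concentration of a
    nonzero x supplies the internal degree. *)
Lemma exact_piece l i (x : E) : bideg i x -> x <> 0 -> piece_deg d l i ->
  exists k, i = exact_deg d k l.
Proof.
move=> xi x0 [k il]; have [k' [l' e]] := conc_exact xi x0.
case: l il => il.
- by exists k'; rewrite e in il *; case: l' {e} il => //= il; exfalso; lia.
- by exists k'; rewrite e in il *; case: l' {e} il => //= il; exfalso; lia.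
- by exists k.
by exists k; rewrite il /exact_deg /=; congr (_, _); lia.
Qed.

Lemma labels_piece ls ds (s : seq E) : homog ds s -> (forall p x q, s = p ++ x :: q -> x <> 0) ->
  forall2 (piece_deg d) ls ds -> exacts ls ds.
Proof.
elim: s ls ds => [|x s IH] [|l ls] [|i ds] //=.
move=> [xi hs] nz [li lds]; split; first exact: exact_piece xi (nz [::] x s erefl) li.
by apply: IH hs _ lds => p y q es; apply: (nz (x :: p) y q); rewrite es.
Qed.

Lemma nonzero_table ls ds (s : seq E) : s <> [::] -> homog ds s -> exacts ls ds -> m s <> 0 ->
  has (fun e => perm_eq ls e.1) (reduced_table d).
Proof.
move=> s0 hs lds ms; have /eqP s0' := s0.
have [k [l e]] := conc_exact (Ainf_deg mA s0' hs) ms.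
have [K eK] := exact_sum lds; apply: (in_table_has d2).
have sz : size s = size ls by rewrite -(forall2_size hs) (forall2_size lds).
rewrite eK sz size_cnt !sum_cnt in e.
have e1 := congr1 fst e; have e2 := congr1 snd e.
rewrite ?(fstD, sndD) /= in e1 e2.
by apply: (table_arith d2 (l := l) (K := K) (L := k)); rewrite /=; lia.
Qed.

Lemma in_degrees0 (D : int * int -> Prop) : in_degrees D (0 : E).
Proof.
exists [::], (fun _ => 0); split=> //; first by move=> i; exact: (grading0 (bideg_grading E)).
by rewrite big_nil.
Qed.

Lemma in_degrees1 (D : int * int -> Prop) i (x : E) : D i -> bideg i x -> in_degrees D x.
Proof.
move=> Di xi; exists [:: i], (fun k => if k == i then x else 0); split.
- by move=> k; rewrite inE => /eqP ->.
- by move=> k; case: eqP => [-> //|_]; exact: (grading0 (bideg_grading E)).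
by rewrite big_seq1 eqxx.
Qed.

Lemma sum_fibers (I : eqType) (V : zmodType) (U s : seq I) (f : I -> V) :
  uniq U -> {subset s <= U} -> \sum_(i <- U) \sum_(k <- s | k == i) f k = \sum_(k <- s) f k.
Proof.
move=> uU sU; rewrite (exchange_big_dep predT) //=; apply: eq_big_seq => k ks.
rewrite big_mkcond (bigD1_seq k) //=; last exact: sU.
by rewrite eqxx big1 ?addr0 // => i; rewrite eq_sym => /negPf ->.
Qed.

Lemma in_degreesD (D : int * int -> Prop) (x y : E) :
  in_degrees D x -> in_degrees D y -> in_degrees D (x + y).
Proof.
move=> [s [f [sD fd ->]]] [t [g [tD gd ->]]].
have gE := bideg_grading E.
have fib (r : seq (int * int)) (f' : int * int -> E) i :
    (forall k, bideg k (f' k)) -> bideg i (\sum_(k <- r | k == i) f' k).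
  move=> f'd; elim/big_ind: _ => [||k /eqP <- //]; first exact: (grading0 gE).
  by move=> u v; exact: gradingD.
exists (undup (s ++ t)), (fun i => \sum_(k <- s | k == i) f k + \sum_(k <- t | k == i) g k).
split.
- by move=> i; rewrite mem_undup mem_cat => /orP[/sD|/tD].
- by move=> i; apply: (gradingD gE); exact: fib.
rewrite big_split /= !sum_fibers ?undup_uniq // => i.
  by rewrite mem_undup mem_cat => ->; rewrite orbT.
by rewrite mem_undup mem_cat => ->.
Qed.

Lemma reduced_of_concentrated : reduced d m.
Proof.
have K0D (x y : E) : x = 0 -> y = 0 -> x + y = 0 by move=> -> ->; rewrite addr0.
have sizes e : e \in reduced_table d -> size e.1 \in [:: 2; 3; 4; d; d.+1]%N.
  rewrite !inE; repeat (case/orP => [/eqP ->|]; first by rewrite /= ?size_nseq; lia).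
  by move=> /eqP ->; rewrite /= size_nseq; lia.
split.
- move=> k j x xi j1 j2; apply: contrapT => x0.
  have [k' [l e]] := conc_exact xi x0; case: l e => -[e1 e2]; rewrite /= in e1 e2.
  + by exfalso; lia.
  + by exfalso; lia.
  + have kk : k = k' by lia.
    by move: j1; rewrite e2 kk eqxx.
  have kk : k = k' by lia.
  by case/eqP: j2; rewrite e2 kk; lia.
- move=> s s0 sN.
  have sD : forall2 (fun D => @in_degrees F E D) (nseq (size s) (fun _ => True)) s.
    elim: (s) => //= x q IH; split=> //.
    by have [l [f [_ fd ->]]] := grading_sum (bideg_grading E) x; exists l, f.
  apply: (mult_pieces (K := fun x => x = 0) mM erefl K0D sD) => ds t ht dst.
  have st : size t = size s.
    by rewrite -(forall2_size ht) -(forall2_size dst) size_nseq.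
  apply: contrapT => mt; have nz := nonzero_entries mt.
  have [ls lds] := labels ht nz.
  have t0 : t <> [::] by move=> t0; move: s0; rewrite -size_eq0 -st t0.
  have /hasP[e eT pe] := nonzero_table t0 ht lds mt.
  have := sizes e eT; rewrite -(perm_size pe) (forall2_size lds) (forall2_size ht) st.
  by rewrite (negPf sN).
- move=> ls s e sD eT pe.
  have D0 := @in_degrees0 (residue_deg e.2).
  have sD' : forall2 (fun D => @in_degrees F E D) (map (piece_deg d) ls) s.
    by elim: (ls) (s) sD => [|l q IH] [|x r] //= [h /IH].
  apply: (mult_pieces mM D0 _ sD'); first exact: in_degreesD.
  move=> ds t ht lds; have {}lds : forall2 (piece_deg d) ls ds.
    by elim: (ls) (ds) lds => [|l q IH] [|x r] //= [h /IH].
  have [mt|mt] := pselect (m t = 0); first by rewrite mt.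
  have t0 : t <> [::].
    move=> t0; rewrite t0 in ht; have d0 := size0nil (forall2_size ht).
    rewrite d0 in lds; have l0 := size0nil (forall2_size lds).
    rewrite l0 in pe; have := perm_size pe; have := sizes e eT; rewrite /= => + e0.
    by rewrite -e0 !inE; lia.
  have lex := labels_piece ht (nonzero_entries mt) lds.
  have [K eK] := exact_sum lex; have [tab cnts] := table_in d2 eT pe.
  have /eqP t0' := t0; have := Ainf_deg mA t0' ht; rewrite eK => deg.
  apply: in_degrees1 deg; rewrite /residue_deg.
  have st : size t = size ls by rewrite -(forall2_size ht) (forall2_size lds).
  exists (K + (2 + cnt E2d ls + cnt E2d1 ls - cnt E0 ls - e.2) %/ 3)%N.
  rewrite fstD /= st sum_cnt; move: cnts tab; rewrite size_cnt /in_table /=.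
  set q := (_ %/ 3)%N; lia.
move=> ls s ls0 sD nT.
have sD' : forall2 (fun D => @in_degrees F E D) (map (piece_deg d) ls) s.
  by elim: (ls) (s) sD => [|l q IH] [|x r] //= [h /IH].
apply: (mult_pieces (K := fun x => x = 0) mM erefl K0D sD') => ds t ht lds.
have {}lds : forall2 (piece_deg d) ls ds.
  by elim: (ls) (ds) lds => [|l q IH] [|x r] //= [h /IH].
apply: contrapT => mt; case/negP: nT; apply: (nonzero_table _ ht _ mt).
  move=> t0; move: ls0; rewrite -size_eq0 (forall2_size lds) (forall2_size ht) t0.
  by [].
exact: labels_piece ht (nonzero_entries mt) lds.
Qed.

End Reducedness.

(** * Generation of Ext and the degrees of the generators *)

Section Decomposables.
Variables (F : fieldType) (A : gradedAlg F).
Hypothesis hgen : generated_in_degree1 A.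

Definition positive_part : set A := fspan (V := A) [set u : A | exists2 k, (0 < k)%N & gdeg k u].
Definition decomposable_part : set A := fspan (V := A) [set x : A | exists u v k l,
  [/\ (0 < k)%N, (0 < l)%N, gdeg k u, gdeg l v & x = u * v]].

Let sPos : subspace positive_part. Proof. exact: fspan_subspace. Qed.
Let sDec : subspace decomposable_part. Proof. exact: fspan_subspace. Qed.

Lemma positive_mul x y : positive_part x -> positive_part y -> decomposable_part (x * y).
Proof.
move=> px py.
apply: (px [set x | decomposable_part (x * y)]).
  split; first by rewrite /= mul0r; case: sDec.
  by move=> c u v du dv; rewrite /= mulrDl -scalerAl; apply: sDec.2.
move=> u [k k0 ku]; apply: (py [set y | decomposable_part (u * y)]).
  split; first by rewrite /= mulr0; case: sDec.
  by move=> c v w dv dw; rewrite /= mulrDr -scalerAr; apply: sDec.2.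
by move=> v [l l0 lv]; apply: sub_fspan; exists u, v, k, l.
Qed.

Lemma decomposable_positive x : decomposable_part x -> positive_part x.
Proof.
move=> dx; apply: (dx _ sPos) => _ [u [v [k [l [k0 l0 ku lv ->]]]]].
by apply: sub_fspan; exists (k + l)%N; [rewrite addn_gt0 k0|exact: gdegM].
Qed.

Lemma decomposable n a : (1 < n)%N -> gdeg n a -> decomposable_part a.
Proof.
move=> n1 an; have gA := gdeg_grading A.
(* Scalars, degree one and decomposables together form a subalgebra, hence all of A; projection to
   degree n > 1 keeps only the decomposable summand. *)
pose S : set A := [set x | exists (c : F) a1 D,
  [/\ gdeg 1 a1, decomposable_part D & x = c%:A + (a1 + D)]].
have D0 : decomposable_part 0 by case: sDec.
have pos1 x : gdeg 1 x -> positive_part x by move=> x1; apply: sub_fspan; exists 1%N.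
have pos x D : gdeg 1 x -> decomposable_part D -> positive_part (x + D).
  by move=> x1 dD; apply: (subspaceD sPos); [exact: pos1|exact: decomposable_positive].
have Sa : S a.
  apply: hgen => [|c x y|x y|x x1].
  - by exists 1, 0, 0; split=> //; [exact: (grading0 gA)|rewrite scale1r !addr0].
  - move=> [c1 [x1 [dx [hx1 hdx ->]]]] [c2 [y1 [dy [hy1 hdy ->]]]].
    exists (c * c1 + c2), (c *: x1 + y1), (c *: dx + dy); split.
    + by apply: gradingD => //; exact: gdegZ.
    + exact: sDec.2.
    rewrite scalerDl -scalerA !scalerDr addrACA; congr (_ + _); exact: addrACA.
  - move=> [c1 [x1 [dx [hx1 hdx ->]]]] [c2 [y1 [dy [hy1 hdy ->]]]].
    exists (c1 * c2), (c1 *: y1 + c2 *: x1), (c1 *: dy + c2 *: dx + (x1 + dx) * (y1 + dy)).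
    split; first by apply: gradingD => //; exact: gdegZ.
      apply: (subspaceD sDec); last by apply: positive_mul; apply: pos.
      by apply: (subspaceD sDec); apply: (subspaceZ _ sDec).
    rewrite mulrDl 2!(mulrDr _ c2%:A) -!scalerAl -!scalerAr !mulr1 !mul1r scalerA.
    rewrite -!addrA !scalerDr -!addrA; congr (_ + (_ + _)); exact: addrCA.
  by exists 0, x, 0; split=> //; rewrite scale0r add0r addr0.
have [p [pV pB pid p0 _]] := grading_proj gA.
have pD i x y : p i (x + y) = p i x + p i y.
  by have := pB i (x + y) y; rewrite addrK => ->; rewrite subrK.
have p00 i : p i 0 = 0 by apply: (@addrI _ (p i 0)); rewrite -pD !addr0.
have pZ i (c : F) x : p i (c *: x) = c *: p i x.
  move: x; apply: (grading_ind gA) => [|x y e1 e2|k x xk].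
  - by rewrite scaler0 p00 scaler0.
  - by rewrite scalerDr !pD e1 e2 scalerDr.
  have cx : gdeg k (c *: x) by exact: gdegZ.
  have [->|ik] := eqVneq i k; first by rewrite !pid.
  by rewrite (p0 _ _ _ cx ik) (p0 _ _ _ xk ik) scaler0.
have [c [a1 [D [ha1 hD ae]]]] := Sa.
rewrite -(pid _ _ an) ae !pD (p0 n 0%N); [|exact: gdegZ (gdeg1 A)|by case: (n) n1].
rewrite (p0 n 1%N) // ?add0r; last by case: (n) n1 => [|[|?]].
have sK : subspace [set x | decomposable_part (p n x)].
  split; first by rewrite /= p00.
  by move=> c' x y dx dy; rewrite /= pD pZ; apply: sDec.2.
apply: (hD _ sK) => _ [u [v [k [l [k0 l0 ku lv ->]]]]] /=.
have uv := gdegM ku lv; have [->|ne] := eqVneq n (k + l)%N.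
  by rewrite pid //; apply: sub_fspan; exists u, v, k, l.
by rewrite (p0 _ _ _ uv ne).
Qed.

End Decomposables.

(** * Detecting generators by the operations *)

Section Degrees.
Variables (F : fieldType) (A : gradedAlg F) (P : free_resolution A) (B : set P) (one : P).
Hypothesis hgen : generated_in_degree1 A.
Hypothesis hconn : connected A.
Hypothesis hmin : minimal P.
Hypothesis homB : forall b, B b -> exists i, rdeg P i b.
Hypothesis basB : is_basis B.
Hypothesis B1 : B one.
Hypothesis deg1 : rdeg P (0, 0) one.
Hypothesis aug1 : raug P one = 1.
Hypothesis bot : forall b j, B b -> rdeg P (0, j) b -> b = one.
Local Notation E := (functional P).
Local Notation homw := (forall2 (@fdeg F A P)).
Local Notation d := (rdiff P).

Let dual_ex := dual_functional basB aug1.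

Lemma basis_neq0 b : B b -> b <> 0.
Proof.
move=> Bb b0; have [x xE] := dual_ex b; have := xE _ Bb.
by rewrite eqxx {1}b0 functional0 => /esym/eqP; rewrite oner_eq0.
Qed.

Lemma basis_deg_uniq b i i' : B b -> rdeg P i b -> rdeg P i' b -> i = i'.
Proof.
move=> Bb bi bi'; apply/eqP; apply: contra_notT (basis_neq0 Bb) => ne.
exact: grading_neq (rdeg_grading P) bi bi' ne.
Qed.

Lemma basis_not_boundary b y : B b -> b <> d y.
Proof.
move=> Bb by'; have [x xE] := dual_ex b; have := xE _ Bb.
by rewrite eqxx {1}by' functional_diff // => /esym/eqP; rewrite oner_eq0.
Qed.

Lemma bottom_low j z : j < 0 -> rdeg P (0, j) z -> z = 0.
Proof.
move=> j0; move: z; apply: (rdeg_ind homB basB) => // [x y -> ->|k j' a b Bb bn ka kj].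
  by rewrite addr0.
have e := bot Bb bn; rewrite e in bn; case: (basis_deg_uniq B1 bn deg1) => j'0.
by lia.
Qed.

Lemma bottom_generated (k : nat) z : rdeg P (0, k%:Z) z -> exists2 a, gdeg k a & z = a *: one.
Proof.
move: z; apply: (rdeg_ind homB basB) => [|x y [a ka ->] [b kb ->]|l j' a b Bb bn la lj].
- by exists 0; [exact: (grading0 (gdeg_grading A))|rewrite scale0r].
- by exists (a + b); [exact: (gradingD (gdeg_grading A))|rewrite scalerDl].
have e := bot Bb bn; rewrite e in bn *; case: (basis_deg_uniq B1 bn deg1) => j'0.
have <- : l = k by lia.
by exists a.
Qed.

(* For v in degree (1, j) with j > 1, decomposability of the coefficient a of
   [d v = a *: one] puts v in A_{>=1} P_1 + Im d, against minimality. *)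
Lemma degree1 v j : B v -> rdeg P (1, j) v -> j = 1.
Proof.
move=> Bv v1; have dv0 : d v <> 0.
  by move=> /(res_exact ltr01 v1)[y]; exact: basis_not_boundary.
have := rdiff_deg v1; rewrite subrr => dv.
case: j v1 dv => [k|k] v1 dv; last by case: dv0; exact: bottom_low dv.
have [a ka dvE] := bottom_generated dv.
case: k ka v1 dv => [|[//|k]] ka v1 dv.
  have [c ac] := hconn ka; case: dv0; rewrite dvE ac.
  have := raug_diff v; rewrite dvE ac raugZ aug1 mulr1 => ->.
  by rewrite scale0r scale0r.
have [x xE] := dual_ex v.
pose T : set A := [set a | exists y, [/\ a *: one = d y, x y = 0 & raug P y = 0]].
have sT : subspace T.
  split; first by exists 0; rewrite scale0r linear0 functional0 raug0.
  move=> c a1 a2 [y1 [e1 x1 r1]] [y2 [e2 x2 r2]]; exists (c%:A *: y1 + y2).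
  have [_ xZ _] := functionalP x.
  by rewrite functionalD raugD xZ raugZ x1 x2 r1 r2 mulr0 addr0 linearD linearZ /= -e1 -e2
    scalerA mulr_algl scalerDl.
have Ta : T a.
  apply: (decomposable hgen (n := k.+2)) => // _ [u [w [l [m [l0 m0 lu mw ->]]]]].
  have := rdegZ mw deg1; rewrite addr0 => w1.
  have [_ _ r0] := raug_triv P; have [_ _ x0] := functionalP x.
  have [y ye] := res_exact0 w1 (r0 _ _ one m0 mw).
  exists (u *: y); rewrite (x0 _ _ _ l0 lu) (r0 _ _ _ l0 lu) linearZ /= -ye scalerA.
  by [].
have [y [e x0 r0]] := Ta.
have [||w we] := res_exactness (x := v - y).
- by rewrite linearB /= dvE e subrr.
- by rewrite raugD raugN r0 subr0 (raug_deg _ v1).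
have := functional_diff hmin x w.
rewrite -we functionalD functionalN x0 subr0 xE // eqxx => /eqP.
by rewrite oner_eq0.
Qed.

Lemma first_low j z : j < 1 -> rdeg P (1, j) z -> z = 0.
Proof.
move=> j1; move: z; apply: (rdeg_ind homB basB) => // [x y -> ->|k j' a b Bb bn ka kj].
  by rewrite addr0.
by have := degree1 Bb bn; lia.
Qed.

Lemma coordinates : exists L : P -> {linear P -> A^o},
  (forall t b, B t -> B b -> L t b = (b == t)%:R) /\
  forall u, (forall t, B t -> L t u = 0) -> u = 0.
Proof.
have [L LE] := choice (fun t => basis_lift basB (fun b => (b == t)%:R : A^o)).
exists L; split=> [t b Bt Bb|u Lu]; first exact: LE.
have [s [c [us sB ue]]] := basis_expand basB u; rewrite ue big_seq big1 // => t ts.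
have := Lu _ (sB _ ts); rewrite ue linear_sum (bigD1_seq t) //= big1_seq => [|b /andP[bt bs]].
  by rewrite linearZ /= LE ?eqxx ?addr0; [rewrite -[_ *: _]/(_ * _) mulr1 => ->; rewrite scale0r|exact: sB].
by rewrite linearZ /= LE ?(negPf bt) ?scaler0 //; exact: sB.
Qed.

Variables (tau : {linear P -> P}) (phi : seq E -> {linear P -> P}).
Hypothesis tw : twisting B one tau phi.
Local Notation bop := (bop tau phi).
Local Notation si := (si tau).
Let tauE := tw_tau tw.

Lemma higher_bottom ds s i z : (1 < size s)%N -> homw ds s -> rdeg P i z ->
  i.1 = (wdeg ds).1 + 1 -> phi s z = 0.
Proof.
case: i => n j s1 dss + i1; move: z; apply: (rdeg_ind homB basB) => [|x y e1 e2|k j' a b Bb bn ka kj].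
- by rewrite linear0.
- by rewrite linearD e1 e2 addr0.
rewrite linearZ /= (tw_bottom tw _ dss Bb bn i1); last by case: (s) s1.
by case: (s) s1 => [|x [|y s']] //= _; rewrite scaler0.
Qed.

Definition dual (i : int * int) (x : E) := exists t, [/\ B t, rdeg P i t &
  forall b, B b -> x b = (b == t)%:R].

Lemma dual_deg i x : dual i x -> fdeg i x.
Proof. by case=> t [Bt it xE]; exact: (dual_functional_deg hconn homB basB it xE). Qed.

(** By [tw_bottom], [phi [:: si x]] on P_q multiplies [one] by the A-coordinate dual to x, up to
    sign. So it sees all of u, whereas x itself sees only u modulo A_{>=1} P. *)
Lemma dual_detect q l u : rdeg P (q, l) u ->
  (forall x j, dual (q, j) x -> phi [:: si x] u = 0) -> u = 0.
Proof.
move=> ul hu; have [L [LE L0]] := coordinates; apply: L0 => t Bt.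
have [[j tq]|ntq] := pselect (exists j, rdeg P (q, j) t); last first.
  move: u ul {hu}; apply: (rdeg_ind homB basB) => [|x y e1 e2|k j' a b Bb bn ka kj].
  - by rewrite linear0.
  - by rewrite linearD e1 e2 addr0.
  rewrite linearZ /= LE //; case: eqP => [bt|]; last by rewrite scaler0.
  by case: ntq; exists j'; rewrite -bt.
have [x xE] := dual_ex t; have xD : dual (q, j) x by exists t.
have key : forall z, rdeg P (q, l) z -> phi [:: si x] z = ((L t z : A) * sign A q) *: one.
  apply: (rdeg_ind homB basB) => [|y z e1 e2|k j' a b Bb bn ka kj].
  - by rewrite !linear0 mul0r scale0r.
  - by rewrite !linearD e1 e2 mulrDl scalerDl.
  rewrite !linearZ /= (tw_bottom tw (ds := [:: (q, j)]) _ _ Bb bn) //; last 2 first.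
  - by split=> //; apply: (fdeg_si tauE); exact: dual_deg.
  - by rewrite wdeg_cons wdeg_nil /=; lia.
  rewrite /base siE opprK (tauE bn) LE // -[a *: _]/(a * _) -mulrA scalerA; congr ((_ * _) *: _).
  rewrite sign_scale; have [_ xZ _] := functionalP x; rewrite xZ xE //.
  by case: eqP => _; rewrite ?mulr1 ?mul1r ?mulr0 ?mul0r ?scale0r.
have := hu x j xD; rewrite key // => e.
have := basB.2 [:: one] (fun=> (L t u : A) * sign A q) isT.
rewrite big_seq1 => /(_ _ e one (mem_head _ _)) => H.
have {}H : (L t u : A) * sign A q = 0.
  by apply: H => b; rewrite inE => /eqP ->.
by rewrite -[L t u](mulr1 (_ : A)) -[X in _ * X](sign2 A q) mulrA H mul0r.
Qed.

(** The curvature at v lies in P_0, where words of two or more letters take no values by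
    [higher_bottom]. The one-letter insertion is b of the whole word at v, zero by assumption; the
    two displayed terms remain. *)
Lemma flat_top v i ds x s : B v -> rdeg P i v -> homw ds (x :: s) ->
  i.1 = (wdeg ds).1 + 2 -> bop (x :: s) v = 0 ->
  d (phi (x :: s) v) + phi [:: si x] (phi s v) = 0.
Proof.
move=> Bv iv dss i1 bv.
have spl_tail : spl (fun u w => phi (map si (x :: u)) (phi w v)) s = phi [:: si x] (phi s v).
  apply: spl_first => y u w es; rewrite es in dss.
  have [du [dw [eds hu hw]]] := forall2_split (u := x :: y :: u) dss.
  apply: (higher_bottom (ds := du) _ _ (tw_deg tw hw iv)) => //.
    exact: (wordsi tauE hu).
  by rewrite /= i1 eds wdeg_cat fstD; lia.
have ins_tail : ins bop si (fun w => phi w v) (x :: s) = 0.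
  apply: ins0 => p m q es m0; rewrite es in dss.
  have [dp [dr [edp hp /forall2_split[dm [dq [edr hm hq]]]]]] := forall2_split dss.
  have hb := bop_deg tauE (tw_deg tw) m0 hm.
  have dw := forall2_cat (wordsi tauE hp) (conj hb hq : homw (_ :: dq) (_ :: q)).
  have dwE : i.1 = (wdeg (dp ++ wdeg dm + (2, 0) :: dq)).1 + 1.
    by rewrite i1 edp edr !wdeg_cat wdeg_cons !fstD /=; lia.
  have [pq|pq] := ltnP 1 (size (map si p ++ bop m :: q)).
    exact: (higher_bottom pq dw iv).
  rewrite (tw_bottom tw _ dw Bv iv dwE); last by case: (p).
  case: p es pq {dss hp dw} => [|y p] /=; last by rewrite size_cat /= addnS.
  case: q {hq} => [|y q] //= es _; move: es; rewrite cats0 => <-.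
  by rewrite bv oppr0 scale0r scale0r.
have := tw_flat tw (x :: s) v; rewrite /Omega ins_tail addr0 /=.
by rewrite spl_tail (tw_nil tw).
Qed.

Lemma duals_homog s : (forall x, x \in s -> dual (1, 1) x) -> homw (nseq (size s) (1, 1)) s.
Proof.
elim: s => //= x s IH hs; split; first by apply: dual_deg; apply: hs; rewrite mem_head.
by apply: IH => y ys; apply: hs; rewrite inE ys orbT.
Qed.

Lemma wdeg_nseq k : wdeg (nseq k (1, 1)) = (0, k%:Z).
Proof.
elim: k => [|k IH]; first by rewrite wdeg_nil.
by rewrite /= wdeg_cons IH; apply: bideg_eq; rewrite ?(fstD, sndD) /=; lia.
Qed.

(* If all the b_r(x_1, ..., x_{r-1}, y) with x_i dual to P_1 and y dual to P_{n+1}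
   vanished at v, the flatness relations would give phi [:: y] v = 0 by descending
   induction on r, hence d v = 0. *)
Lemma generation (n : nat) v j : B v -> rdeg P (n.+2%:Z, j) v ->
  (forall y j', dual (n.+1%:Z, j') y -> 0 <= j') ->
  exists s y j', [/\ s <> [::], forall x, x \in s -> dual (1, 1) x,
    dual (n.+1%:Z, j') y & bop (rcons s y) v <> 0].
Proof.
move=> Bv vn low; apply: contrapT => nex.
have words (s : seq E) y j' : (forall x, x \in s -> dual (1, 1) x) -> dual (n.+1%:Z, j') y ->
    homw (nseq (size s) (1, 1) ++ [:: (n.+1%:Z, j')]) (rcons s y).
  move=> hs hy; rewrite -cats1; apply: forall2_cat; first exact: duals_homog.
  by split=> //; exact: dual_deg hy.
have wdegs k j' : wdeg (nseq k (1, 1) ++ [:: (n.+1%:Z, j')]) = (n%:Z, k%:Z + j').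
  rewrite wdeg_cat wdeg_nseq wdeg_cons wdeg_nil; apply: bideg_eq.
    by rewrite !fstD /=; lia.
  by rewrite !sndD /=; lia.
have bv0 (s : seq E) y j' : (forall x, x \in s -> dual (1, 1) x) -> dual (n.+1%:Z, j') y ->
    bop (rcons s y) v = 0.
  case: s => [|x s] hs hy; last by apply: contrapT => ne; apply: nex; exists (x :: s), y, j'.
  by rewrite bopE (tw_nil tw) (tau_diff tauE) functionalN functional_diff ?oppr0.
have top (s : seq E) y j' x : (forall z, z \in x :: s -> dual (1, 1) z) -> dual (n.+1%:Z, j') y ->
    d (phi (x :: rcons s y) v) + phi [:: si x] (phi (rcons s y) v) = 0.
  move=> hs hy; have := @flat_top v _ _ x (rcons s y) Bv vn (words (x :: s) y j' hs hy) _ (bv0 (x :: s) y j' hs hy).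
  apply.
  by rewrite wdegs /=; lia.
(* The descent starts once s has at least |j| letters: the value then has internal degree j - |s| -
   j' <= 0, while P_1 starts in internal degree 1. N bounds the number of letters still missing. *)
have zero N : forall (s : seq E) y j', (forall x, x \in s -> dual (1, 1) x) -> dual (n.+1%:Z, j') y ->
    (absz j <= size s + N)%N -> phi (rcons s y) v = 0.
  elim: N => [|N IH] s y j' hs hy jN.
    have := tw_deg tw (words _ _ _ hs hy) vn; rewrite wdegs.
    set k := (X in rdeg P X _) => pk.
    have ek : k = (1, j - (size s)%:Z - j').
      by apply: bideg_eq; rewrite /k ?(fstD, fstN, sndD, sndN) /=; lia.
    by rewrite ek in pk; apply: first_low pk; have := low _ _ hy; lia.
  have := tw_deg tw (words _ _ _ hs hy) vn; rewrite wdegs.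
  set k := (X in rdeg P X _) => pk.
  have ek : k = (1, j - (size s)%:Z - j').
    by apply: bideg_eq; rewrite /k ?(fstD, fstN, sndD, sndN) /=; lia.
  rewrite ek in pk; apply: (dual_detect pk) => x j1 hx.
  have hxs : forall z, z \in x :: s -> dual (1, 1) z.
    move=> z; rewrite inE => /orP[/eqP ->|/hs //].
    by case: hx => t [Bt t1 xt]; have e := degree1 Bt t1; rewrite e in t1; exists t.
  have := top _ _ _ _ hxs hy; rewrite (IH (x :: s) _ _ hxs hy) ?linear0 ?add0r //=.
  by rewrite addSn -addnS.
(* With an empty tail, [flat_top] turns phi(y) v = 0 into the vanishing of [phi [:: si y]] at d v,
   for every dual y. *)
have dv : d v = 0.
  have := rdiff_deg vn; rewrite -[X in X - 1]/(n.+2%:Z) -addn1 PoszD addrK => dvn.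
  apply: (dual_detect dvn) => y j' hy.
  have := @flat_top v _ [:: (n.+1%:Z, j')] y [::] Bv vn (conj (dual_deg hy) I).
  rewrite (tw_nil tw) (zero (absz j) [::] y j') ?linear0 ?add0r ?add0n //.
  apply; first by rewrite wdeg_cons wdeg_nil /=; lia.
  exact: (bv0 [::] _ _ _ hy).
by have [|y /(basis_not_boundary Bv)//] := res_exact _ vn dv; lia.
Qed.

End Degrees.

(** * Reducedness determines the degrees of the generators *)

Section Converse.
Variables (F : fieldType) (A : gradedAlg F) (P : free_resolution A) (B : set P) (one : P).
Hypothesis hgen : generated_in_degree1 A.
Hypothesis hconn : connected A.
Hypothesis hmin : minimal P.
Hypothesis homB : forall b, B b -> exists i, rdeg P i b.
Hypothesis basB : is_basis B.
Hypothesis B1 : B one.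
Hypothesis deg1 : rdeg P (0, 0) one.
Hypothesis aug1 : raug P one = 1.
Hypothesis bot : forall b j, B b -> rdeg P (0, j) b -> b = one.
Variable d : nat.
Hypothesis d2 : (2 <= d)%N.
Hypothesis reducedP : forall m : seq (Ext P) -> Ext P, Ext_Ainf_structure m -> reduced d m.
Local Notation E := (functional P).
Local Notation homw := (forall2 (@fdeg F A P)).
Local Notation dual := (dual B).

Lemma reduced_degrees (n : nat) v j : B v -> rdeg P (n%:Z, j) v ->
  j = (Delta d n).1%:Z \/ j = (Delta d n).2%:Z.
Proof.
have [tau [phi tw]] := exists_twisting hconn hmin homB basB B1 deg1 aug1.
have [rho [rhoL rhoI rhoR rhoD rhoS]] := ext_functional hmin.
have [m mE] := operations tw rhoL rhoD rhoS.
have red := reducedP (Ext_structure hmin tw rhoL rhoI rhoR rhoD rhoS mE).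
have rho00 := rho0 rhoL.
have lift i x : dual i x -> exists2 xi, rho xi = x & bideg i xi.
  move=> /(dual_deg hconn homB basB) ix; have [xi e] := rhoS _ (fdeg_cochain ix).
  by exists xi => //; apply/rhoD; rewrite e.
have words (s : seq E) : (forall x, x \in s -> dual (1, 1) x) -> exists2 xs, map rho xs = s &
    homog (nseq (size s) (1, 1)) xs /\ forall2 (fun l => in_degrees (piece_deg d l)) (nseq (size s) E1) xs.
  elim: s => [|x s IH] hs; first by exists [::].
  have [|xs e [h1 h2]] := IH; first by move=> z zs; apply: hs; rewrite inE zs orbT.
  have [xi ex ixi] := lift _ _ (hs x (mem_head _ _)).
  exists (xi :: xs); first by rewrite /= ex e.
  by split; split=> //; apply: in_degrees1 ixi; exists 0%N.
(* Under rho, m is b up to sign on homogeneous words, so a nonzero b puts its word into the table;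
   the degree of b gives the internal degree of the generator at which it is nonzero. *)
have table v' (s : seq E) y n' j' j'' l : rdeg P (n'%:Z + 1, j'') v' -> s <> [::] ->
    (forall x, x \in s -> dual (1, 1) x) -> dual (n'%:Z, j') y -> piece_deg d l (n'%:Z, j') ->
    bop tau phi (rcons s y) v' <> 0 ->
    j'' = (size s)%:Z + j' /\
    has (fun e => perm_eq (rcons (nseq (size s) E1) l) e.1) (reduced_table d).
  move=> vn s0 hs hy ly ne.
  have dw : homw (nseq (size s) (1, 1) ++ [:: (n'%:Z, j')]) (rcons s y).
    rewrite -cats1; have hds := duals_homog hconn homB basB hs; apply: forall2_cat; first by [].
    by split=> //; exact: (dual_deg hconn homB basB hy).
  split.
    apply: contrapT => /eqP ne'; apply: ne.
    apply: (bop_deg (tw_tau tw) (tw_deg tw) _ dw) vn; first by case: (s).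
    rewrite wdeg_cat wdeg_nseq wdeg_cons wdeg_nil; apply: contra ne' => /eqP e.
    by have := congr1 snd e; rewrite !sndD /=; lia.
  apply: contrapT => /negP nt; apply: ne.
  have [xs exs [h1 h2]] := words _ hs; have [eta ey ieta] := lift _ _ hy.
  have hom : homog (nseq (size s) (1, 1) ++ [:: (n'%:Z, j')]) (xs ++ [:: eta]).
    by apply: forall2_cat.
  have m0 : m (xs ++ [:: eta]) = 0.
    apply: (reduced_zero red _ _ nt); first by case: (size s).
    by rewrite -cats1; apply: forall2_cat => //; split=> //; exact: in_degrees1 ly ieta.
  have := m_homog tw rhoD mE hom; rewrite m0 rho00 map_cat exs /= ey !cats1.
  move/(congr1 (fun w : E => w v')); rewrite fval0 fvalN fvalZ => /esym/eqP.
  by rewrite oppr_eq0 /sign mulf_eq0 signr_eq0 /= => /eqP.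
elim: n v j => [|[|n] IH] v j Bv vn.
- have e := bot Bv vn; rewrite e in vn; left.
  by case: (basis_deg_uniq basB aug1 B1 vn deg1) => ->; rewrite /Delta div0n muln0.
- by left; rewrite (degree1 hgen hconn hmin homB basB B1 deg1 aug1 bot Bv vn) /Delta divn_small // muln0.
have low y j' : dual (n.+1%:Z, j') y -> 0 <= j'.
  by case=> t [Bt tn _]; case: (IH t j' Bt tn) => ->.
have := divn_eq n.+2 3; have : (n.+2 %% 3 < 3)%N by exact: ltn_pmod.
set k := (n.+2 %/ 3)%N; set r := (n.+2 %% 3)%N => r3 nE.
have [x xE] := dual_functional basB aug1 v.
case: (eqVneq r 2%N) => [r2|r2].
  have [|xi ex ixi] := lift (n.+2%:Z, j) x; first by exists v.
  have kn : (3 * k + 2 = n.+2)%N by lia.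
  rewrite /Delta -/r -/k r2; apply: contrapT => /not_orP[j1 j2].
  have xi0 : xi = 0.
    by apply: (reduced_E2 red (k := k) (j := j)); rewrite ?kn //; apply/eqP.
  by have := xE v Bv; rewrite -ex xi0 rho00 eqxx fval0 => /esym/eqP; rewrite oner_eq0.
have [s [y [j' [s0 hs hy ne]]]] :=
  generation hgen hconn hmin homB basB B1 deg1 aug1 bot tw Bv vn low.
have jE : j' = (Delta d n.+1).1%:Z \/ j' = (Delta d n.+1).2%:Z.
  by case: (hy) => t [Bt tn _]; exact: IH tn.
have sz : (0 < size s)%N by case: (s) s0.
have vn' : rdeg P (n.+1%:Z + 1, j) v by rewrite -PoszD addn1.
have [r0|r1] : r = 0%N \/ r = 1%N by lia.
  (* Here y has homological degree 3q + 2. Next to [E2d] the table allows d factors [E1], next to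
     [E2d1] it allows d - 1; in both cases j = 2dq + 2d = 2dk. *)
  have [q kq] : exists q, k = q.+1 by exists k.-1; lia.
  have yl : exists l, [/\ l = E2d \/ l = E2d1, piece_deg d l (n.+1%:Z, j') &
      j' = (2 * d * q + off_of d l)%N%:Z].
    move: jE; rewrite /Delta.
    have -> : (n.+1 %/ 3 = q)%N by lia.
    have -> : (n.+1 %% 3 = 2)%N by lia.
    case=> e; [exists E2d|exists E2d1]; split; rewrite ?e /=; try (by auto); try lia.
      by exists q; congr (_, _); lia.
    by exists q; congr (_, _); lia.
  have [l [hl ly j'E]] := yl.
  have [jE' /hasP[e eT pe]] := table _ _ _ _ _ _ _ vn' s0 hs hy ly ne.
  have [tab _] := table_in d2 eT pe.
  move: tab; rewrite /cnt -cats1 !count_cat !count_nseq /in_table /Delta -/k -/r r0 kq jE' j'E.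
  by case: hl => -> /=; lia.
(* Now y lies in [E0], which the table combines with a single [E1] and no further [E1], so j = 2dk +
   1. *)
have ly : piece_deg d E0 (n.+1%:Z, j') by exists k; rewrite /=; lia.
have j'E : j' = (2 * d * k)%N%:Z.
  move: jE; rewrite /Delta.
  have -> : (n.+1 %/ 3 = k)%N by lia.
  have -> : (n.+1 %% 3 = 0)%N by lia.
  by case.
have [jE' /hasP[e eT pe]] := table _ _ _ _ _ _ _ vn' s0 hs hy ly ne.
have [tab _] := table_in d2 eT pe.
move: tab; rewrite /cnt -cats1 !count_cat !count_nseq /in_table /Delta -/k -/r r1 jE' j'E /=.
lia.
Qed.

Lemma bi_Koszul_of_reduced : bi_Koszul d A.
Proof.
exists P; split=> // n j x; apply: (rdeg_ind homB basB).
- by exists [::]; rewrite big_nil.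
- move=> y z [s [sP ->]] [t [tP ->]]; exists (s ++ t); rewrite big_cat; split=> // e.
  by rewrite mem_cat => /orP[/sP|/tP].
move=> k j' a b Bb bn _ _; exists [:: (a, b)]; rewrite big_seq1; split=> // e.
rewrite inE => /eqP -> /=.
by case: (reduced_degrees Bb bn) => jE; rewrite jE in bn; [exists (Delta d n).1|exists (Delta d n).2];
  rewrite ?inE ?eqxx ?orbT.
Qed.

End Converse.

Theorem corollary2p7 (F : fieldType) (A : gradedAlg F)
    (hfin : locally_finite A) (hconn : connected A)
    (hgen : generated_in_degree1 A) (d : nat) (hd : (2 <= d)%N) :
  bi_Koszul d A <->
  (forall (P : free_resolution A) (m : seq (Ext P) -> Ext P),
     Ext_Ainf_structure m -> reduced d m).
Proof.
split=> [bK P m [mA _ _]|red].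
  apply: (reduced_of_concentrated hd mA) => p j x xp x0.
  exact: (ext_concentrated hconn bK xp x0).
have [P [B [one [hmin [homB basB] [B1 deg1 aug1] bot]]]] := minimal_resolution hconn.
exact: (bi_Koszul_of_reduced hgen hconn hmin homB basB B1 deg1 aug1 bot hd (red P)).
Qed.
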